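(* Let $R$ be an associative ring with identity, and let $\mathbf{K}^{\mathcal{F}}$ denote the class of flat left $R$-modules with pure embeddings. The following are equivalent. (1) Every $(\lambda, \alpha)$-limit model in $\mathbf{K}^{\mathcal{F}}$ with $\lambda \geq (|R| + \aleph_0)^+$ and $\operatorname{cf}(\alpha)\geq (|R| + \aleph_0)^+$ is pure-injective. (2) The pure-injective envelope of every flat left $R$-module is flat.
   Context: $\mathbf{K}^{\mathcal{F}} = (K_{flat}, \leq_{pp})$, where $K_{flat}$ is the class of flat left $R$-modules and $\leq_{pp}$ is the pure submodule relation. $\mathbf{K}^{\mathcal{F}}_{\lambda}$ is the class of flat left $R$-modules of cardinality $\lambda$, and $\mathbf{K}^{\mathcal F}_{\leq\lambda}$ those of cardinality at most $\lambda$. A pure embedding $f: M \to N$ is an isomorphism from $M$ onto a pure submodule of $N$. For $N \leq_{pp} M$ in $\mathbf{K}^{\mathcal{F}}$, $M$ is universal over $N$ if $|M| = |N|=\lambda$ (cardinalities) and for every $N^* \in \mathbf{K}^{\mathcal{F}}_{\leq \lambda}$ with $N \leq_{pp} N^*$ there is a pure embedding $f: N^* \to M$ fixing $N$ pointwise. Let $\lambda$ be an infinite cardinal and $\alpha < \lambda^+$ a limit ordinal. $M$ is a $(\lambda,\alpha)$-limit model if there is a $\leq_{pp}$-increasing continuous chain $\{M_i : i < \alpha\} \subseteq \mathbf{K}^{\mathcal{F}}_\lambda$ (continuous: unions at limit stages) such that $M_{i+1}$ is universal over $M_i$ for each $i<\alpha$, and $M = \bigcup_{i<\alpha} M_i$.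 *)

(* Defs.v *)
From HB Require Import structures.
From mathcomp Require Import all_boot all_order all_algebra.
From mathcomp Require Import boolp classical_sets functions cardinality wochoice.
From mathcomp Require Import freeg.

Set Implicit Arguments.
Unset Strict Implicit.
Unset Printing Implicit Defensive.

Import GRing.Theory.
Local Open Scope ring_scope.
Local Open Scope card_scope.
Local Open Scope classical_set_scope.
Local Open Scope quotient_scope.

(* A left R-module is an [lmodType R]; a right R-module is an [lmodType R^c],
   where the right action a.r is written [(r : R^c) *: a]. *)

Section Tensor.
Variables (R : pzRingType) (A : lmodType R^c) (M : lmodType R).

(* The subgroup of the free abelian group on A x M generated by the
   bilinearity and balancing relations. *)
Inductive tensor_null : {freeg (A * M)%type / int} -> Prop :=
| tensor_null_addl a a' m :
    tensor_null (<< (a + a', m) >> - << (a, m) >> - << (a', m) >>)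
| tensor_null_addr a m m' :
    tensor_null (<< (a, m + m') >> - << (a, m) >> - << (a, m') >>)
| tensor_null_bal (r : R) a m :
    tensor_null (<< ((r : R^c) *: a, m) >> - << (a, r *: m) >>)
| tensor_null0 : tensor_null 0
| tensor_nullB x y : tensor_null x -> tensor_null y -> tensor_null (x - y).

Definition tensor_eq (x y : {freeg (A * M)%type / int}) : bool :=
  `[< tensor_null (x - y) >].

Lemma tensor_nullN x : tensor_null x -> tensor_null (- x).
Proof. by move=> hx; rewrite -[- x]add0r; apply: tensor_nullB => //; apply: tensor_null0. Qed.

Lemma tensor_nullD x y : tensor_null x -> tensor_null y -> tensor_null (x + y).
Proof. by move=> hx hy; rewrite -[y]opprK; apply: tensor_nullB => //; apply: tensor_nullN. Qed.

Lemma tensor_eq_refl : reflexive tensor_eq.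
Proof. by move=> x; apply/asboolP; rewrite subrr; apply: tensor_null0. Qed.

Lemma tensor_eq_sym : symmetric tensor_eq.
Proof.
by move=> x y; apply/asboolP/asboolP => /tensor_nullN; rewrite opprB.
Qed.

Lemma tensor_eq_trans : transitive tensor_eq.
Proof.
move=> y x z /asboolP hxy /asboolP hyz; apply/asboolP.
by rewrite -(subrKA y); apply: tensor_nullD.
Qed.

Canonical tensor_equiv :=
  EquivRel tensor_eq tensor_eq_refl tensor_eq_sym tensor_eq_trans.
Canonical tensor_equiv_direct := defaultEncModRel tensor_eq.

Definition tensor : Type := {eq_quot tensor_eq}.

HB.instance Definition _ := Choice.on tensor.
HB.instance Definition _ := Quotient.on tensor.
HB.instance Definition _ : EqQuotient _ tensor_eq tensor := EqQuotient.on tensor.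

Lemma pi_tensorP x y : \pi_tensor x = \pi_tensor y <-> tensor_null (x - y).
Proof.
split=> [/eqP|h]; first by rewrite eqmodE => /asboolP.
by apply/eqP; rewrite eqmodE; apply/asboolP.
Qed.

Definition tensor_zero : tensor := \pi_tensor 0.
Definition tensor_add := lift_op2 tensor +%R.
Definition tensor_opp := lift_op1 tensor -%R.

Lemma pi_tensor_opp : {morph \pi : x / - x >-> tensor_opp x}.
Proof.
move=> x; unlock tensor_opp; apply/pi_tensorP; rewrite -opprD.
by apply/tensor_nullN/pi_tensorP; rewrite reprK.
Qed.
Canonical pi_tensor_opp_morph := PiMorph1 pi_tensor_opp.

Lemma pi_tensor_add : {morph \pi : x y / x + y >-> tensor_add x y}.
Proof.
move=> x y; unlock tensor_add; apply/pi_tensorP; rewrite opprD addrACA.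
by apply: tensor_nullD; apply/pi_tensorP; rewrite reprK.
Qed.
Canonical pi_tensor_add_morph := PiMorph2 pi_tensor_add.

Lemma tensor_addA : associative tensor_add.
Proof. by elim/quotW=> x; elim/quotW=> y; elim/quotW=> z; rewrite !piE addrA. Qed.
Lemma tensor_addC : commutative tensor_add.
Proof. by elim/quotW=> x; elim/quotW=> y; rewrite !piE addrC. Qed.
Lemma tensor_add0 : left_id tensor_zero tensor_add.
Proof. by elim/quotW=> x; rewrite /tensor_zero -pi_tensor_add add0r. Qed.
Lemma tensor_addN : left_inverse tensor_zero tensor_opp tensor_add.
Proof. by elim/quotW=> x; rewrite -pi_tensor_opp -pi_tensor_add addNr. Qed.

HB.instance Definition _ := GRing.isZmodule.Build tensor
  tensor_addA tensor_addC tensor_add0 tensor_addN.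

Definition tens (a : A) (m : M) : tensor := \pi_tensor << (a, m) >>.

End Tensor.

Section Flat.
Variable R : pzRingType.

Section TensorMap.
Variables (A B : lmodType R^c) (M : lmodType R) (f : {linear A -> B}).

Definition free_map (x : {freeg (A * M)%type / int}) :
    {freeg (B * M)%type / int} :=
  fglift (fun am : A * M => << (f am.1, am.2) >>) x.

(* f (x) id_M; [tensor_mapE] shows that it does not depend on the choice of
   representatives. *)
Definition tensor_map (t : tensor A M) : tensor B M :=
  \pi_(tensor B M) (free_map (repr t)).

Lemma free_mapB : {morph free_map : x y / x - y}.
Proof. exact: lift_is_additive. Qed.

Lemma free_mapU a m : free_map << (a, m) >> = << (f a, m) >>.
Proof. by rewrite /free_map liftU scale1r. Qed.

Lemma free_map_null x : tensor_null x -> tensor_null (free_map x).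
Proof.
elim=> [a a' m|a m m'|r a m||{}x y _ hx _ hy].
- by rewrite !free_mapB !free_mapU linearD; apply: tensor_null_addl.
- by rewrite !free_mapB !free_mapU; apply: tensor_null_addr.
- by rewrite !free_mapB !free_mapU linearZ; apply: tensor_null_bal.
- by rewrite -[X in free_map X](subrr 0) free_mapB subrr; apply: tensor_null0.
- by rewrite free_mapB; apply: tensor_nullB.
Qed.

Lemma tensor_mapE x :
  tensor_map (\pi_(tensor A M) x) = \pi_(tensor B M) (free_map x).
Proof.
apply/pi_tensorP; rewrite -free_mapB.
by apply/free_map_null/pi_tensorP; rewrite reprK.
Qed.

Lemma tensor_map_tens a m : tensor_map (tens a m) = tens (f a) m.
Proof. by rewrite /tens tensor_mapE free_mapU. Qed.

End TensorMap.

Definition flat (M : lmodType R) : Prop :=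
  forall (A B : lmodType R^c) (f : {linear A -> B}),
    injective f -> injective (@tensor_map A B M f).

End Flat.

Section Purity.
Variable R : pzRingType.

(* The pp-formula "exists w, ex_part w + free_part v = 0" in k free
   variables v. *)
Record pp_formula (k : nat) := PPFormula {
  pp_vars : nat;
  pp_eqns : nat;
  pp_ex_part : 'M[R]_(pp_eqns, pp_vars);
  pp_free_part : 'M[R]_(pp_eqns, k)
}.

Definition pp_sat (M : lmodType R) (S : {pred M}) k (phi : pp_formula k)
    (v : 'I_k -> M) : Prop :=
  exists w : 'I_(pp_vars phi) -> M,
    (forall j, w j \in S) /\
    forall e, \sum_j pp_ex_part phi e j *: w j +
              \sum_j pp_free_part phi e j *: v j = 0.

(* N <=_pp N', for submodules N, N' of a common module. *)
Definition pp_le (M : lmodType R) (N N' : {pred M}) : Prop :=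
  {subset N <= N'} /\
  forall k (phi : pp_formula k) (v : 'I_k -> M),
    (forall i, v i \in N) -> pp_sat N' phi v -> pp_sat N phi v.

Definition pure_embedding (M N : lmodType R) (f : {linear M -> N}) : Prop :=
  injective f /\ pp_le [pred y : N | y \in range f] predT.

Definition pure_injective (P : lmodType R) : Prop :=
  forall (M N : lmodType R) (f : {linear M -> N}) (g : {linear M -> P}),
    pure_embedding f -> exists h : {linear N -> P}, forall x, h (f x) = g x.

(* P is a minimum pure-injective pure extension of M, via i. *)
Definition pure_injective_envelope (M P : lmodType R) (i : {linear M -> P}) :
    Prop :=
  [/\ pure_embedding i, pure_injective P &
   forall (Q : lmodType R) (j : {linear M -> Q}),
     pure_embedding j -> pure_injective Q ->
     exists2 f : {linear P -> Q}, pure_embedding f & forall x, f (i x) = j x].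

End Purity.

Section SubmoduleType.
Variables (R : pzRingType) (M : lmodType R) (S : submodClosed M).

Definition subm : Type := {x : M | x \in S}.

HB.instance Definition _ := SubChoice.on subm.
HB.instance Definition _ := [SubChoice_isSubLmodule of subm by <:].

End SubmoduleType.

(* A cardinal is represented by a type of that cardinality.  Naming the
   universe once makes all cardinals below range over the same types. *)
Definition cardinal := Type.

Definition is_succ_cardinal (kappa kappa' : cardinal) : Prop :=
  ~~ ([set: kappa'] #<= [set: kappa]) /\
  forall mu : cardinal,
    ~~ ([set: mu] #<= [set: kappa]) -> [set: kappa'] #<= [set: mu].

(* An ordinal is represented by a well-ordered type. *)
Section Ordinals.
Variables (d : Order.disp_t) (I : orderType d).

Definition limit_ordinal : Prop :=
  [/\ well_order (<=%O : rel I), inhabited I &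
   forall i : I, exists j, (i < j)%O].

Definition succ_index (i j : I) : Prop :=
  (i < j)%O /\ forall k, (i < k)%O -> (j <= k)%O.

Definition limit_index (i : I) : Prop :=
  (exists j, (j < i)%O) /\
  forall j, (j < i)%O -> exists k, (j < k)%O /\ (k < i)%O.

Definition cofinal (A : set I) : Prop :=
  forall i, exists2 j, A j & (i <= j)%O.

Definition is_cofinality (c : cardinal) : Prop :=
  (exists2 A : set I, cofinal A & A #= [set: c]) /\
  forall A : set I, cofinal A -> [set: c] #<= A.

End Ordinals.

Section LimitModels.
Variable R : pzRingType.

(* N' is universal over N, for submodules N, N' of a common module W.  An
   extension N <=_pp N* is a pure embedding g of N into N*. *)
Definition universal_over (W : lmodType R) (N N' : submodClosed W) : Prop :=
  [/\ pp_le N N', [set: subm N'] #= [set: subm N] &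
   forall (Ns : lmodType R) (g : {linear subm N -> Ns}),
     flat Ns -> [set: Ns] #<= [set: subm N] -> pure_embedding g ->
     exists2 f : {linear Ns -> subm N'},
       pure_embedding f & forall x, val (f (g x)) = val x].

(* [alpha < lambda^+] is expressed as |alpha| <= lambda. *)
Definition limit_model (lambda : cardinal) d (alpha : orderType d)
    (M : lmodType R) : Prop :=
  [/\ infinite_set [set: lambda], limit_ordinal alpha,
      [set: alpha] #<= [set: lambda] &
   exists C : alpha -> submodClosed M,
     [/\ forall i, flat (subm (C i)) /\ [set: subm (C i)] #= [set: lambda],
         forall i j, (i <= j)%O -> pp_le (C i) (C j),
         forall i, limit_index i ->
           forall x, x \in C i -> exists2 j, (j < i)%O & x \in C j,
         forall i j, succ_index i j -> universal_over (C i) (C j) &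
         forall x : M, exists i, x \in C i]].

End LimitModels.

(* Main.v *)
From HB Require Import structures.
Require Import Defs.
From mathcomp Require Import all_boot all_order all_algebra.
From mathcomp Require Import boolp classical_sets functions cardinality wochoice.
From mathcomp Require Import freeg.
From Stdlib Require List.

(** The equivalence rests on three facts: flatness passes to pure submodules and to
    extensions by flat modules; pure-injectivity can be tested on sets of
    pp-formulas in one unknown; and there are enough universal extensions among
    flat modules.

    Flatness is used through the equational criterion [flatP], in which tensor
    products no longer occur: a relation [X v = 0] has the form [v = C y] with
    [X C = 0].

    Suppose that envelopes of flat modules are flat, and let [M] be a limit model
    with a chain [C i] of cofinality greater than [|R| + aleph_0].  By
    [pure_injective_criterion] it suffices to realize every finitely realized set
    of pp-formulas in one unknown with parameters in [M].  Two instances of one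
    formula with a common realization define the same coset, so one instance of
    each formula is enough; there are at most [|R| + aleph_0] of them and their
    parameters lie in some [C i].  They are realized in the pure-injective envelope
    of [C i], which is flat, hence in a pure submodule of it of the cardinality of
    [C i]; universality moves this submodule into the next stage
    ([limit_model_pure_injective]).

    Conversely, suppose that limit models are pure-injective and let [P] be an
    envelope of a flat module [M].  By [limit_model_extension] there is a limit
    model [N], of large cofinality, that contains [M] as a pure submodule.  By
    minimality [P] is isomorphic to a pure submodule of [N], hence flat.

    Two existence theorems carry this argument.  The first is that every module has
    a pure-injective envelope in the sense used here
    ([pure_injective_envelope_exists]).  The module is pure in its bidual with
    respect to characters, which is pure-injective; the envelope is a retract of
    it, cut out by maximality arguments that use generalized limits
    ([pure_injective_limit]).

    The second is the existence of limit models.  Let [K = R + nat] and let [Lam] be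
    a power set with [Lam ^ K = Lam].  A flat module [N'] containing [N] purely has a
    filtration from [N] whose steps have small flat quotients [A / L], with [A] free
    on [K] ([absorb_step]), and a step is the pushout along a homomorphism from [L].
    There are only [Lam] such pushouts over a module of cardinality [Lam];
    adjoining all of them at once ([extension_step]), and repeating this [Lam]
    times, gives a universal extension ([universal_step]).  A chain of universal
    extensions indexed by the successor cardinal of [K] is a limit model.  To make
    unions harmless, everything takes place inside one power of an injective
    cogenerator, where each step has its own coordinates. *)

Set Implicit Arguments.
Unset Strict Implicit.
Unset Printing Implicit Defensive.

Import Order.TTheory GRing.Theory Num.Theory.
Local Open Scope ring_scope.
Local Open Scope card_scope.
Local Open Scope classical_set_scope.

(** * Cardinal arithmetic *)

Definition inject (T U : Type) : Prop := exists f : T -> U, injective f.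

Lemma inject_refl T : inject T T.
Proof. by exists id. Qed.

Lemma inject_trans T U V : inject T U -> inject U V -> inject T V.
Proof. by move=> [f fi] [g gi]; exists (g \o f); apply: inj_comp. Qed.

Lemma card_le_setT T U : ([set: T] #<= [set: U]) <-> inject T U.
Proof.
split=> [/card_leP[f]|[f fi]].
  exists (fun x => val (f (to_setT x))) => x y /val_inj.
  by move=> /(@inj _ _ _ f); rewrite !inE => /(_ Logic.I Logic.I) /(congr1 val).
suff [g] : $|{injfun [set: T] >-> [set: U]}| by apply: inj_card_le g.
by apply/injfunPex; exists f => // a b _ _ /fi.
Qed.

Lemma infinite_nat_inject T : infinite_set [set: T] <-> inject nat T.
Proof. by rewrite infiniteP; apply: card_le_setT. Qed.

Lemma inject_leftinv T U (t : T) (f : T -> U) : injective f ->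
  exists g : U -> T, cancel f g.
Proof.
move=> fi; exists (fun u =>
  match pselect (exists x, f x = u) with left h => projT1 (cid h) | right _ => t end).
by move=> x; case: pselect => [h|[]]; [apply: fi (projT2 (cid h))|exists x].
Qed.

Lemma inject_prod T T' U U' : inject T U -> inject T' U' ->
  inject (T * T') (U * U').
Proof.
move=> [f fi] [g gi]; exists (fun p => (f p.1, g p.2)).
by move=> [a b] [c d] [/fi-> /gi->].
Qed.

Lemma inject_nat_prod_sum T U : inject nat U -> inject T U -> inject (T + T) (U * U).
Proof.
move=> [n ni] [f fi].
exists (fun x => match x with inl a => (f a, n 0%N) | inr a => (f a, n 1%N) end).
by move=> [a|a] [b|b] [] /fi -> // /ni.
Qed.

Lemma sval_inj T (P : T -> Prop) : injective (@sval T P).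
Proof. by move=> [x px] [y py] /= xy; apply: eq_exist. Qed.

(** Starting from [A0] rather than from the empty set lets [P] contain closure
    conditions that the empty set violates. *)
Lemma Zorn_above T (P : set (set T)) (A0 : set T) : P A0 ->
  (forall F : set (set T), F !=set0 -> (forall X, F X -> P X /\ A0 `<=` X) ->
     total_on F subset -> P (\bigcup_(X in F) X)) ->
  exists A, [/\ A0 `<=` A, P A & forall B, A `<=` B -> P B -> B = A].
Proof.
move=> PA0 Pch; have [F FP Fch|A [PA Amax]] := @Zorn_bigcup _ (fun A => P (A0 `|` A)).
  have [[X0 FX0]|noF] := pselect (exists X, F X); last first.
    rewrite (_ : \bigcup_(X in F) X = set0) ?setU0 //.
    by apply/seteqP; split=> // x [X FX _]; case: noF; exists X.
  rewrite (_ : A0 `|` _ = \bigcup_(Y in [set A0 `|` X | X in F]) Y).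
    apply: Pch => [|_ [X FX <-]|_ _ [X FX <-] [Y FY <-]].
    - by exists (A0 `|` X0), X0.
    - by split; [apply: FP|move=> x; left].
    - have [XY|YX] := Fch _ _ FX FY; [left|right];
      by move=> x [|]; [left|right; auto].
  apply/seteqP; split=> x.
    by case=> [Ax|[X FX Xx]]; [exists (A0 `|` X0); [exists X0|left]
                              |exists (A0 `|` X); [exists X|right]].
  by move=> [_ [X FX <-] [|]]; [left|right; exists X].
exists (A0 `|` A); split=> // B AB PB; apply: contrapT => nAB.
have BE : A0 `|` B = B by apply/setUidPr => x Ax; apply: AB; left.
apply: (Amax B); last by rewrite BE.
split; first by move=> x Ax; apply: AB; right.
move=> BA; apply: nAB; apply/seteqP; split=> // x Bx; right; exact: BA.
Qed.

(** Finitely many elements of the union of a chain lie in one member; this is how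
    finitary properties pass to unions of chains. *)
Lemma finite_in_chain T (F : set (set T)) n (v : 'I_n -> T) : F !=set0 -> total_on F subset ->
  (forall i, exists2 X, F X & X (v i)) -> exists2 X, F X & forall i, X (v i).
Proof.
move=> [X0 FX0] Fch Fv.
suff [X FX Xv] : exists2 X, F X & forall i, i \in enum 'I_n -> X (v i).
  by exists X => // i; apply: Xv; rewrite mem_enum.
elim: (enum 'I_n) => [|i s [X FX Xv]]; first by exists X0.
have [Y FY Yi] := Fv i; have [XY|YX] := Fch _ _ FX FY.
  by exists Y => // j; rewrite inE => /orP[/eqP ->|/Xv/XY].
by exists X => // j; rewrite inE => /orP[/eqP ->|/Xv //]; apply: YX.
Qed.

(** Injections between subsets form an inductive poset, and a maximal one is
    total or onto. *)
Lemma inject_total T U : inject T U \/ inject U T.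
Proof.
pose P (G : set (T * U)) := forall p q, G p -> G q -> (p.1 = q.1 <-> p.2 = q.2).
have [F FP Fch|G [PG Gmax]] := @Zorn_bigcup _ P.
  move=> p q [X FX Xp] [Y FY Yq].
  have [XY|YX] := Fch _ _ FX FY; first exact: (FP _ FY p q (XY _ Xp) Yq).
  exact: (FP _ FX p q Xp (YX _ Yq)).
have [h|/existsNP[t tG]] := pselect (forall t, exists u, G (t, u)).
  by left; have [f fG] := choice h; exists f => x y e; apply/(PG _ _ (fG x) (fG y)).
have [h|/existsNP[u uG]] := pselect (forall u, exists t, G (t, u)).
  right; have [f fG] := choice h; exists f => x y e.
  by apply/(PG _ _ (fG x) (fG y)).
exfalso; apply: (Gmax (G `|` [set (t, u)])).
  split; first by move=> x; left.
  by move=> /(_ (t, u)) h; apply: tG; exists u; apply: h; right.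
have nt q : G q -> q.1 <> t by case: q => a b /= Gq e; apply: tG; exists b; rewrite -e.
have nu q : G q -> q.2 <> u by case: q => a b /= Gq e; apply: uG; exists a; rewrite -e.
move=> p q [Gp|->] [Gq|->] //=; first exact: PG.
  by split=> [/(nt _ Gp)|/(nu _ Gp)].
by split=> /esym; [move/(nt _ Gq)|move/(nu _ Gq)].
Qed.

(** Zorn's lemma on graphs of injections [S * S -> S] gives a maximal one; if its
    field [S] had a complement at least as large as [S], a copy [Y] of [S] in
    the complement would absorb the three missing rectangles of
    [(S u Y) * (S u Y)]. *)
Lemma inject_square T : inject nat T -> inject (T * T) T.
Proof.
move=> [n0 n0i].
pose field (G : set (T * T * T)) : set T :=
  [set t | exists2 p, G p & t = p.1.1 \/ t = p.1.2 \/ t = p.2].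
pose P G := (forall p q, G p -> G q -> (p.1 = q.1 <-> p.2 = q.2)) /\
  forall x y, field G x -> field G y -> exists z, G (x, y, z).
pose G0 : set (T * T * T) :=
  [set p | exists i j, p = (n0 i, n0 j, n0 (pickle (i, j)))].
have fieldG0 x : field G0 x -> exists i, x = n0 i.
  by move=> [_ [i [j ->]]] /= [->|[->|->]]; eexists.
have PG0 : P G0.
  split=> [_ _ [i [j ->]] [i' [j' ->]] /=|_ _ /fieldG0[i ->] /fieldG0[j ->]].
    split=> [[/n0i -> /n0i ->] //|/n0i /(pcan_inj (@pickleK _))].
    by move=> [-> ->].
  by exists (n0 (pickle (i, j))), i, j.
have [//|F F0 FP Fch|H [G0H [Hinj Htot] Hmax]] := @Zorn_above _ P G0.
  have pair p q : (\bigcup_(X in F) X) p -> (\bigcup_(X in F) X) q -> exists X, [/\ F X, X p & X q].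
    move=> [X FX Xp] [Y FY Yq].
    have [|X' FX' X'pq] := @finite_in_chain _ F 2%N (fun i => if i == ord0 then p else q) F0 Fch.
      by move=> i; case: eqP => _; [exists X|exists Y].
    by exists X'; split=> //; [exact: X'pq ord0|exact: X'pq ord_max].
  split=> [p q Fp Fq|x y [p Fp xp] [q Fq yq]].
    by have [X [FX Xp Xq]] := pair p q Fp Fq; exact: (FP X FX).1.1.
  have [X [FX Xp Xq]] := pair p q Fp Fq.
  have [||z Xz] := (FP X FX).1.2 x y; [by exists p|by exists q|].
  by exists z, X.
pose S := {x : T | field H x}.
have HS (a b : S) : exists c : S, H (sval a, sval b, sval c).
  have [z Hz] := Htot _ _ (svalP a) (svalP b).
  have fz : field H z by exists (sval a, sval b, z) => //; right; right.
  by exists (exist _ z fz).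
have /choice[m Hm] : forall ab : S * S, exists c : S, H (sval ab.1, sval ab.2, sval c).
  by move=> [a b]; apply: HS.
have mi : injective m.
  move=> [a b] [a' b'] e; have := (Hinj _ _ (Hm (a, b)) (Hm (a', b'))).2.
  by move=> /= /(_ (congr1 sval e)) [] /sval_inj -> /sval_inj ->.
have SS : inject (S * S) S by exists m.
have natS : inject nat S.
  have fn i : field H (n0 i).
    by exists (n0 i, n0 0%N, n0 (pickle (i, 0%N))); [apply: G0H; exists i, 0%N|left].
  by exists (fun i => exist _ _ (fn i)) => i j [/n0i].
have S2 : inject (S + S) S by apply: inject_trans SS; apply: inject_nat_prod_sum; first exact: natS; exact: inject_refl.
suff [s si] : inject T S.
  have TTSS : inject (T * T) (S * S) by apply: inject_prod; exists s.
  apply: inject_trans TTSS (inject_trans SS _).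
  by exists (fun x => sval x) => x y /sval_inj.
pose S' := {x : T | ~ field H x}.
have [[r ri]|[g gi]] := inject_total S' S.
  apply: inject_trans S2.
  exists (fun x => match pselect (field H x) with
     | left h => inl (exist _ x h) | right h => inr (r (exist _ x h)) end).
  move=> x y; case: pselect => hx; case: pselect => hy // [].
    by move=> e; apply: e.
  by move=> /ri [].
exfalso.
have [S4 S4i] : inject ((S + S) + (S + S)) S.
  have [h hi] := S2; apply: inject_trans S2.
  exists (fun x => match x with inl a => inl (h a) | inr a => inr (h a) end).
  by move=> [a|a] [b|b] [] // /hi ->.
(* [S4] splits [S] into four parts, three of which receive the rectangles
   [S * Y], [Y * S] and [Y * Y], where [Y] is the range of [g]. *)
pose K : set (T * T * T) := [set p | exists a b : S,
  [\/ p = (sval a, sval (g b), sval (g (S4 (inl (inl (m (a, b))))))),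
      p = (sval (g a), sval b, sval (g (S4 (inl (inr (m (a, b))))))) |
      p = (sval (g a), sval (g b), sval (g (S4 (inr (inl (m (a, b))))))) ]].
have gnS (a : S) : ~ field H (sval (g a)) by exact: (svalP (g a)).
have gval a b : sval (g a) = sval (g b) -> a = b by move=> /sval_inj/gi.
have vg (a b : S) : sval a <> sval (g b).
  by move=> e; apply: (gnS b); rewrite -e; exact: (svalP a).
have Kf p : K p -> exists c, sval (g c) = p.2 by move=> [a [b [->|->|->]]]; eexists.
have Hf p : H p -> [/\ field H p.1.1, field H p.1.2 & field H p.2].
  by move=> Hp; split; exists p; auto.
have HKn p q : H p -> K q -> p.1 <> q.1 /\ p.2 <> q.2.
  move=> Hp Kq; split=> e.
    have [h1 h2 _] := Hf _ Hp; move: h1 h2; rewrite e.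
    by case: Kq => [a [b [->|->|->]]] /= h1 h2; [exact: gnS b h2|exact: gnS a h1|exact: gnS a h1].
  by have [_ _ h] := Hf _ Hp; have [c cq] := Kf _ Kq; move: h; rewrite e -cq => /gnS.
have KK p q : K p -> K q -> (p.1 = q.1 <-> p.2 = q.2).
  move=> [a [b Kp]] [c [d Kq]]; split=> e.
    case: Kp e => ->; case: Kq => -> /= [].
    - by move=> /sval_inj -> /gval ->.
    - by move=> /vg.
    - by move=> /vg.
    - by move=> /esym/vg.
    - by move=> /gval -> /sval_inj ->.
    - by move=> _ /vg.
    - by move=> /esym/vg.
    - by move=> _ /esym/vg.
    - by move=> /gval -> /gval ->.
  case: Kp e => ->; case: Kq => -> /= /gval/S4i E.
  all: try by case: E.
  - by have /mi [-> ->] : m (a, b) = m (c, d) by case: E.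
  - by have /mi [-> ->] : m (a, b) = m (c, d) by case: E.
  - by have /mi [-> ->] : m (a, b) = m (c, d) by case: E.
have [s0] : exists s : S, True by case: natS => f _; exists (f 0%N).
suff PHK : P (H `|` K).
  pose q := (sval s0, sval (g s0), sval (g (S4 (inl (inl (m (s0, s0))))))).
  have Kq : K q by exists s0, s0; constructor 1.
  have HK : H `|` K = H by apply: Hmax => // p; left.
  have Hq : H q by rewrite -HK; right.
  by have [] := HKn _ _ Hq Kq.
split.
  move=> p q [Hp|Kp] [Hq|Kq]; [exact: Hinj| | |exact: KK].
    by have [h1 h2] := HKn _ _ Hp Kq.
  by have [h1 h2] := HKn _ _ Hq Kp; split=> /esym.
have fHK x : field (H `|` K) x -> (exists a : S, x = sval a) \/ exists a, x = sval (g a).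
  move=> [p [Hp|Kp] xp].
    have [h1 h2 h3] := Hf _ Hp; left.
    by case: xp => [->|[->|->]]; [exists (exist _ _ h1)|exists (exist _ _ h2)|exists (exist _ _ h3)].
  case: Kp xp => [a [b [->|->|->]]] /= [->|[->|->]];
    by [left; eexists|right; eexists].
move=> x y /fHK[[a ->]|[a ->]] /fHK[[b ->]|[b ->]].
- by exists (sval (m (a, b))); left; apply: Hm (a, b).
- by eexists; right; exists a, b; constructor 1; reflexivity.
- by eexists; right; exists a, b; constructor 2; reflexivity.
- by eexists; right; exists a, b; constructor 3; reflexivity.
Qed.

(** The size is recorded because folding an injection [T * T -> T] along a list is
    injective only among lists of one size. *)
Lemma inject_seq T : inject nat T -> inject (seq T) T.
Proof.
move=> natT; have [e ei] := inject_square natT; case: natT => n ni.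
pose c := foldr (fun x acc => e (x, acc)) (n 0%N).
exists (fun s => e (n (size s), c s)) => s t /ei [/ni].
elim: s t => [|x s IHs] [|y t] //= [] st /ei[-> cst].
by rewrite (IHs t).
Qed.

Lemma inject_sum T U V : inject nat V -> inject T V -> inject U V -> inject (T + U) V.
Proof.
move=> natV [f fi] [g gi]; apply: inject_trans (inject_square natV).
apply: inject_trans (inject_nat_prod_sum natV (inject_refl V)).
exists (fun x => match x with inl a => inl (f a) | inr a => inr (g a) end).
by move=> [a|a] [b|b] [] // => [/fi->|/gi->].
Qed.

(** Subsets of [T] of cardinality at most [L], seen as subsets of the range of an
    [L]-indexed family: this form involves no injection defined on a subset
    only. *)
Definition atmost (L T : Type) (S : set T) : Prop :=
  exists e : L -> T, S `<=` range e.

Lemma inject_surj L X (x0 : X) : inject X L -> exists d : L -> X, forall x, exists l, d l = x.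
Proof.
by move=> [f fi]; have [g gK] := inject_leftinv x0 fi; exists g => x; exists (f x).
Qed.

Lemma atmost_image L T X (x0 : X) (f : X -> T) (S : set T) :
  inject X L -> S `<=` range f -> atmost L S.
Proof.
move=> /(inject_surj x0)[d dP] Sf; exists (f \o d) => y /Sf [x _ <-].
by have [l <-] := dP x; exists l.
Qed.

Lemma atmost_inject L T (S : set T) : atmost L S -> inject {x | S x} L.
Proof.
move=> [e eS].
have /choice[f fP] : forall x : {x | S x}, exists l, e l = sval x.
  by move=> x; have [l _ ex] := eS _ (svalP x); exists l.
by exists f => x y fxy; apply: sval_inj; rewrite -!fP fxy.
Qed.

(** The closure is the union over [n] of the sets of values of terms of height at
    most [n], each indexed by [L] through a coding of the terms. *)
Lemma closure_atmost (L F : Type) (T : eqType) (op : F -> seq T -> T) (S0 : set T) :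
  inject nat L -> inject F L -> inhabited T -> atmost L S0 ->
  exists S : set T, [/\ S0 `<=` S, atmost L S &
    forall f s, (forall x, x \in s -> S x) -> S (op f s)].
Proof.
move=> natL FL [t0] [e0 e0S].
have LFL : inject (L + F * seq L) L.
  apply: inject_sum (natL) (inject_refl _) _; apply: inject_trans (inject_square natL).
  by apply: inject_prod FL (inject_seq natL).
have [n0 _] := natL.
have [d dP] := inject_surj (inl (n0 0%N)) LFL.
pose e := fix e n : L -> T := if n is n'.+1 then
  fun l => match d l with inl l' => e n' l' | inr (f, s) => op f (map (e n') s) end
  else e0.
have eS n l : exists l', e n.+1 l' = e n l.
  by have [l' dl] := dP (inl l); exists l'; rewrite /= dl.
have eD k n l : exists l', e (k + n)%N l' = e n l.
  elim: k => [|k [l' <-]]; first by exists l.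
  by have [l'' <-] := eS (k + n)%N l'; exists l''; rewrite addSn.
exists [set x | exists n l, e n l = x]; split.
- by move=> x /e0S [l _ <-]; exists 0%N, l.
- apply: (@atmost_image _ _ (nat * L)%type (0%N, n0 0%N) (fun p => e p.1 p.2)).
    exact: inject_trans (inject_prod natL (inject_refl _)) (inject_square natL).
  by move=> x [n [l <-]]; exists (n, l).
- move=> f s sS.
  have [n [u us]] : exists n u, map (e n) u = s.
    elim: s sS => [|x s IHs] sS; first by exists 0%N, [::].
    have [|n [u us]] := IHs; first by move=> y ys; apply: sS; rewrite inE ys orbT.
    have [m [l ml]] := sS x (mem_head _ _).
    have [l' l'P] := eD n m l.
    have : exists u', map (e (m + n)%N) u' = map (e n) u.
      elim: (u) => [|y u' [u'' /= IHu]]; first by exists [::].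
      by have [y' y'P] := eD m n y; exists (y' :: u''); rewrite /= IHu y'P.
    move=> [u' u'P]; exists (m + n)%N, (l' :: u').
    by rewrite /= u'P us addnC l'P ml.
  have [l dl] := dP (inr (f, u)).
  by exists n.+1, l; rewrite /= dl us.
Qed.

(** * Transfinite constructions *)

(** Transfinite dependent choice: a value can be chosen at [i] from the values
    chosen below [i], as long as these were themselves chosen correctly. *)
Lemma wf_choice (I X : Type) (lt : I -> I -> Prop) (Q : I -> (I -> X) -> X -> Prop) :
  well_founded lt -> inhabited X ->
  (forall i h h' x, (forall j, lt j i -> h j = h' j) -> Q i h x -> Q i h' x) ->
  (forall i h, (forall j, lt j i -> Q j h (h j)) -> exists x, Q i h x) ->
  exists h, forall i, Q i h (h i).
Proof.
move=> wf [x0] Qext Qex.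
pose pad i (r : forall j, lt j i -> X) : I -> X :=
  fun j => if pselect (lt j i) is left ji then r j ji else x0.
pose step i (r : forall j, lt j i -> X) : X :=
  if pselect (exists x, Q i (pad i r) x) is left h then projT1 (cid h) else x0.
pose h := Fix wf (fun=> X) step.
have hE i : h i = step i (fun j _ => h j).
  apply: (Fix_eq wf (fun=> X) step) => j r r' rr'; congr step.
  by apply: functional_extensionality_dep => k; apply: functional_extensionality_dep.
exists h; elim/(well_founded_ind wf) => i IH.
have padh j : lt j i -> pad i (fun j _ => h j) j = h j.
  by move=> ji; rewrite /pad; case: pselect.
rewrite hE /step; case: pselect => [e|[]].
  by apply: Qext (padh) _; exact: projT2 (cid e).
by have [x Qx] := Qex _ _ IH; exists x; apply: Qext Qx => j ji; rewrite padh.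
Qed.

(** Chains of sets that are continuous by construction: limit and successor stages
    are treated alike, the stage [B u U_(j < i) h j] being extended to [h i] by one
    step.  [Plt J D] is what is known of the union [D] of the stages indexed by [J],
    and [Ple i E] what is known of the [i]-th extension [E]. *)
Lemma transfinite_chain (I T : Type) (lt : I -> I -> Prop) (B : set T)
    (le : set T -> set T -> Prop)
    (Plt : set I -> set T -> Prop) (Ple : I -> set T -> Prop)
    (Q : I -> set T -> set T -> Prop) :
  let U (J : set I) (h : I -> set T) := B `|` \bigcup_(j in J) h j in
  let below i := [set j | lt j i] in
  well_founded lt -> (forall i j k, lt i j -> lt j k -> lt i k) ->
  (forall X Y Z, le X Y -> le Y Z -> le X Z) ->
  (forall J h, (forall j k, J j -> lt k j -> J k) ->
     (forall j, J j -> Ple j (h j) /\ le B (h j)) ->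
     (forall j k, J j -> J k -> lt j k -> le (h j) (h k)) ->
     [/\ Plt J (U J h), le B (U J h) & forall j, J j -> le (h j) (U J h)]) ->
  (forall i D, Plt (below i) D -> exists E, [/\ le D E, Ple i E & Q i D E]) ->
  exists h : I -> set T,
    [/\ forall i, [/\ Plt (below i) (U (below i) h), le B (U (below i) h) &
          forall j, lt j i -> le (h j) (U (below i) h)],
        forall i, [/\ le (U (below i) h) (h i), Ple i (h i) & Q i (U (below i) h) (h i)] &
        [/\ Plt setT (U setT h), le B (U setT h) & forall j, le (h j) (U setT h)]].
Proof.
move=> U below wf lt_trans le_trans union step.
pose good i h E := [/\ Plt (below i) (U (below i) h), le B (U (below i) h),
  forall j, lt j i -> le (h j) (U (below i) h), Ple i E &
  le (U (below i) h) E /\ Q i (U (below i) h) E].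
have Uext i h h' : (forall j, lt j i -> h j = h' j) -> U (below i) h = U (below i) h'.
  by move=> hh'; congr setU; apply: eq_bigcupr => j /hh'.
have Ugood J (h : I -> set T) : (forall j k, J j -> lt k j -> J k) ->
    (forall j, J j -> good j h (h j)) ->
    [/\ Plt J (U J h), le B (U J h) & forall j, J j -> le (h j) (U J h)].
  move=> Jdown gd; apply: union => // [j /gd[_ le1 _ ? [le2 _]]|j k Jj Jk jk].
    by split=> //; apply: le_trans le1 le2.
  by have [_ _ /(_ j jk) le1 _ [le2 _]] := gd k Jk; apply: le_trans le1 le2.
have [|i h h' E hh'|i h gd|h gd] := @wf_choice I (set T) lt good wf.
- by exists; exact: set0.
- rewrite /good (Uext i h h' hh') => -[? ? h3 ? ?]; split=> // j ji.
  by rewrite -hh' //; apply: h3.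
- have [|p1 p2 p3] := Ugood (below i) h _ gd; first by move=> j k ji kj; apply: lt_trans ji.
  by have [E [e1 e2 e3]] := step _ _ p1; exists E; split.
exists h; split=> [i|i|].
- by have [] := gd i.
- by have [? ? ? ? []] := gd i.
- by have [//|? ? H] := Ugood setT h _ (fun j _ => gd j); split=> // j; apply: H.
Qed.

Lemma well_order_min (T : eqType) (R : rel T) (A : T -> Prop) : well_order R ->
  (exists x, A x) -> exists2 x, A x & forall y, A y -> R x y.
Proof.
move=> wo [x Ax]; have [] := wo [pred y | `[< A y >]].
  by exists x; apply: asboolT.
move=> z [[/asboolW Az zmin] _]; exists z => // y Ay.
by apply: zmin; apply: asboolT.
Qed.

Section WellOrders.
Variables (T : eqType) (R : rel T) (Rwo : well_order R).

Lemma well_order_chain : wo_chain R predT.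
Proof. by move=> A _; apply: Rwo. Qed.

Lemma well_order_refl : reflexive R.
Proof. by move=> x; apply: (wo_chain_reflexive well_order_chain). Qed.

Lemma well_order_total : total R.
Proof. by move=> x y; apply: (wo_chainW well_order_chain). Qed.

Lemma well_order_anti : antisymmetric R.
Proof. by move=> x y; apply: (wo_chain_antisymmetric well_order_chain). Qed.

Lemma well_order_trans : transitive R.
Proof.
move=> y x z xy yz.
have [|w [->|[->|->]] wmin] := @well_order_min T R (fun w => w = x \/ w = y \/ w = z) Rwo.
- by exists x; left.
- by apply: wmin; right; right.
- suff -> : x = y by [].
  by apply: well_order_anti; rewrite xy wmin //; left.
- have zy : z = y by apply: well_order_anti; rewrite yz wmin //; right; left.
  by rewrite zy.
Qed.

Lemma well_order_wf : well_founded (fun x y => R x y && (x != y)).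
Proof.
move=> x; apply: contrapT => nx.
have [|z nz zmin] := @well_order_min T R
  (fun y => ~ Acc (fun x y => R x y && (x != y)) y) Rwo; first by exists x.
apply: nz; constructor=> y /andP[yz ynz]; apply: contrapT => ny.
by move: ynz; rewrite (@well_order_anti y z) ?eqxx // yz zmin.
Qed.

End WellOrders.

Section WellOrderedType.
Variables (T : choiceType) (R : rel T) (Rwo : well_order R).

Definition wotype of well_order R : Type := T.

HB.instance Definition _ := Choice.on (wotype Rwo).
HB.instance Definition _ := Order.Le_isPOrder.Build (Order.Disp tt tt) (wotype Rwo)
  (well_order_refl Rwo) (well_order_anti Rwo) (well_order_trans Rwo).
HB.instance Definition _ := Order.POrder_isTotal.Build _ (wotype Rwo) (well_order_total Rwo).

End WellOrderedType.

Lemma order_wf d (I : orderType d) : well_order (<=%O : rel I) ->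
  well_founded (fun i j : I => (i < j)%O).
Proof.
move=> /well_order_wf wf i; elim: {i}(wf i) => i _ IH; constructor=> j ji.
by apply: IH; rewrite ltW // lt_eqF.
Qed.

Lemma inject_Prop_not K : ~ inject (K -> Prop) K.
Proof.
move=> [f fi]; pose D k := exists2 A : K -> Prop, f A = k & ~ A k.
have [DD|nDD] := pselect (D (f D)).
  by have [A /fi AD nA] := DD; apply: nA; rewrite AD.
by apply: (nDD); exists D.
Qed.

(** An initial segment of a well-ordered power set of [K], cut as soon as it has
    more than [K] elements: the initial ordinal of the successor cardinal. *)
Lemma succ_ordinal (K : Type) : inject nat K -> exists d (alpha : orderType d),
  [/\ well_order (<=%O : rel alpha),
      ~ inject alpha K &
      forall i : alpha, inject {j : alpha | (j <= i)%O} K].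
Proof.
move=> natK; pose T : choiceType := HB.pack_for choiceType (K -> Prop)
   (gen_eqMixin (K -> Prop)) (gen_choiceMixin (K -> Prop)).
have [R Rwo] := well_ordering_principle T.
pose small i := inject {j : T | R j i} K.
pose al := {i : T | `[< small i >]}.
pose S : rel al := fun x y => R (sval x) (sval y).
have Swo : well_order S.
  apply: antisymmetric_well_order => [x y /(well_order_anti Rwo) xy|A [x Ax]].
    exact: sval_inj.
  have [|_ [y Ay <-] ymin] := @well_order_min T R (fun t => exists2 y, y \in A & sval y = t) Rwo.
    by exists (sval x), x.
  by exists y; split=> // z Az; apply: ymin; exists z.
exists _, (wotype Swo); split=> [|[f fi]|i]; first exact: Swo.
  have [allsmall|/existsNP[i0 ni0]] := pselect (forall i, small i).
    apply: (@inject_Prop_not K); exists (fun A => f (exist _ A (asboolT (allsmall A)))).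
    by move=> A B /fi [].
  have [|i ni imin] := @well_order_min T R (fun i => ~ small i) Rwo; first by exists i0.
  have lt_small j : R j i -> j <> i -> small j.
    move=> ji nji; apply: contrapT => nj; apply: nji.
    by apply: (well_order_anti Rwo); rewrite ji imin.
  apply: ni; have sumK := inject_sum natK (inject_refl K) natK.
  apply: inject_trans sumK.
  exists (fun j : {j | R j i} => match pselect (sval j <> i) with
    | left h => inl (f (exist _ (sval j) (asboolT (lt_small _ (svalP j) h))))
    | right _ => inr 0%N end).
  move=> [x xi] [y yi] /=; case: pselect => hx; case: pselect => hy //.
    by move=> [] /fi [] xy; apply: eq_exist.
  by move=> _; apply: eq_exist; rewrite (contrapT hx) (contrapT hy).
have [f fi] := asboolW (svalP i).
exists (fun j : {j : wotype Swo | (j <= i)%O} => f (exist _ (sval (sval j)) (svalP j))).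
by move=> [x xi] [y yi] /fi [] xy; apply: eq_exist; apply: val_inj.
Qed.

(** The [i]-th element of [mu] is chosen outside the fewer values taken below [i]. *)
Lemma succ_ordinal_least K d (alpha : orderType d) (mu : Type) :
  well_order (<=%O : rel alpha) ->
  (forall i : alpha, inject {j : alpha | (j <= i)%O} K) ->
  ~ inject mu K -> inject alpha mu.
Proof.
move=> wo small nmu.
have [x0] : inhabited mu.
  apply: contrapT => nx; apply: nmu.
  have h (x : mu) : False by apply: nx.
  by exists (fun x => match h x with end) => x; case: (h x).
have [||i h gd|h hP] := @wf_choice alpha mu _
  (fun i h x => forall j, (j < i)%O -> h j <> x) (order_wf wo).
- by exists.
- by move=> i h h' x hh' hx j ji; rewrite -hh' //; apply: hx.
- apply: contrapT => nx; apply: nmu.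
  have {nx}/choice[g gP] : forall x, exists j, (j < i)%O /\ h j = x.
    move=> x; apply: contrapT => nj; apply: nx; exists x => j ji hj.
    by apply: nj; exists j.
  apply: inject_trans (small i).
  exists (fun x => exist _ (g x) (ltW (gP x).1)) => x y [] gxy.
  by rewrite -(gP x).2 -(gP y).2 gxy.
- exists h => x y hxy; case: (ltgtP x y) => // xy.
  + by case: (hP y x xy).
  + by case: (hP x y xy).
Qed.

(** A cofinal set of cardinality [K] would cover [alpha] by [K] initial segments,
    each of cardinality [K]. *)
Lemma succ_ordinal_cofinal K d (alpha : orderType d) (A : set alpha) :
  inject nat K -> well_order (<=%O : rel alpha) -> ~ inject alpha K ->
  (forall i : alpha, inject {j : alpha | (j <= i)%O} K) ->
  cofinal A -> inject alpha {i | A i}.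
Proof.
move=> natK wo nK small cof; apply: (succ_ordinal_least wo small) => -[f fi].
apply: nK; have /choice[a aP] : forall i, exists a : {a | A a}, (i <= sval a)%O.
  by move=> i; have [a Aa ia] := cof i; exists (exist _ a Aa).
pose g i := projT1 (cid (small i)).
have gi i : injective (g i) := projT2 (cid (small i)).
have g_inj x y i j (p : (i <= x)%O) (q : (j <= y)%O) :
    x = y -> g x (exist _ i p) = g y (exist _ j q) -> i = j.
  by move=> xy; subst y; move=> /gi [].
apply: inject_trans (inject_square natK).
exists (fun i => (f (a i), g (sval (a i)) (exist _ i (aP i)))) => i j [] /fi aij.
by apply: g_inj; rewrite aij.
Qed.

(** * Linear systems, purity and flatness *)

Lemma fctD I (V : zmodType) (f g : I -> V) i : (f + g) i = f i + g i.
Proof. by []. Qed.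

Lemma fctN I (V : zmodType) (f : I -> V) i : (- f) i = - f i.
Proof. by []. Qed.

Section MatrixAction.
Variables (R : pzRingType) (M : lmodType R).
Implicit Types (S : set M).

Definition mact m n (X : 'M[R]_(m, n)) (v : 'I_n -> M) : 'I_m -> M :=
  fun i => \sum_j X i j *: v j.

Lemma mactD m n (X : 'M[R]_(m, n)) v w : mact X (v + w) = mact X v + mact X w.
Proof.
apply/funext => i; rewrite /mact fctD -big_split /=.
by apply: eq_bigr => j _; rewrite fctD scalerDr.
Qed.

Lemma mactN m n (X : 'M[R]_(m, n)) v : mact X (- v) = - mact X v.
Proof.
apply/funext => i; rewrite /mact fctN -sumrN.
by apply: eq_bigr => j _; rewrite fctN scalerN.
Qed.

Lemma mactB m n (X : 'M[R]_(m, n)) v w : mact X (v - w) = mact X v - mact X w.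
Proof. by rewrite mactD mactN. Qed.

Lemma mact0 m n (X : 'M[R]_(m, n)) : mact X 0 = 0.
Proof. by apply/funext => i; apply: big1 => j _; rewrite scaler0. Qed.

Lemma mact0l m n v : mact (0 : 'M[R]_(m, n)) v = 0.
Proof. by apply/funext => i; apply: big1 => j _; rewrite mxE scale0r. Qed.

Lemma mactNl m n (X : 'M[R]_(m, n)) v : mact (- X) v = - mact X v.
Proof.
apply/funext => i; rewrite /mact fctN -sumrN.
by apply: eq_bigr => j _; rewrite mxE scaleNr.
Qed.

Lemma mactM m n p (X : 'M[R]_(m, n)) (Y : 'M[R]_(n, p)) v :
  mact (X *m Y) v = mact X (mact Y v).
Proof.
apply/funext => i; rewrite /mact.
under eq_bigr do rewrite mxE scaler_suml.
rewrite exchange_big; apply: eq_bigr => j _; rewrite scaler_sumr.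
by apply: eq_bigr => k _; rewrite scalerA.
Qed.

Lemma mact1 n (v : 'I_n -> M) : mact 1%:M v = v.
Proof.
apply/funext => i; rewrite /mact (bigD1 i) //= mxE eqxx scale1r big1 ?addr0 // => j ji.
by rewrite mxE eq_sym (negPf ji) scale0r.
Qed.

Definition vcat m n (v : 'I_m -> M) (w : 'I_n -> M) : 'I_(m + n) -> M :=
  fun i => match fintype.split i with inl j => v j | inr j => w j end.

Lemma vcatl m n (v : 'I_m -> M) (w : 'I_n -> M) i : vcat v w (lshift n i) = v i.
Proof. by rewrite /vcat; have := unsplitK (inl i : 'I_m + 'I_n) => /= ->. Qed.

Lemma vcatr m n (v : 'I_m -> M) (w : 'I_n -> M) i : vcat v w (rshift m i) = w i.
Proof. by rewrite /vcat; have := unsplitK (inr i : 'I_m + 'I_n) => /= ->. Qed.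

Lemma mact_row m n p (X : 'M[R]_(m, n)) (Y : 'M[R]_(m, p)) v w :
  mact (row_mx X Y) (vcat v w) = mact X v + mact Y w.
Proof.
apply/funext => i; rewrite /mact big_split_ord fctD; congr (_ + _).
  by apply: eq_bigr => j _; rewrite row_mxEl vcatl.
by apply: eq_bigr => j _; rewrite row_mxEr vcatr.
Qed.

Definition submodS S : Prop := S 0 /\ forall r x y, S x -> S y -> S (r *: x + y).

Definition allin S n (v : 'I_n -> M) : Prop := forall j, S (v j).

Lemma submodS_D S x y : submodS S -> S x -> S y -> S (x + y).
Proof. by move=> [_ Sl] Sx Sy; rewrite -[x]scale1r; apply: Sl. Qed.

Lemma submodS_Z S r x : submodS S -> S x -> S (r *: x).
Proof. by move=> [S0 Sl] Sx; rewrite -[_ *: _]addr0; apply: Sl. Qed.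

Lemma submodS_N S x : submodS S -> S x -> S (- x).
Proof. by move=> sS Sx; rewrite -scaleN1r; apply: submodS_Z. Qed.

Lemma submodS_B S x y : submodS S -> S x -> S y -> S (x - y).
Proof. by move=> sS Sx Sy; apply: submodS_D => //; apply: submodS_N. Qed.

Lemma submodS_sum S I (s : seq I) (P : pred I) (F : I -> M) : submodS S ->
  (forall i, P i -> S (F i)) -> S (\sum_(i <- s | P i) F i).
Proof.
move=> sS SF; apply: big_ind => //; first by case: sS.
by move=> x y; apply: submodS_D.
Qed.

Lemma mact_in S m n (X : 'M[R]_(m, n)) v : submodS S -> allin S v -> allin S (mact X v).
Proof. by move=> sS Sv i; apply: submodS_sum => // j _; apply: submodS_Z. Qed.

Lemma allinD S n (v w : 'I_n -> M) : submodS S -> allin S v -> allin S w -> allin S (v + w).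
Proof. by move=> sS Sv Sw i; apply: submodS_D. Qed.

Lemma allinN S n (v : 'I_n -> M) : submodS S -> allin S v -> allin S (- v).
Proof. by move=> sS Sv i; apply: submodS_N. Qed.

Lemma allin0 S n : submodS S -> allin S (0 : 'I_n -> M).
Proof. by move=> [S0 _] i. Qed.

Lemma allin_vcat S m n (v : 'I_m -> M) (w : 'I_n -> M) :
  allin S v -> allin S w -> allin S (vcat v w).
Proof. by move=> Sv Sw i; rewrite /vcat; case: fintype.split. Qed.

Lemma allin_sub S S' n (v : 'I_n -> M) : S `<=` S' -> allin S v -> allin S' v.
Proof. by move=> SS' Sv i; apply: SS'. Qed.

(** Purity without formulas: for submodules, a pp-condition with parameters in [S]
    amounts to the solvability of a linear system with right-hand side in [S]. *)
Definition purein S S' : Prop := S `<=` S' /\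
  forall m n (X : 'M[R]_(m, n)) u, allin S u ->
    (exists2 w, allin S' w & mact X w = u) -> exists2 w, allin S w & mact X w = u.

Lemma purein_refl S : purein S S.
Proof. by split. Qed.

Lemma purein_trans S S' S'' : purein S S' -> purein S' S'' -> purein S S''.
Proof.
move=> [SS' pS] [SS'' pS']; split; first exact: subset_trans SS''.
by move=> m n X u Su h; apply: pS => //; apply: pS' => //; apply: allin_sub Su.
Qed.

Lemma pp_leP (N N' : {pred M}) : submodS [set` N] ->
  pp_le N N' <-> purein [set` N] [set` N'].
Proof.
move=> sN; split=> -[NN' h].
  split=> // m n X u Nu [w Nw Xw].
  have one : mact (- 1%:M) u = - u by rewrite -[in RHS](mact1 u) -mactN;
    apply/funext => i; apply: eq_bigr => j _; rewrite mxE fctN scaleNr scalerN.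
  have [w' [Nw' Xw']] : pp_sat N (PPFormula X (- 1%:M)) u.
    apply: h => //; exists w; split=> // e.
    by rewrite -/(mact X w e) -/(mact (- 1%:M) u e) one Xw fctN subrr.
  exists w' => //; apply/funext => e; have := Xw' e.
  by rewrite -/(mact X w' e) -/(mact (- 1%:M) u e) one fctN => /subr0_eq.
split=> // k phi v Nv [w [Nw Aw]].
have [||w' Nw' Aw'] := h _ _ (pp_ex_part phi) (- mact (pp_free_part phi) v).
- by apply: allinN => //; apply: mact_in.
- exists w => //; apply/funext => e.
  by rewrite fctN; apply/eqP; rewrite -addr_eq0; apply/eqP; apply: Aw.
exists w'; split=> // e; rewrite -/(mact _ w' e) Aw' fctN.
exact: addNr.
Qed.

(** The equational criterion of flatness.  It makes sense inside an ambient module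
    and involves no tensor product. *)
Definition flatin S : Prop := forall m n (X : 'M[R]_(m, n)) v,
  allin S v -> mact X v = 0 ->
  exists k (C : 'M[R]_(n, k)) y, [/\ allin S y, v = mact C y & X *m C = 0].

(** This is the equational criterion for the quotient [S' / S], with congruences
    modulo [S] lifted to [S'], so that no quotient has to be formed. *)
Definition flatover S S' : Prop := S `<=` S' /\
  forall m n (X : 'M[R]_(m, n)) v, allin S' v -> allin S (mact X v) ->
  exists u k (C : 'M[R]_(n, k)) y,
    [/\ allin S u, allin S' y, v = u + mact C y & X *m C = 0].

Lemma flatover_refl S : flatover S S.
Proof.
split=> // m n X v Sv _; exists v, 0%N, 0, (fun i => match i with Ordinal _ h => 0 end).
split=> //; first by case.
  by rewrite mact0l addr0.
by rewrite mulmx0.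
Qed.

(** Flatness is stable under extensions of [S'' / S'] by [S' / S]: the two
    factorizations are put side by side. *)
Lemma flatover_trans S S' S'' : submodS S'' -> S `<=` S' ->
  flatover S S' -> flatover S' S'' -> flatover S S''.
Proof.
move=> sS'' SS' [_ f1] [S'S'' f2]; split; first exact: subset_trans S'S''.
move=> m n X v Sv SXv.
have [|u [k [C [y [Su Sy vE XC]]]]] := f2 _ _ X v Sv; first exact: allin_sub SXv.
have [||u' [k' [C' [y' [Su' Sy' uE XC']]]]] := f1 _ _ X u => //.
  by move: SXv; rewrite vE mactD -mactM XC mact0l addr0.
exists u', (k' + k)%N, (row_mx C' C), (vcat y' y); split=> //.
- by apply: allin_vcat => //; apply: allin_sub Sy'.
- by rewrite mact_row addrA -uE.
- by rewrite mul_mx_row XC XC' row_mx0.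
Qed.

(** A solution [w = u' + C y] of a system with right-hand side in [S] can be
    replaced by [u'], because [X C = 0]. *)
Lemma flatover_purein S S' : submodS S -> submodS S' -> flatover S S' -> purein S S'.
Proof.
move=> sS sS' [SS' f]; split=> // m n X u Su [w S'w Xw].
have [|u' [k [C [y [Su' Sy wE XC]]]]] := f _ _ X w S'w; first by rewrite Xw.
by exists u' => //; rewrite -Xw wE mactD -mactM XC mact0l addr0.
Qed.

Lemma flatin_purein S S' : purein S S' -> flatin S' -> flatin S.
Proof.
move=> [SS' pS] fS' m n X v Sv Xv.
have [k [C [y [Sy vE XC]]]] := fS' _ _ X v (allin_sub SS' Sv) Xv.
have [|y' Sy' vE'] := pS _ _ C v Sv; first by exists y.
by exists k, C, y'; split.
Qed.

Lemma flatin_flatover S S' : submodS S -> submodS S' -> flatin S -> flatover S S' ->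
  flatin S'.
Proof.
move=> sS sS' fS [SS' f] m n X v Sv Xv.
have [|u [k [C [y [Su Sy vE XC]]]]] := f _ _ X v Sv; first by rewrite Xv; apply: allin0.
have [||k' [C' [y' [Sy' uE XC']]]] := fS _ _ X u => //.
  by move: Xv; rewrite vE mactD -mactM XC mact0l addr0.
exists (k' + k)%N, (row_mx C' C), (vcat y' y); split=> //.
- by apply: allin_vcat => //; apply: allin_sub Sy'.
- by rewrite mact_row -uE.
- by rewrite mul_mx_row XC XC' row_mx0.
Qed.

(** Subtracting a solution in [S], given by purity, turns a dependence modulo [S]
    into a dependence. *)
Lemma flatin_purein_flatover S S' : submodS S' -> purein S S' -> flatin S' ->
  flatover S S'.
Proof.
move=> sS' [SS' pS] fS'; split=> // m n X v Sv SXv.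
have [|u Su Xu] := pS _ _ X _ SXv; first by exists v.
have [||k [C [y [Sy vE XC]]]] := fS' _ _ X (v - u).
- by apply: allinD => //; apply: allinN => //; apply: allin_sub Su.
- by rewrite mactB Xu subrr.
by exists u, k, C, y; split=> //; rewrite -vE addrC subrK.
Qed.

End MatrixAction.

Section Systems.
Variables (R : pzRingType) (V : eqType).

(** A finite homogeneous system in unknowns from [V]: a list of linear forms, each
    a list of coefficient-unknown pairs. *)
Definition solves (M : lmodType R) (L : seq (seq (R * V))) (sigma : V -> M) : Prop :=
  forall t, t \in L -> \sum_(x <- t) x.1 *: sigma x.2 = 0.

Lemma solves_cat (M : lmodType R) L L' (sigma : V -> M) :
  solves (L ++ L') sigma <-> solves L sigma /\ solves L' sigma.
Proof.
split=> [h|[h h'] t]; last by rewrite mem_cat => /orP[/h|/h'].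
by split=> t tL; apply: h; rewrite mem_cat tL ?orbT.
Qed.

Lemma solves_linear (M N : lmodType R) (f : {linear M -> N}) L (sigma : V -> M) :
  solves L sigma -> solves L (f \o sigma).
Proof.
move=> h t /h /(congr1 f); rewrite linear_sum linear0 => {2}<-.
by apply: eq_bigr => x _; rewrite linearZ.
Qed.

Definition coef (t : seq (R * V)) (u : V) : R := \sum_(x <- t | x.2 == u) x.1.

Lemma sum_coef (M : lmodType R) (t : seq (R * V)) (U : seq V) (sigma : V -> M) :
  uniq U -> {subset [seq x.2 | x <- t] <= U} ->
  \sum_(x <- t) x.1 *: sigma x.2 =
  \sum_(j < size U) coef t (tnth (in_tuple U) j) *: sigma (tnth (in_tuple U) j).
Proof.
move=> Uu tU; rewrite -(big_tuple _ _ _ xpredT (fun u => coef t u *: sigma u)) /=.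
under [RHS]eq_bigr do rewrite scaler_suml.
rewrite (exchange_big_dep predT) //= big_seq [RHS]big_seq; apply: eq_bigr => x xt.
have xU : x.2 \in U by apply: tU; apply: map_f.
by rewrite big_mkcond (bigD1_seq x.2) //= eqxx big1 ?addr0 // => u; rewrite eq_sym => /negPf ->.
Qed.

Definition unknowns (L : seq (seq (R * V))) : seq V := flatten [seq [seq x.2 | x <- t] | t <- L].

Lemma unknowns_sub L t : t \in L -> {subset [seq x.2 | x <- t] <= unknowns L}.
Proof. by move=> tL v vt; apply/flatten_mapP; exists t. Qed.

Definition sysmx (L : seq (seq (R * V))) (U : seq V) : 'M[R]_(size L, size U) :=
  \matrix_(i, j) coef (tnth (in_tuple L) i) (tnth (in_tuple U) j).

Lemma solves_sysmx (M : lmodType R) L (U : seq V) (sigma : V -> M) :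
  uniq U -> {subset unknowns L <= U} ->
  solves L sigma <-> mact (sysmx L U) (sigma \o tnth (in_tuple U)) = 0.
Proof.
move=> Uu LU.
have eE t : t \in L -> \sum_(x <- t) x.1 *: sigma x.2 =
   \sum_(j < size U) coef t (tnth (in_tuple U) j) *: sigma (tnth (in_tuple U) j).
  by move=> tL; apply: sum_coef => // v /(unknowns_sub tL)/LU.
split=> [h|h t tL].
  apply/funext => i; rewrite -[RHS](h (tnth (in_tuple L) i)) ?mem_tnth //.
  by rewrite eE ?mem_tnth //; apply: eq_bigr => j _; rewrite mxE.
have [i tE] := seq_tnthP tL.
rewrite eE // -[RHS](congr1 (fun f => f i) h).
by apply: eq_bigr => j _; rewrite mxE tE.
Qed.

(** Extension by zero of values given at the positions of [U]. *)
Definition unindex (M : lmodType R) (U : seq V) (w : 'I_(size U) -> M) (v : V) : M :=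
  match pselect (v \in U) with
  | left vU => w (Ordinal (etrans (index_mem v U) vU)) | right _ => 0 end.

Lemma unindexK (M : lmodType R) (U : seq V) (w : 'I_(size U) -> M) j :
  uniq U -> unindex w (tnth (in_tuple U) j) = w j.
Proof.
move=> Uu; rewrite /unindex; case: pselect => [vU|[]]; last exact: mem_tnth.
congr w; apply: val_inj => /=.
by rewrite (tnth_nth (tnth (in_tuple U) j)) index_uniq.
Qed.

Lemma unindex_in (M : lmodType R) (S : set M) (U : seq V) (w : 'I_(size U) -> M) v :
  S 0 -> allin S w -> S (unindex w v).
Proof. by move=> S0 Sw; rewrite /unindex; case: pselect. Qed.

End Systems.

Lemma mact_linear (R : pzRingType) (M N : lmodType R) (f : {linear M -> N}) m n
  (X : 'M[R]_(m, n)) v : mact X (f \o v) = f \o mact X v.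
Proof.
apply/funext => i; rewrite /mact /= linear_sum.
by apply: eq_bigr => j _; rewrite linearZ.
Qed.

Section SystemFormula.
Variable R : pzRingType.

Definition satS (M : lmodType R) (S : set M) k (phi : pp_formula R k) (v : 'I_k -> M) : Prop :=
  exists2 w, allin S w & mact (pp_ex_part phi) w + mact (pp_free_part phi) v = 0.

Lemma pp_satE (M : lmodType R) (S : {pred M}) k (phi : pp_formula R k) v :
  pp_sat S phi v <-> satS [set` S] phi v.
Proof.
split=> [[w [Sw h]]|[w Sw h]]; exists w => //; first by apply/funext.
by split=> // e; apply: (congr1 (fun f => f e) h).
Qed.

Lemma satS_linear (M N : lmodType R) (f : {linear M -> N}) (S : set M) (S' : set N)
    k (phi : pp_formula R k) v :
  (forall x, S x -> S' (f x)) -> satS S phi v -> satS S' phi (f \o v).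
Proof.
move=> SS' [w Sw h]; exists (f \o w) => [j|]; first exact: SS'.
rewrite !mact_linear; apply/funext => i; have := congr1 (fun g => f (g i)) h.
by rewrite fctD linearD linear0.
Qed.

(** The existential closure of a finite system over the unknowns outside [F]: a
    pp-formula whose free variables are the entries of [F]. *)
Lemma system_formula (V : eqType) (L : seq (seq (R * V))) (F : seq V) :
  exists phi : pp_formula R (size F), forall (M : lmodType R) (S : set M) v, S 0 ->
    satS S phi v <-> exists sigma : V -> M,
      [/\ forall x, S (sigma x), solves L sigma & sigma \o tnth (in_tuple F) = v].
Proof.
pose U := undup (F ++ unknowns L).
have Uu : uniq U by apply: undup_uniq.
have LU : {subset unknowns L <= U} by move=> x xL; rewrite mem_undup mem_cat xL orbT.
have FU : {subset F <= U} by move=> x xF; rewrite mem_undup mem_cat xF.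
pose E : 'M[R]_(size F, size U) :=
  \matrix_(i, j) (tnth (in_tuple F) i == tnth (in_tuple U) j)%:R.
have actE (M : lmodType R) (sigma : V -> M) :
    mact E (sigma \o tnth (in_tuple U)) = sigma \o tnth (in_tuple F).
  apply/funext => i; rewrite /mact /=.
  have /seq_tnthP[j ij] : tnth (in_tuple F) i \in U by apply: FU; apply: mem_tnth.
  rewrite (bigD1 j) //= mxE ij eqxx scale1r big1 ?addr0 // => k kj.
  rewrite mxE ij [_ == _]negbTE ?scale0r //; apply: contra kj => /eqP jk.
  by apply/eqP/(elimT (tuple_uniqP (in_tuple U)) Uu).
exists (PPFormula (col_mx (sysmx L U) E) (col_mx 0 (- 1%:M))) => M S v S0.
have split_eq (w : 'I_(size U) -> M) :
    mact (col_mx (sysmx L U) E) w + mact (col_mx 0 (- 1%:M)) v = 0 <->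
    mact (sysmx L U) w = 0 /\ mact E w = v.
  have up (f : 'I_(size L + size F) -> M) : f = 0 <->
      (forall i, f (lshift _ i) = 0) /\ (forall i, f (rshift _ i) = 0).
    split=> [-> //|[h1 h2]]; apply/funext => i.
    by case: (splitP i) => j ij; [rewrite (_ : i = lshift _ j) ?h1|rewrite (_ : i = rshift _ j) ?h2]; try exact: val_inj.
  have upE i : mact (col_mx (sysmx L U) E) w (lshift (size F) i) + mact (col_mx 0 (- 1%:M)) v (lshift (size F) i)
      = mact (sysmx L U) w i.
    rewrite /mact [X in _ + X]big1 ?addr0; last by move=> j _; rewrite col_mxEu mxE scale0r.
    by apply: eq_bigr => j _; rewrite col_mxEu.
  have dnE i : mact (col_mx (sysmx L U) E) w (rshift (size L) i) + mact (col_mx 0 (- 1%:M)) v (rshift (size L) i)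
      = mact E w i - v i.
    rewrite -[in RHS](mact1 v) /mact -sumrN; congr (_ + _); apply: eq_bigr => j _.
      by rewrite col_mxEd.
    by rewrite col_mxEd !mxE scaleNr.
  rewrite up; split=> -[h1 h2]; split.
  - by apply/funext => i; rewrite -upE; apply: h1.
  - by apply/funext => i; apply/subr0_eq; rewrite -dnE; apply: h2.
  - by move=> i; rewrite fctD upE h1.
  - by move=> i; rewrite fctD dnE h2 subrr.
split=> [[w Sw /split_eq[h1 h2]]|[sigma [Ss sL sF]]].
  exists (unindex w).
  have wE : unindex w \o tnth (in_tuple U) = w by apply/funext => j; apply: unindexK.
  split=> [x||]; first exact: unindex_in.
    by apply/(solves_sysmx _ Uu LU); rewrite wE.
  by rewrite -actE wE.
exists (sigma \o tnth (in_tuple U)) => [j|]; first exact: Ss.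
by apply/split_eq; rewrite actE; split=> //; apply/(solves_sysmx _ Uu LU).
Qed.

End SystemFormula.

Lemma range_submodS (R : pzRingType) (M N : lmodType R) (f : {linear M -> N}) :
  submodS (range f).
Proof.
split=> [|r _ _ [x _ <-] [y _ <-]]; first by exists 0; rewrite ?linear0.
by exists (r *: x + y); rewrite // linearP.
Qed.

Lemma range_pred (T U : Type) (f : T -> U) : [set` [pred y : U | y \in range f]] = range f.
Proof. by apply/seteqP; split=> x /=; rewrite inE. Qed.

(** Purity of a homomorphism, which includes injectivity: the empty system with
    right-hand side [f x = 0] must be solvable. *)
Lemma pure_embeddingP (R : pzRingType) (M N : lmodType R) (f : {linear M -> N}) :
  pure_embedding f <-> forall m n (X : 'M[R]_(m, n)) v w, mact X w = f \o v ->
    exists w', mact X w' = v.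
Proof.
have sr := range_submodS f; split=> [[fi]|h].
  move=> /pp_leP; rewrite range_pred => /(_ sr)[_ fp] m n X v w Xw.
  have [||w' fw' Xw'] := fp _ _ X (f \o v) => [i||]; first by exists (v i).
    by exists w.
  have /choice[u uw'] : forall j, exists x, f x = w' j by move=> j; have [x _ fx] := fw' j; exists x.
  exists u; apply/funext => i; apply: fi; rewrite -[RHS]/((f \o v) i) -Xw'.
  by rewrite -[LHS]/((f \o mact X u) i) -mact_linear; congr (mact X _ i); apply/funext.
split.
  move=> x y fxy; have [|w] := h 1%N 0%N 0 (fun=> x - y) (fun=> 0).
    by rewrite mact0l; apply/funext => i /=; rewrite linearB fxy subrr.
  by rewrite mact0l => /(congr1 (fun g => g ord0))/esym/subr0_eq.
apply/pp_leP; rewrite range_pred //; split=> // m n X u fu [w _ Xw].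
have /choice[v uv] : forall j, exists x, f x = u j by move=> j; have [x _ fx] := fu j; exists x.
have uE : u = f \o v by apply/funext => i; rewrite /= uv.
have [w' Xw'] := h _ _ _ v w (etrans Xw uE).
by exists (f \o w') => [j|]; [exists (w' j)|rewrite mact_linear Xw' uE].
Qed.

(** * The equational criterion of flatness *)

Section SubmoduleOfSet.
Variables (R : pzRingType) (M : lmodType R) (S : set M) (sS : submodS S).

Definition smod of submodS S : {pred M} := [pred x | `[< S x >]].

Lemma smod_closed : subsemimod_closed (smod sS).
Proof.
split; first split; first by apply: asboolT; case: sS.
  by move=> x y /asboolW Sx /asboolW Sy; apply: asboolT; apply: submodS_D.
by move=> r x /asboolW Sx; apply: asboolT; apply: submodS_Z.
Qed.

HB.instance Definition _ := GRing.isSubmodClosed.Build R M (smod sS) smod_closed.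

Definition submod : submodClosed M := smod sS.

Lemma in_submodP x : (x \in submod) <-> S x.
Proof. by split=> [/asboolW|/asboolT]. Qed.

Lemma submodE : [set` submod] = S.
Proof. by apply/seteqP; split=> x /in_submodP. Qed.

End SubmoduleOfSet.

Lemma submodS_closed (R : pzRingType) (M : lmodType R) (C : submodClosed M) : submodS [set` C].
Proof. by split=> [|r x y Cx Cy]; [apply: rpred0|apply: rpredD => //; apply: rpredZ]. Qed.

Section FreeGroupLift.
Variables (K : choiceType) (G : zmodType).

Definition flift (F : K -> G) (x : {freeg K / int}) : G := fglift (F : K -> zmodule G) x.

Lemma fliftB F : {morph flift F : x y / x - y}.
Proof. by move=> x y; have := @lift_is_additive int K (zmodule G) F x y; rewrite /flift => ->. Qed.

Lemma fliftU F k : flift F << k >> = F k.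
Proof. by rewrite /flift liftU scale1r. Qed.

Lemma flift0 F : flift F 0 = 0.
Proof. by rewrite -[X in flift F X](subrr 0) fliftB subrr. Qed.

Lemma additive_freegE (h : {freeg K / int} -> G) x : {morph h : x y / x - y} ->
  h x = \sum_(z <- dom x) h << z >> *~ coeff z x.
Proof.
move=> hB; pose ha : {additive {freeg K / int} -> G} :=
  HB.pack h (GRing.isZmodMorphism.Build _ _ h hB).
transitivity (ha (\sum_(z <- dom x) << coeff z x *g z >>)); first by rewrite freeg_sumE.
rewrite raddf_sum; apply: eq_bigr => z _.
by rewrite -[coeff z x in LHS]intz -freegU_mulz raddfMz.
Qed.

Lemma fliftE F x : flift F x = \sum_(z <- dom x) F z *~ coeff z x.
Proof.
by rewrite (additive_freegE x (fliftB F)); apply: eq_bigr => z _; rewrite fliftU.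
Qed.

Lemma eq_flift F F' x : {in dom x, F =1 F'} -> flift F x = flift F' x.
Proof.
by move=> FF'; rewrite !fliftE; apply: eq_big_seq => z /FF' ->.
Qed.

End FreeGroupLift.

Lemma flift_comp (K : choiceType) (G H : zmodType) (F : K -> G) (h : G -> H) x :
  {morph h : x y / x - y} -> h (flift F x) = flift (h \o F) x.
Proof.
move=> hB; rewrite [RHS]fliftE -/((h \o flift F) x) (@additive_freegE _ _ (h \o flift F)).
  by apply: eq_bigr => z _; rewrite /= fliftU.
by move=> u v; rewrite /= fliftB hB.
Qed.

Lemma flift_freegU (K : choiceType) (x : {freeg K / int}) : flift (fun k => << k >>) x = x.
Proof.
by rewrite fliftE; apply/esym/(@additive_freegE _ _ id).
Qed.

Section TensorTheory.
Variables (R : pzRingType) (A : lmodType R^c) (M : lmodType R).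
Local Open Scope quotient_scope.

Lemma pi_tensorB : {morph \pi_(tensor A M) : x y / x - y}.
Proof. by move=> x y; rewrite pi_tensor_add pi_tensor_opp. Qed.

Lemma pi_tensorD : {morph \pi_(tensor A M) : x y / x + y}.
Proof. by move=> x y; rewrite pi_tensor_add. Qed.

Lemma pi_tensor_flift x : \pi_(tensor A M) x = flift (fun am => tens am.1 am.2) x.
Proof.
rewrite -[in LHS](flift_freegU x) (flift_comp _ _ pi_tensorB).
by apply: eq_flift => -[a m] _.
Qed.

Lemma tensB (a a' : A) (m : M) : tens (a - a') m = tens a m - tens a' m.
Proof.
rewrite /tens -pi_tensorB; apply/pi_tensorP.
have := tensor_nullN (tensor_null_addl (a - a') a' m).
by rewrite subrK !opprB addrCA.
Qed.

Lemma tensD (a a' : A) (m : M) : tens (a + a') m = tens a m + tens a' m.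
Proof. by have := tensB (a + a') a' m; rewrite addrK => ->; rewrite subrK. Qed.

Lemma tensDr (a : A) (m m' : M) : tens a (m + m') = tens a m + tens a m'.
Proof.
rewrite /tens -pi_tensorD; apply/pi_tensorP.
by rewrite opprD addrA; apply: tensor_null_addr.
Qed.

Lemma tensZ (r : R) (a : A) (m : M) : tens ((r : R^c) *: a) m = tens a (r *: m).
Proof. exact/pi_tensorP/tensor_null_bal. Qed.

Lemma tens0 (m : M) : tens (0 : A) m = 0.
Proof. by have := tensB 0 0 m; rewrite !subrr. Qed.

Lemma tens0r (a : A) : tens a (0 : M) = 0.
Proof. by apply: (addrI (tens a 0)); rewrite -tensDr !addr0. Qed.

Lemma tens_sum I (s : seq I) (F : I -> A) (m : M) :
  tens (\sum_(i <- s) F i) m = \sum_(i <- s) tens (F i) m.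
Proof.
by elim: s => [|i s IHs]; rewrite ?big_nil ?tens0 // !big_cons tensD IHs.
Qed.

Lemma tens_sumr I (s : seq I) (a : A) (F : I -> M) :
  tens a (\sum_(i <- s) F i) = \sum_(i <- s) tens a (F i).
Proof.
by elim: s => [|i s IHs]; rewrite ?big_nil ?tens0r // !big_cons tensDr IHs.
Qed.

Definition balanced (P : lmodType R) (G : zmodType) (beta : A -> P -> G) : Prop :=
  [/\ forall a a' p, beta (a + a') p = beta a p + beta a' p,
      forall a p p', beta a (p + p') = beta a p + beta a p' &
      forall (r : R) a p, beta ((r : R^c) *: a) p = beta a (r *: p)].

(** The vanishing of a tensor involves finitely many elements of [M] and finitely
    many linear relations between them; any assignment satisfying the same
    relations in another module yields a vanishing tensor. *)
Lemma tensor_null_local (x : {freeg (A * M)%type / int}) : tensor_null x ->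
  exists L : seq (seq (R * M)), solves L id /\
    forall (P : lmodType R) (G : zmodType) (beta : A -> P -> G) (sigma : M -> P),
      balanced beta -> solves L sigma ->
      flift (fun am => beta am.1 (sigma am.2)) x = 0.
Proof.
elim=> [a a' m|a m m'|r a m||u w _ [L [sL hL]] _ [L' [sL' hL']]].
- exists [::]; split=> // P G beta sigma [bD _ _] _.
  by rewrite !fliftB !fliftU /= bD -addrA -opprD subrr.
- exists [:: [:: (1, m + m'); (- 1, m); (- 1, m')]]; split.
    move=> t; rewrite inE => /eqP ->; rewrite !big_cons big_nil /= !scaleN1r scale1r addr0.
    by rewrite -opprD subrr.
  move=> P G beta sigma [_ bD bZ] /(_ _ (mem_head _ _)).
  rewrite !big_cons big_nil /= !scaleN1r scale1r addr0 -opprD => /subr0_eq e.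
  by rewrite !fliftB !fliftU /= e bD -addrA -opprD subrr.
- exists [:: [:: (1, r *: m); (- r, m)]]; split.
    move=> t; rewrite inE => /eqP ->; rewrite !big_cons big_nil /=.
    by rewrite scale1r addr0 scaleNr subrr.
  move=> P G beta sigma [_ bD bZ] /(_ _ (mem_head _ _)).
  rewrite !big_cons big_nil /= scale1r addr0 scaleNr => /subr0_eq e.
  by rewrite fliftB !fliftU /= bZ e subrr.
- by exists [::]; split=> // *; rewrite flift0.
- exists (L ++ L'); split; first by apply/solves_cat.
  move=> P G beta sigma bb /solves_cat[h h'].
  by rewrite fliftB (hL _ _ _ _ bb h) (hL' _ _ _ _ bb h') subrr.
Qed.

End TensorTheory.

Section FlatnessCriterion.
Local Open Scope quotient_scope.
Variables (R : pzRingType) (M : lmodType R).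

Lemma morphB_sum (G H : zmodType) (I : Type) (r : seq I) (F : I -> G) (h : G -> H) :
  {morph h : x y / x - y} -> h (\sum_(i <- r) F i) = \sum_(i <- r) h (F i).
Proof.
move=> hB; have h0 : h 0 = 0 by rewrite -(subrr 0) hB subrr.
have hN x : h (- x) = - h x by rewrite -sub0r hB h0 sub0r.
by apply: (big_morph h) => // x y; rewrite -[y]opprK hB !hN opprK.
Qed.

Lemma unindexP (V : eqType) (N : lmodType R) (U : seq V) (w : 'I_(size U) -> N) (P : N -> V -> Prop) v :
  uniq U -> v \in U -> (forall j, P (w j) (tnth (in_tuple U) j)) -> P (unindex w v) v.
Proof.
move=> Uu vU h; have [j ->] := seq_tnthP vU.
by rewrite unindexK.
Qed.

(** The vanishing of the image of a tensor in [B * M] involves finitely many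
    elements of [M]; the criterion factors these through a finite free module, over
    which tensors are tuples of elements of [A], and [f] is injective on tuples. *)
Lemma flatin_flat : @flatin R M setT -> flat M.
Proof.
move=> fM A B f fi t t'; rewrite -[t]reprK -[t']reprK !tensor_mapE.
move: (repr t) (repr t') => {t t'} x x' /pi_tensorP; rewrite -free_mapB => xx'.
suff {xx'} null (z : {freeg (A * M)%type / int}) : tensor_null (free_map f z) ->
    \pi_(tensor A M) z = 0.
  by apply/eqP; rewrite -subr_eq0 -pi_tensorB null.
move=> /tensor_null_local[L [Lid Lkill]].
pose U := undup (unknowns L ++ [seq am.2 | am <- dom z]).
have Uu : uniq U by apply: undup_uniq.
have LU : {subset unknowns L <= U} by move=> u uL; rewrite mem_undup mem_cat uL.
have zU am : am \in dom z -> am.2 \in U.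
  by move=> amz; rewrite mem_undup mem_cat map_f ?orbT.
have /(solves_sysmx _ Uu LU)LUid := Lid.
have [//|k [C [y [_ vE XC]]]] := fM _ _ (sysmx L U) (id \o tnth (in_tuple U)) _ LUid.
pose sigma : M -> ('I_k -> R^o) := unindex (fun j => (fun l => C j l) : 'I_k -> R^o).
have sigmaL : solves L sigma.
  apply/(solves_sysmx _ Uu LU); apply/funext => i; apply/funext => l.
  transitivity ((sysmx L U *m C) i l); last by rewrite XC mxE.
  rewrite [RHS]mxE /mact fct_sumE; apply: eq_bigr => j _.
  by rewrite scalrfctE /= /sigma unindexK.
have sigmay am : am \in dom z -> am.2 = \sum_l (sigma am.2 l : R) *: y l.
  move=> /zU amU; rewrite /sigma.
  apply: (@unindexP _ ('I_k -> R^o) _ _ (fun p v => v = \sum_l (p l : R) *: y l)) => // j.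
  exact: (congr1 (fun g => g j) vE).
pose beta (D : lmodType R^c) (d : D) (p : 'I_k -> R^o) : 'I_k -> D := fun l => ((p l : R) : R^c) *: d.
have bb D : balanced (@beta D).
  split=> [d d' p|d p p'|r d p]; apply/funext => l; rewrite /beta.
  - by rewrite fctD scalerDr.
  - by rewrite !fctD scalerDl.
  - by rewrite scalerA.
pose FA (am : A * M) := beta A am.1 (sigma am.2).
pose FB (am : B * M) := beta B am.1 (sigma am.2).
have FB0 : flift FB (free_map f z) = 0 := Lkill _ _ _ _ (bb B) sigmaL.
have hz : flift FA z = 0.
  apply/funext => l; apply: fi; rewrite [RHS]linear0.
  pose hA (g : 'I_k -> A) := f (g l); pose hB u := flift FB (free_map f u) l.
  transitivity (hB z); last by rewrite /hB FB0.
  rewrite -/(hA (flift FA z)) (@flift_comp _ _ _ _ hA); last first.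
    by move=> u v; rewrite /hA /= linearB.
  rewrite (@additive_freegE _ _ hB); last by move=> u v; rewrite /hB free_mapB fliftB.
  rewrite fliftE; apply: eq_bigr => -[a m] _; congr (_ *~ _).
  by rewrite /hB free_mapU fliftU /hA /FB /= /beta linearZ.
rewrite pi_tensor_flift.
rewrite (@eq_flift _ _ _ (fun am => \sum_l tens (beta A am.1 (sigma am.2) l) (y l))); last first.
  move=> am /sigmay amE; rewrite [in LHS]amE tens_sumr; apply: eq_bigr => l _.
  by rewrite -tensZ.
pose h (g : 'I_k -> A) := \sum_l tens (g l) (y l).
rewrite -[flift _ _](@flift_comp _ _ _ _ h) ?hz.
  by apply: big1 => l _; rewrite tens0.
by move=> u v; rewrite /h -sumrB; apply: eq_bigr => l _; rewrite -tensB.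
Qed.

(** The columns of [X] generate a submodule [A] of [R ^ m].  The tensor with terms
    [X_j * v_j] vanishes over [R ^ m], since [X v = 0], hence over [A] by flatness.
    Lifting the elements of [A] to [R ^ n] then shows that [v] lies in [K M], where
    [K] is the kernel of [X]. *)
Lemma flat_flatin : flat M -> @flatin R M setT.
Proof.
move=> fM m n X v _ Xv.
pose B : lmodType R^c := ('I_m -> (R^c)^o).
pose Xact (s : 'I_n -> R) : B := fun i => \sum_j X i j * s j.
have XactD s s' : Xact (fun j => s j + s' j) = Xact s + Xact s'.
  apply/funext => i; rewrite /Xact fctD -big_split; apply: eq_bigr => j _.
  by rewrite mulrDr.
have XactZ (r : R) s : Xact (fun j => s j * r) = (r : R^c) *: Xact s.
  apply/funext => i; rewrite /Xact -[RHS]/((\sum_j X i j * s j : R) * r) mulr_suml.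
  by apply: eq_bigr => j _; rewrite mulrA.
pose S : set B := range Xact.
have sS : submodS S.
  split=> [|r _ _ [s _ <-] [s' _ <-]].
    exists (fun=> 0) => //; apply/funext => i; by apply: big1 => j _; rewrite mulr0.
  by exists (fun j => s j * r + s' j) => //; rewrite XactD XactZ.
pose A : lmodType R^c := subm (submod sS).
pose ej (j : 'I_n) : 'I_n -> R := fun j' => (j' == j)%:R.
have colS j : Xact (ej j) \in submod sS by apply/in_submodP; exists (ej j).
pose col j : A := Sub (Xact (ej j)) (colS j).
pose eB (i : 'I_m) : B := fun i' => (i' == i)%:R.
have colE j : \val (col j) = \sum_i (X i j : R^c) *: eB i.
  rewrite SubK; apply/funext => i; rewrite fct_sumE.
  rewrite (bigD1 i) //= big1 ?addr0.
    rewrite /Xact (bigD1 j) //= big1 ?addr0 => [|k kj].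
      by rewrite /ej eqxx mulr1 scalrfctE /eB eqxx; exact: (esym (mul1r (X i j : R))).
    by rewrite /ej (negPf kj) mulr0.
  by move=> k ki; rewrite scalrfctE /eB eq_sym (negPf ki); exact: (mul0r (X k j : R)).
pose x : {freeg (A * M)%type / int} := \sum_j << (col j, v j) >>.
have xnull : tensor_null x.
  rewrite -[x]subr0; apply/pi_tensorP; pose f : {linear A -> B} := \val.
  have fcol j : f (col j) = \sum_i (X i j : R^c) *: eB i := colE j.
  apply: (fM _ _ f) => [a b /val_inj //|].
  rewrite !tensor_mapE -[in RHS](subrr 0) free_mapB subrr.
  rewrite (morphB_sum _ _ (@free_mapB _ _ _ _ f)).
  rewrite (morphB_sum _ _ (@pi_tensorB _ _ _)).
  under eq_bigr => j _ do rewrite free_mapU -/(tens _ _) fcol tens_sum.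
  rewrite exchange_big /= big1 // => i _.
  under eq_bigr => j _ do rewrite tensZ.
  by rewrite -tens_sumr -/(mact X v i) Xv tens0r.
(* The subgroup [K M] of [M ^ n]. *)
pose KM (u : 'I_n -> M) := exists k (C : 'M[R]_(n, k)) y, u = mact C y /\ X *m C = 0.
have KMB u w : KM u -> KM w -> KM (u - w).
  move=> [k [C [y [-> XC]]]] [k' [C' [y' [-> XC']]]].
  exists (k + k')%N, (row_mx C (- C')), (vcat y y').
  by rewrite mact_row mactNl mul_mx_row mulmxN XC XC' oppr0 row_mx0.
have KM1 (c : 'I_n -> R) p : Xact c = 0 -> KM (fun j => c j *: p).
  move=> Xc; exists 1%N, (\matrix_(j, _) c j), (fun=> p); split.
    by apply/funext => j; rewrite /mact big_ord1 mxE.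
  apply/matrixP => i l; rewrite !mxE -[RHS](congr1 (fun g => g i) Xc).
  by apply: eq_bigr => j _; rewrite mxE.
have /choice[s sP] : forall a : A, exists s : 'I_n -> R, Xact s = \val a.
  by move=> a; have /in_submodP[s _ sa] := valP a; exists s.
pose F (am : A * M) : 'I_n -> M := fun j => s am.1 j *: am.2.
have KMF (z : {freeg (A * M)%type / int}) : tensor_null z -> KM (flift F z).
  have XactB c c' : Xact (fun j => c j - c' j) = Xact c - Xact c'.
    apply/funext => i; rewrite /Xact fctD fctN -sumrB; apply: eq_bigr => j _.
    by rewrite mulrBr.
  elim=> [a a' p|a p p'|r a p||u w _ hu _ hw].
  - rewrite !fliftB !fliftU /F /=.
    rewrite [X in KM X](_ : _ = fun j => (s (a + a') j - s a j - s a' j) *: p).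
      by apply: KM1; rewrite !XactB !sP linearD addrAC subrr sub0r || rewrite !XactB !sP linearD /= -addrA -opprD subrr.
    by apply/funext => j; rewrite !scalerBl.
  - rewrite !fliftB !fliftU /F /= [X in KM X](_ : _ = 0).
      by exists 0%N, 0, (fun=> 0); rewrite mact0l mulmx0.
    by apply/funext => j; rewrite !fctD !fctN scalerDr -addrA -opprD subrr.
  - rewrite !fliftB !fliftU /F /=.
    rewrite [X in KM X](_ : _ = fun j => (s ((r : R^c) *: a) j - s a j * r) *: p).
      by apply: KM1; rewrite XactB XactZ !sP linearZ subrr.
    by apply/funext => j; rewrite scalerBl -scalerA.
  - by rewrite flift0; exists 0%N, 0, (fun=> 0); rewrite mact0l mulmx0.
  - by rewrite fliftB; apply: KMB.
have xE : flift F x = v - \sum_j (fun j' => (ej j j' - s (col j) j') *: v j).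
  rewrite (morphB_sum _ _ (fliftB F)); apply/funext => j'.
  rewrite fctD fctN !fct_sumE; under [X in _ - X]eq_bigr do rewrite scalerBl.
  rewrite sumrB opprB addrC -addrA [X in _ = _ + X](_ : _ = 0) ?addr0.
    by apply: eq_bigr => j _; rewrite fliftU.
  rewrite addrC; apply/eqP; rewrite subr_eq0; apply/eqP.
  rewrite (bigD1 j') //= /ej eqxx scale1r big1 ?addr0 // => j jj'.
  by rewrite eq_sym (negPf jj') scale0r.
have KMsum : KM (\sum_j (fun j' => (ej j j' - s (col j) j') *: v j)).
  have KM0 : KM 0 by exists 0%N, 0, (fun=> 0); rewrite mact0l mulmx0.
  apply: big_ind => // [u w Ku Kw|j _].
    by rewrite -[w]opprK; apply: (KMB) => //; rewrite -[- w]sub0r; apply: (KMB).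
  apply: KM1; transitivity (Xact (ej j) - Xact (s (col j))).
    apply/funext => i; rewrite /Xact fctD fctN -sumrB; apply: eq_bigr => k _.
    by rewrite mulrBr.
  by rewrite sP SubK subrr.
have [k [C [y [vE XC]]]] : KM v.
  have -> : v = flift F x - (0 - \sum_j (fun j' => (ej j j' - s (col j) j') *: v j)).
    by rewrite xE sub0r opprK subrK.
  apply: (KMB); first exact: KMF.
  by apply: (KMB) => //; exists 0%N, 0, (fun=> 0); rewrite mact0l mulmx0.
by exists k, C, y.
Qed.

Lemma flatP : flat M <-> @flatin R M setT.
Proof. by split=> [/flat_flatin|/flatin_flat]. Qed.

End FlatnessCriterion.

(** * Characters *)

Definition divisible (D : zmodType) : Prop :=
  forall n (d : D), (0 < n)%N -> exists e : D, e *+ n = d.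

Definition subgroupS (G : zmodType) (H : set G) : Prop :=
  H 0 /\ forall x y, H x -> H y -> H (x - y).

Section Subgroups.
Variables (G : zmodType) (H : set G).
Hypothesis sH : subgroupS H.

Lemma subgroupS_N x : H x -> H (- x).
Proof. by move=> Hx; rewrite -sub0r; apply: sH.2 => //; exact: sH.1. Qed.

Lemma subgroupS_D x y : H x -> H y -> H (x + y).
Proof. by move=> Hx Hy; rewrite -[y]opprK; apply: sH.2 => //; apply: subgroupS_N. Qed.

Lemma subgroupS_Mz x (k : int) : H x -> H (x *~ k).
Proof.
move=> Hx; have Hn n : H (x *+ n).
  by elim: n => [|n IHn]; [exact: sH.1|rewrite mulrS; apply: subgroupS_D].
by case: k => n; [exact: Hn|rewrite NegzE mulrNz; apply: subgroupS_N; exact: Hn].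
Qed.

(** The order of [g] modulo [H], zero when it is infinite. *)
Lemma order_mod g : exists n : nat, forall k : int, H (g *~ k) <-> (n%:Z %| k)%Z.
Proof.
have [[m0 m0P]|no] := pselect (exists m, `[< (0 < m)%N /\ H (g *+ m) >]).
  have [n /asboolP[n0 Hn] nmin] := ex_minnP (ex_intro (fun m => `[< (0 < m)%N /\ H (g *+ m) >]) m0 m0P).
  exists n => k; split=> [Hk|/dvdzP[q ->]]; last first.
    by rewrite mulrC mulrzA; apply: subgroupS_Mz.
  have nz : n%:Z != 0 by rewrite -lt0n.
  have Hr : H (g *~ (k %% n%:Z)%Z).
    rewrite /modz mulrzBr; apply: sH.2 => //.
    by rewrite mulrC mulrzA; apply: subgroupS_Mz.
  have := modz_ge0 k nz; have := ltz_pmod k (n0 : (0 < n%:Z)%R).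
  case E : (k %% n%:Z)%Z Hr => [r|//] Hr rn _.
  apply/dvdz_mod0P; rewrite E; case: r rn Hr {E} => // r rn Hr.
  by have := nmin r.+1 (asboolT (conj (ltn0Sn r) Hr)); rewrite leqNgt => /negP[].
exists 0%N => k; rewrite dvd0z; split=> [|/eqP->]; last by rewrite mulr0z; exact: sH.1.
case: k => [[|n]|n] // Hk; case: no; exists n.+1; apply: asboolT; split=> //.
by move: Hk; rewrite NegzE mulrNz => /subgroupS_N; rewrite opprK.
Qed.

End Subgroups.

Lemma pairMz (G D : zmodType) (g : G) (e : D) (k : int) : (g, e) *~ k = (g *~ k, e *~ k).
Proof.
have Mn n : (g, e) *+ n = (g *+ n, e *+ n) by elim: n => // n; rewrite !mulrS => ->.
by case: k => n; [exact: Mn|rewrite !NegzE !mulrNz -!pmulrn Mn].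
Qed.

(** Divisible groups are injective.  Partial homomorphisms are handled as
    subgroups of the product that are graphs of functions. *)
Lemma divisible_ext (G D : zmodType) (r : set (G * D)) : divisible D ->
  subgroupS r -> (forall d, r (0, d) -> d = 0) ->
  exists chi : G -> D, {morph chi : x y / x - y} /\ forall x d, r (x, d) -> chi x = d.
Proof.
move=> divD sr fr.
pose P (s : set (G * D)) := subgroupS s /\ forall d, s (0, d) -> d = 0.
have [//|F [X0 FX0] FP Fch|s [rs [ss fs] smax]] := @Zorn_above _ P r.
  split; last by move=> d [X FX Xd]; apply: (FP X FX).1.2.
  split; first by exists X0 => //; exact: (FP X0 FX0).1.1.1.
  move=> x y [X FX Xx] [Y FY Yy].
  by have [XY|YX] := Fch _ _ FX FY; [exists Y => //; apply: (FP Y FY).1.1.2 => //; apply: XY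
                                    |exists X => //; apply: (FP X FX).1.1.2 => //; apply: YX].
have tot g : exists d, s (g, d).
  pose H : set G := [set x | exists d, s (x, d)].
  have sH : subgroupS H.
    split; first by exists 0; exact: ss.1.
    by move=> x y [d sx] [e sy]; exists (d - e); exact: ss.2 sx sy.
  have [n nP] := order_mod sH g.
  have [e eP] : exists e, s (g *+ n, e *+ n).
    case: n {nP} (nP n%:Z) => [_|n [_ /(_ (dvdzz _))[d sd]]]; first by exists 0; exact: ss.1.
    by have [e ed] := divD n.+1 d (ltn0Sn n); exists e; rewrite ed.
  pose s' : set (G * D) := [set p | exists q k, s q /\ p = (q.1 + g *~ k, q.2 + e *~ k)].
  have ss' : s `<=` s' by move=> [x d] sxd; exists (x, d), 0; rewrite !mulr0z !addr0.
  suff <- : s' = s by exists (0 + e *~ 1), (0, 0), 1; rewrite ?add0r; split=> //; exact: ss.1.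
  apply: smax => //; split; first split.
  - by exists (0, 0), 0; rewrite !mulr0z !addr0; split=> //; exact: ss.1.
  - move=> _ _ [[x d] [k [sx ->]]] [[y d'] [l [sy ->]]].
    exists (x - y, d - d'), (k - l); split; first exact: ss.2 sx sy.
    by rewrite /= !mulrzBr [RHS](_ : _ = (x + g *~ k - (y + g *~ l), d + e *~ k - (d' + e *~ l))) // !opprD; congr (_, _); rewrite addrACA.
  - move=> d [[x d'] [k [/= sx [/esym/eqP xk ->]]]].
    have /dvdzP[q kq] : (n%:Z %| k)%Z.
      apply/nP; exists (- d'); move: xk; rewrite addr_eq0 => /eqP xk.
      by rewrite -[g *~ k]opprK -xk; apply: (subgroupS_N ss sx).
    apply: fs; have := subgroupS_D ss sx (subgroupS_Mz ss q eP).
    have -> : (g *+ n, e *+ n) *~ q = (g *~ k, e *~ k).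
      by rewrite (pmulrn g) (pmulrn e) -pairMz -mulrzA mulrC -kq pairMz.
    by rewrite -[_ + _]/(x + g *~ k, d' + e *~ k) (eqP xk).
have [chi chiP] := choice tot.
have schi x d : s (x, d) -> chi x = d.
  move=> sx; apply/eqP; rewrite -subr_eq0; apply/eqP/fs.
  by rewrite -(subrr x); exact: ss.2 (chiP x) sx.
exists chi; split=> [x y|x d /rs]; last exact: schi.
by apply: schi; exact: ss.2 (chiP x) (chiP y).
Qed.

Section QuotientModule.
Variables (R : pzRingType) (M : lmodType R) (S : submodClosed M).
Local Open Scope quotient_scope.

(** A copy of [S] that carries the structure of a subgroup. *)
Definition lquot_pred : {pred M} := [pred x | x \in S].

Lemma lquot_pred_closed : zmod_closed lquot_pred.
Proof.
split=> [|x y]; rewrite !inE; first exact: rpred0.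
by move=> Sx Sy; rewrite rpredD // -scaleN1r rpredZ.
Qed.

HB.instance Definition _ := GRing.isZmodClosed.Build M lquot_pred lquot_pred_closed.

Definition lquot : Type := Quotient.quot lquot_pred.

HB.instance Definition _ := GRing.Zmodule.on lquot.

Definition lquot_pi (x : M) : lquot := \pi_(Quotient.quot lquot_pred) x.

Lemma lquot_pi_eq x y : lquot_pi x = lquot_pi y <-> x - y \in S.
Proof.
by rewrite -[x - y \in S]/(x - y \in lquot_pred) Quotient.idealrBE; split=> /eqP.
Qed.

Lemma lquot_pi_surj q : exists x, lquot_pi x = q.
Proof. by exists (repr (q : Quotient.quot lquot_pred)); rewrite /lquot_pi reprK. Qed.

Definition lquot_scale (r : R) (q : lquot) : lquot :=
  lquot_pi (r *: repr (q : Quotient.quot lquot_pred)).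

Lemma lquot_scaleE r x : lquot_scale r (lquot_pi x) = lquot_pi (r *: x).
Proof.
by apply/lquot_pi_eq; rewrite -scalerBr rpredZ //; apply/lquot_pi_eq; rewrite /lquot_pi reprK.
Qed.

Lemma lquot_piD : {morph lquot_pi : x y / x + y}.
Proof. by move=> x y; rewrite /lquot_pi raddfD. Qed.

Lemma lquot_scaleA a b q : lquot_scale a (lquot_scale b q) = lquot_scale (a * b) q.
Proof. by have [x <-] := lquot_pi_surj q; rewrite !lquot_scaleE scalerA. Qed.

Lemma lquot_scale1 : left_id 1 lquot_scale.
Proof. by move=> q; have [x <-] := lquot_pi_surj q; rewrite lquot_scaleE scale1r. Qed.

Lemma lquot_scaleDr : right_distributive lquot_scale +%R.
Proof.
move=> r q q'; have [x <-] := lquot_pi_surj q; have [y <-] := lquot_pi_surj q'.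
by rewrite -lquot_piD !lquot_scaleE -lquot_piD scalerDr.
Qed.

Lemma lquot_scaleDl q : {morph lquot_scale^~ q : a b / a + b}.
Proof.
by move=> a b; have [x <-] := lquot_pi_surj q; rewrite !lquot_scaleE -lquot_piD scalerDl.
Qed.

HB.instance Definition _ := GRing.Zmodule_isLmodule.Build R lquot
  lquot_scaleA lquot_scale1 lquot_scaleDr lquot_scaleDl.

Lemma lquot_pi_is_linear : linear lquot_pi.
Proof. by move=> r x y; rewrite lquot_piD -lquot_scaleE. Qed.

HB.instance Definition _ := GRing.isLinear.Build R M lquot _ lquot_pi lquot_pi_is_linear.

End QuotientModule.

Lemma linear_ext (R : pzRingType) (M N : lmodType R) (h : M -> N) :
  (forall r x y, h (r *: x + y) = r *: h x + h y) ->
  exists f : {linear M -> N}, f = h :> (M -> N).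
Proof.
move=> hl; pose f : {linear M -> N} := HB.pack h (GRing.isLinear.Build R M N *:%R h hl).
by exists f.
Qed.

Definition rat_integers : {pred rat} := [pred x | x \is a Num.int].

Lemma rat_integers_closed : zmod_closed rat_integers.
Proof. by split=> [|x y]; rewrite !inE; [exact: rpred0|exact: rpredB]. Qed.

HB.instance Definition _ := GRing.isZmodClosed.Build rat rat_integers rat_integers_closed.

(** The rationals modulo one, a divisible cogenerator of abelian groups. *)
Definition QZ : zmodType := Quotient.quot rat_integers.

Definition pQZ (x : rat) : QZ := (\pi_(Quotient.quot rat_integers) x)%qT.

Lemma pQZ_eq0 x : pQZ x = 0 <-> x \is a Num.int.
Proof.
have -> : (0 : QZ) = pQZ 0 by rewrite /pQZ raddf0.
rewrite [X in _ <-> is_true X](_ : _ = (x - 0 \in rat_integers)); last by rewrite subr0.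
by rewrite Quotient.idealrBE; split=> /eqP.
Qed.

Lemma pQZ_Mz x (k : int) : pQZ x *~ k = pQZ (x *~ k).
Proof. by rewrite /pQZ raddfMz. Qed.

Lemma QZ_divisible : divisible QZ.
Proof.
move=> n d n0; exists (pQZ (repr (d : Quotient.quot _) / n%:R)).
rewrite pmulrn pQZ_Mz -pmulrn -[X in pQZ X]mulr_natr divfK; last by rewrite pnatr_eq0 -lt0n.
by rewrite /pQZ reprK.
Qed.

Lemma QZ_order n : n != 1%N -> exists2 d : QZ, d != 0 & forall k : int, (n%:Z %| k)%Z -> d *~ k = 0.
Proof.
move=> n1; pose m := if n is 0%N then 2%N else n.
have m2 : (1 < m)%N by rewrite /m; case: (n) n1 => [|[]].
exists (pQZ m%:R^-1).
  apply/eqP => /pQZ_eq0 /intrP[z zm].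
  have : (z * m%:Z)%:~R = 1%:~R :> rat.
    by rewrite intrM -zm -pmulrn mulVf // pnatr_eq0; case: (m) m2.
  move=> /intr_inj zm1; have : (`|z| * m)%N = 1%N by have := congr1 absz zm1; rewrite abszM.
  by move=> /eqP; rewrite muln_eq1 => /andP[_ /eqP me]; rewrite me in m2.
move=> k nk; rewrite pQZ_Mz; apply/pQZ_eq0.
rewrite {}/m in m2 *; case: n n1 m2 nk => [|n] _ m2 /dvdzP[q ->]; first by rewrite mulr0 mulr0z.
apply/intrP; exists q; rewrite -mulrzr intrM mulrCA -pmulrn mulVf ?mulr1 //.
by rewrite pnatr_eq0.
Qed.

(** Characters separate points from subgroups. *)
Lemma character_separates (G : zmodType) (H : set G) (g : G) : subgroupS H -> ~ H g ->
  exists chi : G -> QZ, [/\ {morph chi : x y / x - y}, forall x, H x -> chi x = 0 & chi g != 0].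
Proof.
move=> sH Hg; have [n nP] := order_mod sH g.
have n1 : n != 1%N.
  by apply/eqP => n1; apply: Hg; rewrite -[g]mulr1z; apply/nP; rewrite n1.
have [d d0 dP] := QZ_order n1.
have [||chi [chiB chiP]] := @divisible_ext G QZ
    [set p | exists h k, H h /\ p = (h + g *~ k, d *~ k)] QZ_divisible.
- split; first by exists 0, 0; rewrite !mulr0z addr0; split=> //; exact: sH.1.
  move=> _ _ [h [k [Hh ->]]] [h' [k' [Hh' ->]]].
  exists (h - h'), (k - k'); split; first exact: sH.2.
  rewrite !mulrzBr [LHS](_ : _ = (h + g *~ k - (h' + g *~ k'), d *~ k - d *~ k')) //.
  by rewrite opprD addrACA.
- move=> _ [h [k [Hh [/esym/eqP hk ->]]]]; apply/dP/nP.
  move: hk; rewrite addrC addr_eq0 => /eqP ->; exact: subgroupS_N.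
exists chi; split=> [//|x Hx|].
  by apply: chiP; exists x, 0; rewrite !mulr0z addr0.
by rewrite (chiP g d) //; exists 0, 1; rewrite !mulr1z add0r; split=> //; exact: sH.1.
Qed.

Section CharacterGroup.
Variable N : zmodType.

Definition char_pred : {pred N -> QZ} := [pred f | `[< {morph f : x y / x - y} >]].

Lemma char_pred_closed : zmod_closed char_pred.
Proof.
split=> [|f g /asboolW fB /asboolW gB]; apply: asboolT => x y; first by rewrite subr0.
by rewrite !fctD !fctN fB gB opprD addrACA -opprD.
Qed.

HB.instance Definition _ := GRing.isZmodClosed.Build (N -> QZ) char_pred char_pred_closed.

Definition chars : Type := {f : N -> QZ | f \in char_pred}.

HB.instance Definition _ := SubChoice.on chars.
HB.instance Definition _ := [SubChoice_isSubZmodule of chars by <:].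

Lemma charsB (chi : chars) : {morph val chi : x y / x - y}.
Proof. by have /asboolW := valP chi. Qed.

Lemma chars0 (chi : chars) : val chi 0 = 0.
Proof. by have := charsB chi 0 0; rewrite !subrr. Qed.

Lemma charsD (chi : chars) : {morph val chi : x y / x + y}.
Proof. by move=> x y; rewrite -[y in LHS]opprK -[- y]sub0r !charsB chars0 sub0r opprK. Qed.

Definition mkchar f (fB : {morph f : x y / x - y}) : chars :=
  Sub (f : N -> QZ) (asboolT fB : f \in char_pred).

End CharacterGroup.

(** The module structure on characters induced by an action on the group. *)
Section CharacterModule.
Variables (R : pzRingType) (N : zmodType) (act : R -> N -> N).
Hypothesis actB : forall r, {morph act r : x y / x - y}.
Hypothesis actA : forall r s x, act r (act s x) = act (s * r) x.
Hypothesis act1 : forall x, act 1 x = x.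
Hypothesis actDl : forall r s x, act (r + s) x = act r x + act s x.

Lemma char_scale_additive (r : R) (chi : chars N) :
  {morph (fun x => val chi (act r x)) : x y / x - y}.
Proof. by move=> x y; rewrite actB charsB. Qed.

Definition char_scale (r : R) (chi : chars N) : chars N :=
  mkchar (char_scale_additive r chi).

Lemma char_scaleA a b chi : char_scale a (char_scale b chi) = char_scale (a * b) chi.
Proof. by apply: val_inj; apply/funext => x; rewrite /= actA. Qed.

Lemma char_scale1 : left_id 1 char_scale.
Proof. by move=> chi; apply: val_inj; apply/funext => x; rewrite /= act1. Qed.

Lemma char_scaleDr : right_distributive char_scale +%R.
Proof. by move=> r chi psi; apply: val_inj; apply/funext => x. Qed.

Lemma char_scaleDl chi : {morph char_scale^~ chi : a b / a + b}.
Proof. by move=> a b; apply: val_inj; apply/funext => x; rewrite /= actDl charsD. Qed.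

End CharacterModule.

(** The ring [(R^c)^c] has the operations of [R] but is a different structure, so
    the duals of right modules and of left modules are separate constructions. *)
Section LeftDual.
Variables (R : pzRingType) (N : lmodType R^c).

Definition ldual : Type := chars N.
HB.instance Definition _ := GRing.Zmodule.on ldual.

Let act (r : R) (x : N) : N := (r : R^c) *: x.
Let actB r : {morph act r : x y / x - y}. Proof. by move=> x y; apply: scalerBr. Qed.
Let actA r s x : act r (act s x) = act (s * r) x. Proof. exact: scalerA. Qed.
Let act1 x : act 1 x = x. Proof. exact: scale1r. Qed.
Let actDl r s x : act (r + s) x = act r x + act s x. Proof. exact: scalerDl. Qed.

HB.instance Definition _ := GRing.Zmodule_isLmodule.Build R ldual
  (char_scaleA actB actA) (char_scale1 actB act1) (char_scaleDr actB) (char_scaleDl actB actDl).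

End LeftDual.

Section RightDual.
Variables (R : pzRingType) (M : lmodType R).

Definition rdual : Type := chars M.
HB.instance Definition _ := GRing.Zmodule.on rdual.

Let act (r : R^c) (x : M) : M := (r : R) *: x.
Let actB r : {morph act r : x y / x - y}. Proof. by move=> x y; apply: scalerBr. Qed.
Let actA r s x : act r (act s x) = act (s * r) x. Proof. exact: scalerA. Qed.
Let act1 x : act 1 x = x. Proof. exact: scale1r. Qed.
Let actDl r s x : act (r + s) x = act r x + act s x. Proof. exact: scalerDl. Qed.

HB.instance Definition _ := GRing.Zmodule_isLmodule.Build R^c rdual
  (char_scaleA actB actA) (char_scale1 actB act1) (char_scaleDr actB) (char_scaleDl actB actDl).

End RightDual.

(** Finitely many relations in a pure extension are realized below, with
    prescribed values on finitely many elements of the submodule. *)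
Lemma pure_embedding_local (R : pzRingType) (A B : lmodType R) (f : {linear A -> B})
    (L : seq (seq (R * B))) (s : seq A) : pure_embedding f -> solves L id ->
  exists sigma : B -> A, solves L sigma /\ forall a, a \in s -> sigma (f a) = a.
Proof.
move=> [fi [_ fp]] Lid; have [phi phiP] := system_formula L (map f s).
have r0 : range f 0 by exists 0; rewrite ?linear0.
pose v := id \o tnth (in_tuple (map f s)).
have : pp_sat [pred y : B | y \in range f] phi v.
  apply: fp => [i|].
    by have := mem_tnth i (in_tuple (map f s)) => /mapP[a _ e]; rewrite !inE /v /= e; exists a.
  by apply/pp_satE/phiP => //; exists id.
move=> /pp_satE; rewrite (_ : [set` _] = range f); last first.
  by apply/seteqP; split=> x /=; rewrite inE.
move=> /(phiP _ _ _ r0)[tau [tauf tauL tauv]].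
have /choice[sigma sigmaP] : forall b, exists a, f a = tau b.
  by move=> b; have [a _ fa] := tauf b; exists a.
exists sigma; split=> [t tL|a aS].
  apply: fi; rewrite linear0 linear_sum -[RHS](tauL t tL).
  by apply: eq_bigr => x _; rewrite linearZ sigmaP.
apply: fi; rewrite sigmaP; have /seq_tnthP[i fai] : f a \in map f s by apply: map_f.
by have := congr1 (fun g => g i) tauv; rewrite /v /= -[tnth _ i]fai.
Qed.

(** A homomorphism into the dual of [N] is a character of a tensor product with
    [N]; purity makes its extension well defined. *)
Lemma ldual_pure_injective (R : pzRingType) (N : lmodType R^c) : pure_injective (ldual N).
Proof.
move=> A B f g fpure.
pose F := flift (fun na : N * A => << (na.1, f na.2) >> : {freeg (N * B)%type / int}).
pose gam := flift (fun na : N * A => val (g na.2) na.1).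
pose r : set ({freeg (N * B)%type / int} * QZ) :=
  [set p | exists x z, tensor_null z /\ p = (F x + z, gam x)].
have [||chi [chiB chiP]] := @divisible_ext _ QZ r QZ_divisible.
- split; first by exists 0, 0; split; [exact: tensor_null0|rewrite /F /gam !flift0 addr0].
  move=> _ _ [x [z [nz ->]]] [x' [z' [nz' ->]]].
  exists (x - x'), (z - z'); split; first exact: tensor_nullB.
  rewrite /F /gam !fliftB -/F -/gam.
  rewrite [LHS](_ : _ = (F x + z - (F x' + z'), gam x - gam x')) //.
  by rewrite opprD addrACA.
- move=> _ [x [z [nz [/esym/eqP Fx ->]]]].
  have : tensor_null (F x) by move: Fx; rewrite addr_eq0 => /eqP ->; apply: tensor_nullN.
  move=> /tensor_null_local[L [Lid Lkill]].
  have [sigma [sL sf]] := pure_embedding_local (map snd (dom x)) fpure Lid.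
  pose beta (n : N) (a : A) : QZ := val (g a) n.
  have bb : balanced beta.
    split=> [n n' a|n a a'|s n a]; rewrite /beta; first exact: charsD.
      by rewrite linearD.
    by rewrite linearZ.
  rewrite -[RHS](Lkill _ _ _ _ bb sL) /F.
  rewrite (@flift_comp _ _ _ _ (flift _)); last exact: fliftB.
  apply: eq_flift => -[n a] nax; rewrite /= fliftU /beta /= sf //.
  by apply/mapP; exists (n, a).
pose h0 (b : B) (n : N) : QZ := chi << (n, b) >>.
have chi0 z : tensor_null z -> chi z = 0.
  by move=> nz; apply: chiP; exists 0, z; rewrite /F /gam !flift0 add0r.
have h0B b : {morph h0 b : n n' / n - n'}.
  move=> n n'; apply/esym/eqP; rewrite /h0 -chiB -subr_eq0 -chiB; apply/eqP/chi0.
  have := tensor_null_addl (n - n') n' b.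
  by rewrite subrK addrAC.
pose h (b : B) : ldual N := mkchar (h0B b).
have hl r' b b' : h (r' *: b + b') = r' *: h b + h b'.
  apply: val_inj; apply/funext => n; rewrite [RHS](_ : _ = h0 b (((r' : R) : R^c) *: n) + h0 b' n) //.
  rewrite -[LHS]/(h0 (r' *: b + b') n).
  have e1 : h0 (r' *: b + b') n - h0 (r' *: b) n - h0 b' n = 0.
    by rewrite /h0 -!chiB; apply/chi0/tensor_null_addr.
  have e2 : h0 b ((r' : R^c) *: n) - h0 (r' *: b) n = 0.
    by rewrite /h0 -!chiB; apply/chi0/tensor_null_bal.
  move/eqP: e1; rewrite -addrA -opprD subr_eq0 => /eqP ->.
  by move/eqP: e2; rewrite subr_eq0 => /eqP ->.
have [k kE] := linear_ext hl.
exists k => a; rewrite kE; apply: val_inj; apply/funext => n.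
rewrite -[LHS]/(chi _); apply: chiP.
exists << (n, a) >>, 0; split; first exact: tensor_null0.
by rewrite /F /gam !fliftU addr0.
Qed.

Section BidualEmbedding.
Variables (R : pzRingType) (M : lmodType R).

Definition bidual : lmodType R := ldual (rdual M).

Lemma evaluation_additive (x : M) : {morph (fun chi : rdual M => val chi x) : f g / f - g}.
Proof. by []. Qed.

Definition evaluation (x : M) : bidual := mkchar (evaluation_additive x).

Lemma evaluation_linear r x y : evaluation (r *: x + y) = r *: evaluation x + evaluation y.
Proof. by apply: val_inj; apply/funext => chi; rewrite /= charsD. Qed.

(** If [X w = v] has no solution in [M], a character of [M ^ m] separates [v] from
    the image of [X].  Its components are [m] elements of the dual with
    combination zero along each column of [X], which excludes a solution in the
    bidual. *)
Lemma evaluation_pure (f : {linear M -> bidual}) : f = evaluation :> (M -> bidual) ->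
  pure_embedding f.
Proof.
move=> fE; apply/pure_embeddingP => m n X v W XW.
apply: contrapT => no.
have [||chi [chiB chiH /eqP[]]] := @character_separates ('I_m -> M) (range (mact X)) v.
- split; first by exists 0; rewrite ?mact0.
  by move=> _ _ [a _ <-] [b _ <-]; exists (a - b); rewrite // mactB.
- by move=> [w _ Xw]; apply: no; exists w.
pose emb i (x : M) : 'I_m -> M := fun i' => if i' == i then x else 0.
have chiiB i : {morph (fun x => chi (emb i x)) : x y / x - y}.
  move=> x y; rewrite -chiB; congr chi; apply/funext => i'.
  by rewrite fctD fctN /emb; case: eqP; rewrite ?subr0.
pose chii i : rdual M := mkchar (chiiB i).
have embE (t : 'I_m -> M) : t = \sum_i emb i (t i).
  apply/funext => i; rewrite fct_sumE (bigD1 i) //= /emb eqxx big1 ?addr0 // => j ji.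
  by rewrite eq_sym (negPf ji).
have chiE t : chi t = \sum_i val (chii i) (t i).
  by rewrite [in LHS](embE t) (morphB_sum _ _ chiB).
have killX j : \sum_i (X i j : R^c) *: chii i = 0 :> rdual M.
  apply: val_inj; apply/funext => x.
  rewrite [LHS](_ : _ = \sum_i val (chii i) (X i j *: x)); last first.
    by rewrite raddf_sum fct_sumE; apply: eq_bigr.
  rewrite -(chiE (fun i => X i j *: x)); apply: chiH.
  exists (fun j' => if j' == j then x else 0) => //.
  apply/funext => i; rewrite /mact (bigD1 j) //= eqxx big1 ?addr0 // => j' j'j.
  by rewrite (negPf j'j) scaler0.
rewrite chiE; transitivity (\sum_i val ((f \o v) i) (chii i)).
  by apply: eq_bigr => i _; rewrite /= fE.
rewrite -XW; transitivity (\sum_i \sum_j val (W j) ((X i j : R^c) *: chii i)).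
  by apply: eq_bigr => i _; rewrite /mact raddf_sum fct_sumE; apply: eq_bigr.
rewrite exchange_big big1 // => j _.
rewrite -(morphB_sum _ _ (charsB (W j))) killX; exact: chars0.
Qed.

Lemma pure_injective_extension :
  exists (Q : lmodType R) (j : {linear M -> Q}), pure_embedding j /\ pure_injective Q.
Proof.
have [f fE] := linear_ext evaluation_linear.
by exists bidual, f; split; [apply: evaluation_pure|apply: ldual_pure_injective].
Qed.

End BidualEmbedding.

(** * Limits in pure-injective modules *)

Section Limits.
Variables (R : pzRingType) (Q : lmodType R).
Hypothesis PIQ : pure_injective Q.

(** A pure-injective module is a retract of its reduced powers: nets have
    generalized limits that satisfy every linear equation satisfied eventually. *)
Lemma pure_injective_limit (D : Type) (le : D -> D -> Prop) (d0 : D) :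
  (forall d, le d d) -> (forall d d' d'', le d d' -> le d' d'' -> le d d'') ->
  (forall d d', exists d'', le d d'' /\ le d' d'') ->
  exists rho : {linear (D -> Q) -> Q}, (forall q, rho (fun=> q) = q) /\
    forall u, (exists d, forall d', le d d' -> u d' = 0) -> rho u = 0.
Proof.
move=> le_refl le_trans dir.
pose S : set (D -> Q) := [set u | exists d, forall d', le d d' -> u d' = 0].
have sS : submodS S.
  split=> [|r u v [d du] [e ev]]; first by exists d0.
  have [c [dc ec]] := dir d e; exists c => c' cc'.
  rewrite fctD scalrfctE du ?ev ?scaler0 ?addr0 //; exact: le_trans cc'.
pose T := lquot (submod sS); pose p : {linear (D -> Q) -> T} := @lquot_pi _ _ (submod sS).
have p0 u : p u = 0 <-> S u.
  rewrite -[0](linear0 p); split=> [/lquot_pi_eq/in_submodP|Su]; rewrite ?subr0 //.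
  by apply/lquot_pi_eq/in_submodP; rewrite subr0.
have [diag diagE] : exists f : {linear Q -> T}, f = (fun q => p (fun=> q)) :> (Q -> T).
  by apply: linear_ext => r x y; rewrite -linearP.
have pure_diag : pure_embedding diag.
  apply/pure_embeddingP => m n X v W XW.
  have /choice[w wW] : forall j, exists x, p x = W j by move=> j; apply: lquot_pi_surj.
  have ev i : S (mact X w i - (fun=> v i)).
    apply/p0; rewrite linearB; apply/eqP; rewrite subr_eq0; apply/eqP.
    rewrite -[LHS]/((p \o mact X w) i) -mact_linear (_ : p \o w = W); last exact/funext.
    by rewrite XW /= diagE.
  have [c cP] : exists c, forall i d, le c d -> (mact X w i - (fun=> v i)) d = 0.
    have /choice[e eP] := ev.
    suff [c cP] : exists c, forall i, i \in enum 'I_m -> le (e i) c.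
      by exists c => i d cd; apply: eP; apply: le_trans cd; apply: cP; rewrite mem_enum.
    elim: (enum 'I_m) => [|i s [c cP]]; first by exists d0.
    have [c' [ic' cc']] := dir (e i) c; exists c' => k; rewrite inE => /orP[/eqP ->//|/cP h].
    exact: le_trans cc'.
  exists (fun j => w j c); apply/funext => i; have := cP i c (le_refl c).
  by rewrite fctD fctN => /subr0_eq <-; rewrite /mact fct_sumE.
have [idl idlE] : exists f : {linear Q -> Q}, f = id :> (Q -> Q) by apply: linear_ext.
have [h hP] := PIQ idl pure_diag.
have [rho rhoE] : exists f : {linear (D -> Q) -> Q}, f = h \o p :> ((D -> Q) -> Q).
  by apply: linear_ext => r x y; rewrite /= !linearP.
exists rho; rewrite rhoE; split=> [q|u Su]; last by rewrite /= (p0 u).2 // linear0.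
by have := hP q; rewrite diagE idlE.
Qed.

(** Partial homomorphisms preserving pp-formulas extend: they have approximations
    compatible with any finite set of relations of [B], and a generalized limit of
    these is compatible with all. *)
Lemma pure_injective_extend (B : lmodType R) (I : eqType) (Y : set I) (a : I -> B) (b : I -> Q) :
  (forall k (phi : pp_formula R k) (v : 'I_k -> I), (forall i, Y (v i)) ->
    satS setT phi (a \o v) -> satS setT phi (b \o v)) ->
  exists g : {linear B -> Q}, forall i, Y i -> g (a i) = b i.
Proof.
move=> ab; pose D := {LF : seq (seq (R * B)) * seq I |
  solves LF.1 id /\ forall i, i \in LF.2 -> Y i}.
pose le (d e : D) := {subset (sval d).1 <= (sval e).1} /\ {subset (sval d).2 <= (sval e).2}.
have d0 : D by exists ([::], [::]).
have /choice[sig sigP] : forall d : D, exists sigma : B -> Q,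
    solves (sval d).1 sigma /\ forall i, i \in (sval d).2 -> sigma (a i) = b i.
  move=> [[L F] [/= Lid FY]].
  have [phi phiP] := system_formula L (map a F).
  pose v (j : 'I_(size (map a F))) := tnth (in_tuple F) (cast_ord (size_map a F) j).
  have av : a \o v = id \o tnth (in_tuple (map a F)).
    apply/funext => j; rewrite /= /v (tnth_nth (v j)) /=.
    by rewrite (tnth_nth (a (v j))) /= (nth_map (v j)) // -(size_map a).
  have [|sigma [_ sL sv]] := (phiP _ setT (b \o v) Logic.I).1.
    apply: ab => [i|]; first by apply: FY; apply: mem_tnth.
    by apply/phiP => //; exists id; split=> //; rewrite av.
  exists sigma; split=> // i iF; have /seq_tnthP[j ij] := iF.
  pose j' := cast_ord (esym (size_map a F)) j.
  have := congr1 (fun g => g j') sv; rewrite -[LHS]/(sigma ((id \o tnth (in_tuple (map a F))) j')).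
  rewrite -av /= /v; have -> : cast_ord (size_map a F) j' = j by apply: val_inj.
  by rewrite -ij.
have [|||rho [rhoC rho0]] := @pure_injective_limit D le d0.
- by move=> d; split.
- by move=> d e f [h1 h2] [h3 h4]; split=> x ?; [apply/h3/h1|apply/h4/h2].
- move=> [[L F] [Lid FY]] [[L' F'] [Lid' FY']].
  have h : solves (L ++ L') (@id B) /\ forall i, i \in F ++ F' -> Y i.
    split; first by apply/solves_cat.
    by move=> i; rewrite mem_cat => /orP[/FY|/FY'].
  exists (exist _ (L ++ L', F ++ F') h).
  by split; split=> x xL /=; rewrite mem_cat xL ?orbT.
have [g gE] : exists g : {linear B -> Q}, g = (fun x => rho (fun d => sig d x)) :> (B -> Q).
  apply: linear_ext => r x y; rewrite -linearP; apply/eqP; rewrite -subr_eq0 -linearB.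
  apply/eqP/rho0.
  have h : solves [:: [:: (1, r *: x + y); (- r, x); (- 1, y)]] (@id B) /\
      forall i : I, i \in [::] -> Y i.
    split=> // t; rewrite inE => /eqP ->; rewrite !big_cons big_nil /= scale1r addr0.
    by rewrite scaleN1r scaleNr -opprD subrr.
  exists (exist _ ([:: [:: (1, r *: x + y); (- r, x); (- 1, y)]], [::]) h) => d [/= h1 _].
  have := (sigP d).1 _ (h1 _ (mem_head _ _)).
  rewrite !big_cons big_nil /= scale1r addr0 scaleN1r scaleNr -opprD.
  by rewrite fctD fctN fctD scalrfctE.
exists g => i Yi; rewrite gE -[RHS]rhoC; apply/eqP; rewrite -subr_eq0 -linearB.
apply/eqP/rho0.
have h : solves [::] (@id B) /\ forall k : I, k \in [:: i] -> Y k.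
  by split=> // k; rewrite inE => /eqP ->.
exists (exist _ ([::], [:: i]) h) => d [_ /= h2].
by rewrite fctD fctN (sigP d).2 ?subrr // h2 ?mem_head.
Qed.

(** The endomorphisms fixing [Y] are preordered by the pp-formulas that hold of
    their values; generalized limits bound chains, so there is a maximal one. *)
Lemma maximal_endomorphism (Y : set Q) :
  exists f : {linear Q -> Q}, (forall y, Y y -> f y = y) /\
    forall h : {linear Q -> Q}, (forall y, Y y -> h y = y) ->
    forall k (phi : pp_formula R k) v,
      satS setT phi (h \o (f \o v)) -> satS setT phi (f \o v).
Proof.
pose T := {f : {linear Q -> Q} | forall y, Y y -> f y = y}.
have [idl idlE] : exists f : {linear Q -> Q}, f = id :> (Q -> Q) by apply: linear_ext.
have t0 : T by exists idl => y _; rewrite idlE.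
pose lep (f g : T) := forall k (phi : pp_formula R k) v,
  satS setT phi (sval f \o v) -> satS setT phi (sval g \o v).
have [||A Atot|f fmax] := @ZL_preorder T t0 (fun f g => `[< lep f g >]).
- by move=> t; apply: asboolT.
- by move=> r s t /asboolW rs /asboolW st; apply: asboolT => k phi v /rs/st.
- have [[a0 Aa0]|noA] := pselect (exists a, A a); last first.
    by exists t0 => s As; case: noA; exists s.
  pose D := {a : T | A a}; pose le (d e : D) := lep (sval d) (sval e).
  have [|||rho [rhoC rho0]] := @pure_injective_limit D le (exist _ a0 Aa0).
  + by move=> d k phi v.
  + by move=> d e f de ef k phi v /de/ef.
  + move=> d e; have [/asboolW de|/asboolW ed] := Atot _ _ (svalP d) (svalP e).
      by exists e; split=> // k phi v.
    by exists d; split=> // k phi v.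
  have [g gE] : exists g : {linear Q -> Q},
      g = (fun q => rho (fun d : D => sval (sval d) q)) :> (Q -> Q).
    apply: linear_ext => r x y; rewrite -linearP; congr (rho _); apply/funext => d.
    by rewrite linearP.
  have gY y : Y y -> g y = y.
    move=> Yy; rewrite gE -[RHS]rhoC; congr (rho _); apply/funext => d.
    exact: svalP (sval d) y Yy.
  exists (exist _ g gY) => a Aa; apply: asboolT => k phi v sat_a.
  have /choice[w wP] : forall d : D, exists w, le (exist _ a Aa) d ->
      mact (pp_ex_part phi) w + mact (pp_free_part phi) (sval (sval d) \o v) = 0.
    move=> d; have [ad|nad] := pselect (le (exist _ a Aa) d); last by exists (fun=> 0).
    by have [w _ wd] := ad _ phi v sat_a; exists w.
  exists (fun j => rho (fun d => w d j)) => //.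
  have gv : (g : Q -> Q) \o v = rho \o (fun j (d : D) => sval (sval d) (v j)).
    by apply/funext => j /=; rewrite gE.
  have -> : (fun j => rho (fun d => w d j)) = rho \o (fun j d => w d j) by [].
  rewrite /= gv !mact_linear; apply/funext => i; rewrite fctD /= -linearD; apply: rho0.
  exists (exist _ a Aa) => d /wP/(congr1 (fun u => u i)); rewrite !fctD => h.
  by rewrite /mact !fct_sumE.
exists (sval f); split=> [y Yy|h hY k phi v]; first exact: (svalP f y Yy).
have [hf hfE] : exists g : {linear Q -> Q}, g = h \o sval f :> (Q -> Q).
  by apply: linear_ext => r x y; rewrite /= !linearP.
have hfY y : Y y -> hf y = y by move=> Yy; rewrite hfE /= (svalP f y Yy) hY.
have le_f : lep f (exist _ hf hfY).
  by move=> j psi u su; rewrite /= hfE; apply: satS_linear su.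
have /asboolW := fmax (exist _ hf hfY) (asboolT le_f).
by move=> /(_ k phi v) /=; rewrite hfE; apply.
Qed.

End Limits.

(** * Pure-injective envelopes *)

Section Envelope.
Variables (R : pzRingType) (Q : lmodType R).
Hypothesis PIQ : pure_injective Q.

(** The analogue, inside a pure-injective module, of a pure-essential extension:
    [X] adds to [Y] nothing that could be moved to a more special position. *)
Definition tight (Y X : set Q) : Prop :=
  forall h : {linear Q -> Q}, (forall y, Y y -> h y = y) ->
  forall k (phi : pp_formula R k) (v : 'I_k -> Q), allin X v ->
    satS setT phi (h \o v) -> satS setT phi v.

(** The image of a maximal endomorphism fixing [X] is tight over [Y] if [X] is:
    an endomorphism fixing [Y] can be undone on [X], then on that image. *)
Lemma tight_image Y X (f : {linear Q -> Q}) : Y `<=` X -> tight Y X ->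
  (forall h : {linear Q -> Q}, (forall x, X x -> h x = x) ->
    forall k (phi : pp_formula R k) v,
      satS setT phi (h \o (f \o v)) -> satS setT phi (f \o v)) ->
  tight Y (range f).
Proof.
move=> YX tX fmax h hY k phi v fv.
have /choice[u uv] : forall i, exists q, f q = v i by move=> i; have [q _ fq] := fv i; exists q.
have -> : v = f \o u by apply/funext => i; rewrite /= uv.
have [|g gP] := @pure_injective_extend R Q PIQ Q Q X h id.
  by move=> j psi w Xw; apply: tX.
have [gh ghE] : exists e : {linear Q -> Q}, e = g \o h :> (Q -> Q).
  by apply: linear_ext => r x y; rewrite /= !linearP.
move=> sat_h; apply: (fmax gh) => [x Xx|]; first by rewrite ghE /= gP.
by rewrite ghE; apply: (satS_linear (f := g) _ sat_h).
Qed.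

(** A maximal tight set contains the image of a maximal endomorphism fixing it, by
    the preceding lemma, hence is equal to this image. *)
Lemma tight_retract Y : exists f : {linear Q -> Q},
  [/\ forall q, f (f q) = f q, forall y, Y y -> f y = y & tight Y (range f)].
Proof.
have [||X [YX tX Xmax]] := @Zorn_above _ (tight Y) Y.
- move=> h hY k phi v Yv; rewrite (_ : h \o v = v) //.
  by apply/funext => i; apply: hY.
- move=> F [X0 FX0] FP Fch h hY k phi v Fv.
  have [||X FX Xv] := @finite_in_chain _ F k v _ Fch; [by exists X0|by move=> i; apply: Fv|].
  exact: (FP X FX).1 hY _ _ _ Xv.
have [f [fX fmax]] := maximal_endomorphism PIQ X.
have tf := tight_image YX tX fmax.
have XE : range f = X by apply: Xmax => // x Xx; exists x; rewrite // fX.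
exists f; split=> // [q|y Yy]; last by apply: fX; apply: YX.
by apply: fX; rewrite -XE; exists q.
Qed.

End Envelope.

(** The range of a tight retraction of a pure-injective pure extension.  It is
    pure-injective as a direct summand; a homomorphism [h] from it over [M] is pure
    because tightness applies to [h] followed by a homomorphism back to [Q]. *)
Lemma pure_injective_envelope_exists (R : pzRingType) (M : lmodType R) :
  exists (P : lmodType R) (i : {linear M -> P}), pure_injective_envelope i.
Proof.
have [Q [j [jpure PIQ]]] := pure_injective_extension M.
have [f [ff fj tf]] := tight_retract PIQ (range j).
pose P : lmodType R := subm (submod (range_submodS f)).
have fP q : f q \in submod (range_submodS f) by apply/in_submodP; exists q.
have [p pE] : exists p : {linear Q -> P}, p = (fun q => Sub (f q) (fP q)) :> (Q -> P).
  apply: linear_ext => r x y; apply: val_inj.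
  by rewrite /= linearP.
pose inc : {linear P -> Q} := \val.
have incp q : inc (p q) = f q by rewrite pE.
have finc x : f (inc x) = inc x by have /in_submodP[q _ e] := valP x; rewrite -[inc x]e ff.
have pinc x : p (inc x) = x by apply: val_inj; rewrite -[LHS]/(inc (p (inc x))) incp finc.
have [i iE] : exists i : {linear M -> P}, i = p \o j :> (M -> P).
  by apply: linear_ext => r x y; rewrite /= !linearP.
have inci x : inc (i x) = j x.
  by rewrite iE -[LHS]/(inc (p (j x))) incp; apply: fj; exists x.
have ipure : pure_embedding i.
  apply/pure_embeddingP => m n X v w Xw.
  apply: ((pure_embeddingP j).1 jpure _ _ _ _ (inc \o w)).
  by rewrite mact_linear Xw; apply/funext => k; exact: inci.
exists P, i; split=> //.
  move=> A B a g apure.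
  have [incg incgE] : exists e : {linear A -> Q}, e = inc \o g :> (A -> Q).
    by apply: linear_ext => r x y; rewrite /= !linearP.
  have [h hP] := PIQ _ _ a incg apure.
  have [ph phE] : exists e : {linear B -> P}, e = p \o h :> (B -> P).
    by apply: linear_ext => r x y; rewrite /= !linearP.
  by exists ph => x; rewrite phE -[LHS]/(p (h (a x))) hP incgE; exact: pinc.
move=> Q' j' j'pure PIQ'.
have [h hP] := PIQ' _ _ i j' ipure.
exists h => //; have [k kP] := PIQ _ _ j' j j'pure.
have [e eE] : exists e : {linear Q -> Q}, e = k \o h \o p :> (Q -> Q).
  by apply: linear_ext => r x y; rewrite /= !linearP.
apply/pure_embeddingP => m n X v w Xw.
have : satS setT (PPFormula X (- 1%:M)) (inc \o v).
  apply: (tf e) => [_ [x _ <-]|l|].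
  - by rewrite eE -[LHS]/(k (h (p (j x)))) -{1}inci pinc hP kP.
  - by exists (inc (v l)) => //; exact: finc.
  exists (k \o w) => //=.
  rewrite mactNl mact1 mact_linear Xw; apply/funext => l.
  by rewrite fctD fctN eE -[X in _ - X]/(k (h (p (inc (v l))))) pinc subrr.
move=> [w' _ /=]; rewrite mactNl mact1 => /subr0_eq Xw'.
exists (p \o w'); rewrite mact_linear Xw'; apply/funext => l.
exact: pinc.
Qed.

(** * A criterion of pure-injectivity *)

Definition vcons (T : Type) k (x : T) (v : 'I_k -> T) : 'I_k.+1 -> T :=
  fun i => if unlift ord0 i is Some j then v j else x.

(** An instance of a pp-formula in one unknown with parameters in [P]. *)
Record pp_instance (R : pzRingType) (P : lmodType R) := PPInstance {
  pp_arity : nat;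
  pp_shape : pp_formula R pp_arity.+1;
  pp_params : 'I_pp_arity -> P
}.

Arguments pp_params {R P} p i.

Definition pp_holds (R : pzRingType) (P : lmodType R) (psi : pp_instance P) (x : P) : Prop :=
  satS setT (pp_shape psi) (vcons x (pp_params psi)).

Definition finitely_realized (R : pzRingType) (P : lmodType R) (Psi : set (pp_instance P)) : Prop :=
  forall n (t : 'I_n -> pp_instance P), (forall i, Psi (t i)) ->
    exists x, forall i, pp_holds (t i) x.

Section Criterion.
Variables (R : pzRingType) (P : lmodType R).

(** The pp-instance saying that a system in unknowns from [B] is solvable with
    prescribed values at [b] and at the elements listed in [G]. *)
Lemma system_instance (B : lmodType R) (b : B) (L : seq (seq (R * B))) (G : seq (B * P)) :
  exists psi : pp_instance P, forall x, pp_holds psi x <->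
    exists sigma : B -> P,
      [/\ solves L sigma, sigma b = x & forall p, p \in G -> sigma p.1 = p.2].
Proof.
have [phi phiP] := system_formula L (b :: map fst G).
pose v (i : 'I_(size (map fst G))) : P := (nth (0, 0) G i).2.
exists (@PPInstance R P (size (map fst G)) phi v) => x; rewrite /pp_holds /=.
have vcons_tnth (sigma : B -> P) :
    sigma \o tnth (in_tuple (b :: map fst G)) = vcons x v <->
    sigma b = x /\ forall p, p \in G -> sigma p.1 = p.2.
  split=> [e|[sb sG]].
    have ei i : sigma (tnth (in_tuple (b :: map fst G)) i) = vcons x v i by rewrite -e.
    split=> [|p pG]; first by have := ei ord0; rewrite /vcons unlift_none.
    have iG : (index p G < size (map fst G))%N by rewrite size_map index_mem.
    have := ei (fintype.lift ord0 (Ordinal iG)).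
    rewrite /vcons liftK /v /= nth_index // => <-; congr sigma.
    by rewrite (tnth_nth 0) /= (nth_map (0, 0)) ?nth_index // index_mem.
  apply/funext => i; rewrite /vcons; case: unliftP => [j ->|->] /=; last exact: sb.
  have jG : (j < size G)%N by rewrite -(size_map fst G).
  by rewrite (tnth_nth 0) /= (nth_map (0, 0)) // sG // mem_nth.
split=> [/(phiP _ setT _ Logic.I)[sigma [_ sL /vcons_tnth[sb sG]]]|[sigma [sL sb sG]]].
  by exists sigma.
by apply/(phiP _ setT _ Logic.I); exists sigma; split=> //; apply/vcons_tnth.
Qed.

(** Homomorphisms into [P] are extended along a pure embedding one element at a
    time, keeping them compatible with every finite system solvable in [B]. *)
Lemma pure_injective_criterion :
  (forall Psi : set (pp_instance P), finitely_realized Psi ->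
    exists x, forall psi, Psi psi -> pp_holds psi x) -> pure_injective P.
Proof.
move=> compact A B f g fpure.
pose good (Gam : set (B * P)) := forall (G : seq (B * P)) (L : seq (seq (R * B))),
  (forall p, p \in G -> Gam p) -> solves L id ->
  exists sigma : B -> P, solves L sigma /\ forall p, p \in G -> sigma p.1 = p.2.
have [||Gam [G0 Gg Gmax]] := @Zorn_above _ good [set (f a, g a) | a in [set: A]].
- move=> G L GA Lid.
  have [s sG] : exists s : seq A, forall p, p \in G -> exists2 a, a \in s & p = (f a, g a).
    elim: G GA => [|p G IHG] GA; first by exists [::].
    have [q qG|s sP] := IHG; first by apply: GA; rewrite inE qG orbT.
    have [a _ fa] := GA p (mem_head _ _); exists (a :: s) => q.
    rewrite inE => /orP[/eqP ->|/sP[a' a's ->]]; first by exists a; rewrite ?mem_head.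
    by exists a'; rewrite // inE a's orbT.
  have [sigma [sL sf]] := pure_embedding_local s fpure Lid.
  exists (g \o sigma); split; first exact: solves_linear.
  by move=> p /sG[a aS ->]; rewrite /= sf.
- move=> F [X0 FX0] FP Fch G L GF Lid.
  suff [X FX GX] : exists2 X, F X & forall p, p \in G -> X p by apply: (FP X FX).1.
  elim: G GF => [|p G IHG] GF; first by exists X0.
  have [q qG|X FX GX] := IHG; first by apply: GF; rewrite inE qG orbT.
  have [Z FZ Zp] := GF p (mem_head _ _).
  have [XZ|ZX] := Fch _ _ FX FZ; [exists Z|exists X] => // q; rewrite inE => /orP[/eqP ->|/GX] //.
    exact: XZ.
  exact: ZX.
have /choice[h hP] : forall b, exists m, Gam (b, m).
  move=> b; pose Psi : set (pp_instance P) := [set psi | exists (G : seq (B * P)) (L : seq (seq (R * B))),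
    [/\ forall p, p \in G -> Gam p, solves L (@id B) & forall x, pp_holds psi x <->
      exists sigma : B -> P,
        [/\ solves L sigma, sigma b = x & forall p, p \in G -> sigma p.1 = p.2]]].
  have [|m mP] := compact Psi.
    move=> n t /choice[G /choice[L GL]].
    have [||sigma [sL sG]] := Gg (flatten (map G (enum 'I_n))) (flatten (map L (enum 'I_n))).
    - by move=> p /flatten_mapP[i _ pG]; have [/(_ p pG)] := GL i.
    - by move=> l /flatten_mapP[i _ lL]; have [_ /(_ l lL)] := GL i.
    exists (sigma b) => i; have [_ _ iP] := GL i; apply/iP; exists sigma; split=> //.
      by move=> l lL; apply: sL; apply/flatten_mapP; exists i; rewrite ?mem_enum.
    by move=> p pG; apply: sG; apply/flatten_mapP; exists i; rewrite ?mem_enum.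
  exists m; suff <- : Gam `|` [set (b, m)] = Gam by right.
  apply: Gmax => [p|G L GGam Lid]; first by left.
  pose G' := [seq p <- G | `[< Gam p >]].
  have [psi psiP] := system_instance b L G'.
  have : pp_holds psi m.
    by apply: mP; exists G', L; split=> // p; rewrite mem_filter => /andP[/asboolW].
  move=> /psiP[sigma [sL sb sG]]; exists sigma; split=> // p pG.
  have [Gp|->//] := GGam p pG.
  by apply: sG; rewrite mem_filter pG andbT; apply: asboolT.
have [k kE] : exists k : {linear B -> P}, k = h :> (B -> P).
  apply: linear_ext => r x y.
  have [||sigma [sL sG]] := Gg [:: (r *: x + y, h (r *: x + y)); (x, h x); (y, h y)]
     [:: [:: (1, r *: x + y); (- r, x); (- 1, y)]].
  - by move=> p; rewrite !inE => /or3P[] /eqP ->.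
  - move=> t; rewrite inE => /eqP ->; rewrite !big_cons big_nil /= scale1r addr0.
    by rewrite scaleN1r scaleNr -opprD subrr.
  have := sL _ (mem_head _ _); rewrite !big_cons big_nil /= scale1r addr0 scaleN1r scaleNr -opprD.
  have -> : sigma (r *: x + y) = h (r *: x + y) by apply: (sG (_, _)); rewrite !inE eqxx.
  have -> : sigma x = h x by apply: (sG (_, _)); rewrite !inE eqxx ?orbT.
  have -> : sigma y = h y by apply: (sG (_, _)); rewrite !inE eqxx ?orbT.
  by move/subr0_eq.
exists k => a; rewrite kE.
have [||sigma [_ sG]] := Gg [:: (f a, h (f a)); (f a, g a)] [::] => //.
  by move=> p; rewrite !inE => /orP[] /eqP -> //; apply: G0; exists a.
transitivity (sigma (f a)); first by apply/esym/(sG (_, _)); rewrite !inE eqxx.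
by apply: (sG (_, _)); rewrite !inE eqxx orbT.
Qed.

End Criterion.

(** * Submodules as modules *)

Section SubmoduleTransfer.
Variables (R : pzRingType) (M : lmodType R) (C : submodClosed M).

Definition subm_incl : {linear subm C -> M} := \val.

Lemma subm_inclP (x : subm C) : subm_incl x \in C.
Proof. exact: valP. Qed.

Lemma subm_lift n (v : 'I_n -> M) : allin [set` C] v ->
  exists v' : 'I_n -> subm C, subm_incl \o v' = v.
Proof.
move=> Cv; exists (fun i => Sub (v i) (Cv i)); apply/funext => i; exact: SubK.
Qed.

Lemma subm_incl_inj : injective subm_incl.
Proof. exact: val_inj. Qed.

Lemma subm_incl_in n (v : 'I_n -> subm C) : allin [set` C] (subm_incl \o v).
Proof. by move=> i; apply: subm_inclP. Qed.

Lemma subm_incl_comp_inj n (v w : 'I_n -> subm C) :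
  subm_incl \o v = subm_incl \o w -> v = w.
Proof.
by move=> vw; apply/funext => i; apply: subm_incl_inj; apply: (congr1 (fun u => u i) vw).
Qed.

Lemma subm_flatP : flat (subm C) <-> flatin [set` C].
Proof.
rewrite flatP; split=> fC m n X v Cv Xv.
  have [v' v'v] := subm_lift Cv.
  have [//||k [D [y [_ v'E XD]]]] := fC _ _ X v'.
    apply: subm_incl_comp_inj; rewrite -mact_linear v'v Xv.
    by apply/funext => i; rewrite -[RHS](linear0 subm_incl).
  exists k, D, (subm_incl \o y); split=> //; first exact: subm_incl_in.
  by rewrite mact_linear -v'E.
have [||k [D [y [Cy vE XD]]]] := fC _ _ X (subm_incl \o v); first exact: subm_incl_in.
  by rewrite mact_linear Xv; apply/funext => i; rewrite -[RHS](linear0 subm_incl).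
have [y' y'y] := subm_lift Cy.
exists k, D, y'; split=> //; apply: subm_incl_comp_inj.
by rewrite -mact_linear y'y.
Qed.

Lemma subm_pure_embeddingP : pure_embedding subm_incl <-> purein [set` C] setT.
Proof.
rewrite pure_embeddingP; split=> [h|[_ h]].
  split=> // m n X u Cu [w _ Xw]; have [u' u'u] := subm_lift Cu.
  have [w' Xw'] := h _ _ X u' w (etrans Xw (esym u'u)).
  exists (subm_incl \o w'); first exact: subm_incl_in.
  by rewrite mact_linear Xw'.
move=> m n X v w Xw.
have [||w' Cw' Xw'] := h _ _ X (subm_incl \o v); first exact: subm_incl_in.
  by exists w.
have [y yw] := subm_lift Cw'; exists y; apply: subm_incl_comp_inj.
by rewrite -mact_linear yw.
Qed.

Lemma subm_atmost L : atmost L [set` C] -> [set: subm C] #<= [set: L].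
Proof. by move=> /atmost_inject h; apply/card_le_setT. Qed.

End SubmoduleTransfer.

Lemma pure_embedding_comp (R : pzRingType) (A B C : lmodType R) (f : {linear A -> B})
    (g : {linear B -> C}) (h : {linear A -> C}) : h = g \o f :> (A -> C) ->
  pure_embedding h -> pure_embedding f.
Proof.
move=> hE /pure_embeddingP hp; apply/pure_embeddingP => m n X v w Xw.
by apply: (hp _ _ X v (g \o w)); rewrite hE mact_linear Xw.
Qed.

Lemma pure_embedding_sat (R : pzRingType) (A B : lmodType R) (f : {linear A -> B})
    k (phi : pp_formula R k) v :
  pure_embedding f -> satS setT phi (f \o v) -> satS setT phi v.
Proof.
move=> /pure_embeddingP fp [w _ h].
have [|w' h'] := fp _ _ (pp_ex_part phi) (- mact (pp_free_part phi) v) w.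
  apply/eqP; rewrite -subr_eq0; apply/eqP; rewrite -[RHS]h; congr (_ + _).
  apply/funext => i; rewrite mact_linear fctN /=.
  by rewrite fctN linearN opprK.
by exists w' => //; rewrite h' addNr.
Qed.

Lemma satSB (R : pzRingType) (M : lmodType R) (S : set M) k (phi : pp_formula R k) v w :
  submodS S -> satS S phi v -> satS S phi w -> satS S phi (v - w).
Proof.
move=> sS [a Sa ha] [b Sb hb]; exists (a - b); first by apply: allinD => //; apply: allinN.
by rewrite !mactB addrACA -opprD ha hb subrr.
Qed.

(** * Small pure submodules *)

Lemma inject_of_surj (X L : Type) (d : L -> X) : (forall x, exists l, d l = x) -> inject X L.
Proof.
by move=> /choice[f fK]; exists f => x y fxy; rewrite -(fK x) -(fK y) fxy.
Qed.

Section SmallPure.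
Variables (R : pzRingType) (L : Type).
Hypotheses (natL : inject nat L) (RL : inject R L).

Lemma inject_seqseq : inject (seq (seq R)) L.
Proof.
apply: (inject_trans _ (inject_seq natL)); case: (inject_seq natL) => c ci.
case: RL => f fi; exists (map (fun s => c (map f s))).
apply: inj_map => s t /ci; exact: inj_map.
Qed.

Definition mx_of_rows m n (s : seq (seq R)) : 'M[R]_(m, n) :=
  \matrix_(i, j) nth 0 (nth [::] s i) j.

Lemma mx_of_rows_surj m n (X : 'M[R]_(m, n)) : exists s, mx_of_rows m n s = X.
Proof.
exists [seq [seq X i j | j <- enum 'I_n] | i <- enum 'I_m]; apply/matrixP => i j.
rewrite mxE (nth_map i) ?size_enum_ord // nth_ord_enum.
by rewrite (nth_map j) ?size_enum_ord // nth_ord_enum.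
Qed.

Lemma inject_pp_formula : inject {k & pp_formula R k.+1} L.
Proof.
have LL := inject_square natL.
apply: (@inject_trans _ ((nat * (nat * nat)) * (seq (seq R) * seq (seq R)))%type).
  apply: (@inject_of_surj _ _ (fun c => existT _ c.1.1
    (PPFormula (mx_of_rows c.1.2.1 c.1.2.2 c.2.1) (mx_of_rows c.1.2.1 c.1.1.+1 c.2.2)))).
  move=> [k [n m A B]]; have [s sA] := mx_of_rows_surj A; have [t tB] := mx_of_rows_surj B.
  by exists ((k, (m, n)), (s, t)); rewrite /= sA tB.
apply: (inject_trans _ LL); apply: inject_prod; last first.
  by apply: (inject_trans _ LL); apply: inject_prod; apply: inject_seqseq.
by apply: (inject_trans _ LL); apply: inject_prod => //; apply: (inject_trans _ LL); apply: inject_prod.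
Qed.

(** A Skolem function for each component of the solutions of linear systems
    modulo [S]. *)
Lemma small_pure_modulo (M : lmodType R) (S S0 : set M) : submodS S -> atmost L S0 ->
  exists T : set M, [/\ S0 `<=` T, submodS T, atmost L T &
    forall m n (X : 'M[R]_(m, n)) u, allin T u -> (exists w, allin S (mact X w - u)) ->
      exists2 w, allin T w & allin S (mact X w - u)].
Proof.
move=> sS S0L.
pose problem := {m : nat & {n : nat & ('M[R]_(m, n) * 'I_n)%type}}.
have LL := inject_square natL.
have RpL : inject (R + option problem) L.
  apply: inject_sum => //.
  apply: (@inject_trans _ (nat * (nat * (seq (seq R) * nat)))%type).
    pose d (c : nat * (nat * (seq (seq R) * nat))) : option problem :=
      if c.2.1 is n'.+1 then
        Some (existT _ c.1 (existT (fun n => ('M[R]_(c.1, n) * 'I_n)%type) n'.+1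
           (mx_of_rows c.1 n'.+1 c.2.2.1, inord c.2.2.2)))
      else None.
    apply: (@inject_of_surj _ _ d) => -[[m [n [X j]]]|]; last by exists (0, (0, ([::], 0)))%N.
    case: n X j => [|n] X j; first by case: j.
    have [s sX] := mx_of_rows_surj X; exists (m, (n.+1, (s, nat_of_ord j))).
    by rewrite /d /= sX inord_val.
  apply: (inject_trans _ LL); apply: inject_prod => //; apply: (inject_trans _ LL).
  apply: inject_prod => //; apply: (inject_trans _ LL).
  by apply: inject_prod => //; apply: inject_seqseq.
pose vec m (s : seq M) : 'I_m -> M := fun i => nth 0 s i.
have /choice[sk skP] : forall c : {m : nat & {n : nat & 'M[R]_(m, n)}} * seq M,
    exists w : nat -> M, let: (existT m (existT n X), s) := c in
      (exists w', allin S (mact X w' - vec m s)) ->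
      allin S (mact X (fun j : 'I_n => w j) - vec m s).
  move=> [[m [n X]] s].
  have [[w wP]|no] := pselect (exists w', allin S (mact X w' - vec m s)); last by exists (fun=> 0).
  exists (fun j => if insub j is Some j' then w j' else 0) => _.
  rewrite (_ : (fun j : 'I_n => _) = w) //; apply/funext => j.
  by rewrite valK.
pose op (f : R + option problem) (s : seq M) : M := match f with
  | inl r => r *: nth 0 s 0 + nth 0 s 1
  | inr (Some (existT m (existT n (X, j)))) => sk (existT _ m (existT _ n X), s) j
  | inr None => 0 end.
have [|T [S0T TL Top]] := @closure_atmost L _ M op S0 natL RpL _ S0L; first by exists; exact: 0.
exists T; split=> //.
  split; first by apply: (Top (inr None) [::]).
  by move=> r x y Tx Ty; apply: (Top (inl r) [:: x; y]) => z; rewrite !inE => /orP[]/eqP ->.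
move=> m n X u Tu hw; pose s := map u (enum 'I_m).
have sE : vec m s = u.
  by apply/funext => i; rewrite /vec /s (nth_map i) ?size_enum_ord // nth_ord_enum.
have sT x : x \in s -> T x by move=> /mapP[i _ ->].
exists (fun j : 'I_n => sk (existT _ m (existT _ n X), s) j) => [j|].
  exact: (Top (inr (Some (existT _ m (existT _ n (X, j))))) s sT).
by have := skP (existT _ m (existT _ n X), s); rewrite sE; apply.
Qed.

Lemma small_pure (M : lmodType R) (S0 : set M) : atmost L S0 ->
  exists T : set M, [/\ S0 `<=` T, submodS T, atmost L T & purein T setT].
Proof.
have s0 : submodS [set 0 : M] by split=> // r x y -> ->; rewrite scaler0 addr0.
move=> /(small_pure_modulo s0)[T [S0T sT TL Tp]]; exists T; split=> //; split=> // m n X u Tu [w _ Xw].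
have [|w' Tw' Xw'] := Tp _ _ X u Tu; first by exists w => i; rewrite Xw subrr.
by exists w' => //; apply/funext => i; apply/subr0_eq/Xw'.
Qed.

End SmallPure.

(** A generalized limit of elements realizing the finite subsets of [Psi]. *)
Lemma pure_injective_compact (R : pzRingType) (P : lmodType R) (Psi : set (pp_instance P)) :
  pure_injective P -> finitely_realized Psi -> exists x, forall psi, Psi psi -> pp_holds psi x.
Proof.
move=> PIP fin; pose D := seq {psi | Psi psi}.
have /choice[x xP] : forall d : D, exists x, forall psi, List.In psi d -> pp_holds (sval psi) x.
  move=> d; have [|x xP] := fin (size d) (fun i => sval (tnth (in_tuple d) i)).
    by move=> i; apply: svalP.
  exists x; suff h psi : List.In psi d -> exists i, psi = tnth (in_tuple d) i.
    by move=> psi /h[i ->].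
  elim: (d) => //= phi e IHe [->|/IHe[i ->]]; first by exists ord0; rewrite (tnth_nth phi).
  by exists (fintype.lift ord0 i); rewrite (tnth_nth phi) (tnth_nth phi).
have [|||rho [rhoC rho0]] := @pure_injective_limit R P PIP D (fun d e => forall psi, List.In psi d -> List.In psi e) [::].
- by [].
- by move=> d e f de ef psi /de/ef.
- by move=> d e; exists (d ++ e); split=> psi pd; apply/List.in_or_app; [left|right].
exists (rho x) => psi Ppsi.
have /choice[w wP] : forall d : D, exists w, List.In (exist _ psi Ppsi) d ->
    mact (pp_ex_part (pp_shape psi)) w +
    mact (pp_free_part (pp_shape psi)) (vcons (x d) (pp_params psi)) = 0.
  move=> d; have [pd|npd] := pselect (List.In (exist _ psi Ppsi) d); last by exists (fun=> 0).
  by have [w _ h] := xP d _ pd; exists w.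
exists (rho \o (fun j d => w d j)) => //.
have -> : vcons (rho x) (pp_params psi) = rho \o (fun j d => vcons (x d) (pp_params psi) j).
  by apply/funext => j; rewrite /vcons /=; case: unliftP => //= *; rewrite ?rhoC //; congr (rho _).
rewrite !mact_linear; apply/funext => i; rewrite fctD /= -linearD; apply: rho0.
exists [:: exist _ psi Ppsi] => d dP.
have /(congr1 (fun u => u i)) := wP d (dP _ (or_introl erefl)).
by rewrite !fctD => h; rewrite /mact !fct_sumE.
Qed.

(** * Limit models of large cofinality are pure-injective *)

(** An unbounded family would have a cofinal range. *)
Lemma small_family_bounded (K kappa cf : cardinal) d (alpha : orderType d) (b : K -> alpha) :
  is_succ_cardinal K kappa -> is_cofinality alpha cf -> [set: kappa] #<= [set: cf] ->
  exists i, forall x, (b x <= i)%O.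
Proof.
move=> [nkK _] [_ cofmin] kcf; apply: contrapT => nb; move: nkK => /negP; apply.
have cofb : cofinal (range b).
  move=> i; have /existsNP[x /negP] : ~ (forall x, b x <= i)%O by move=> h; apply: nb; exists i.
  by rewrite -ltNge => /ltW ibx; exists (b x); first by exists x.
apply: (card_le_trans kcf); apply: (card_le_trans (cofmin _ cofb)).
exact: card_image_le.
Qed.

Section EnvelopesFlat.
Variable R : pzRingType.
Hypothesis envelope_flat : forall (M P : lmodType R) (i : {linear M -> P}),
  flat M -> pure_injective_envelope i -> flat P.

(** Instances of one pp-formula define cosets of a single subgroup, so a finitely
    realized set of instances is generated by one instance of each formula; these
    have all their parameters in a stage [C i] of the chain.  The generating
    instances are realized in the envelope of [C i], which is flat, hence in a
    small flat extension of [C i], hence in the next stage. *)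
Lemma limit_model_pure_injective (kappa lambda cf : cardinal) d (alpha : orderType d)
    (M : lmodType R) :
  is_succ_cardinal (R + nat)%type kappa -> [set: kappa] #<= [set: lambda] ->
  is_cofinality alpha cf -> [set: kappa] #<= [set: cf] ->
  limit_model lambda alpha M -> pure_injective M.
Proof.
move=> ksucc kl acf kcf [infl [wo [i0] nomax] _ [C [Cflat Cmono _ Cuniv Call]]].
apply: pure_injective_criterion => Psi fin.
have Cpp i j : (i <= j)%O -> purein [set` C i] [set` C j].
  by move=> ij; apply/pp_leP; [exact: submodS_closed|exact: Cmono].
have Csub i j x : (i <= j)%O -> x \in C i -> x \in C j.
  by move=> ij; apply: (Cpp i j ij).1.
have bound n (v : 'I_n -> M) : exists i, allin [set` C i] v.
  have /choice[e eP] : forall j, exists i, v j \in C i by move=> j; apply: Call.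
  suff [i iP] : exists i, forall j, j \in enum 'I_n -> (e j <= i)%O.
    by exists i => j; apply: (Csub (e j)) => //; apply: iP; rewrite mem_enum.
  elim: (enum 'I_n) => [|j s [i iP]]; first by exists i0.
  exists (Order.max (e j) i) => k; rewrite inE => /orP[/eqP ->|/iP ki].
    by rewrite le_max lexx.
  by rewrite le_max ki orbT.
have Cpure i : purein [set` C i] setT.
  split=> // m n X u Cu [w _ Xw]; have [j Cw] := bound n w.
  apply: (Cpp i (Order.max i j) _).2 => //; first by rewrite le_max lexx.
  by exists w => // k; apply: Csub (Cw k); rewrite le_max lexx orbT.
pose K := (R + nat)%type.
have natK : inject nat K by exists inr => x y [].
have RK : inject R K by exists inl => x y [].
pose X := {k & pp_formula R k.+1}.
have XK : inject X K := inject_pp_formula natK RK.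
have x0 : X by exists 0%N; exact: (@PPFormula _ _ 0 0 0 0).
have [dec decP] := inject_surj x0 XK.
(* One instance in [Psi] of each formula that has one. *)
have par_ex (x : X) : exists v : 'I_(projT1 x) -> M,
    forall v', Psi (PPInstance (projT2 x) v') -> Psi (PPInstance (projT2 x) v).
  have [[v Pv]|nP] := pselect (exists v, Psi (PPInstance (projT2 x) v)).
    by exists v.
  by exists (fun=> 0) => v' Pv'; case: nP; exists v'.
pose par x := projT1 (cid (par_ex x)); have parP x := projT2 (cid (par_ex x)).
have /choice[b bP] : forall k : K, exists i, allin [set` C i] (par (dec k)) by move=> k; apply: bound.
have [i iP] := small_family_bounded b ksucc acf kcf.
have parC x : allin [set` C i] (par x).
  by have [k <-] := decP x; move=> j; apply: Csub (bP k j).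
have [j ij] : exists j, succ_index i j.
  have [|j ij jmin] := @well_order_min _ _ (fun j => (i < j)%O) wo; first exact: nomax.
  by exists j; split.
have [_ _ univ] := Cuniv i j ij.
have [P [e env]] := pure_injective_envelope_exists (subm (C i)).
have [epure PIP _] := env.
have Pflat : flat P by apply: envelope_flat env; apply: (Cflat i).1.
pose par' x := projT1 (cid (subm_lift (parC x))).
have par'P x : subm_incl (C i) \o par' x = par x := projT2 (cid (subm_lift (parC x))).
(* [e] extends to [M], so realizations in [M] of finite parts are sent to [P]. *)
have [ebar ebarP] := PIP _ _ (subm_incl (C i)) e ((subm_pure_embeddingP _).2 (Cpure i)).
pose PsiP : set (pp_instance P) := [set psi | exists x, Psi (PPInstance (projT2 x) (par x)) /\
  psi = PPInstance (projT2 x) (e \o par' x)].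
have vcons_comp (A B : lmodType R) (f : A -> B) k y (v : 'I_k -> A) :
    vcons (f y) (f \o v) = f \o vcons y v.
  by apply/funext => l; rewrite /vcons /=; case: unlift.
have [|x xP] := @pure_injective_compact _ _ PsiP PIP.
  move=> n t /choice[y yP].
  have [|m mP] := fin n (fun l => PPInstance (projT2 (y l)) (par (y l))).
    by move=> l; have [] := yP l.
  exists (ebar m) => l; have [_ ->] := yP l; have := mP l; rewrite /pp_holds /=.
  have -> : e \o par' (y l) = ebar \o par (y l).
    by apply/funext => q; rewrite /= -ebarP -[in RHS]par'P.
  by rewrite vcons_comp; apply: satS_linear.
pose L := subm (C i).
have Ll : inject lambda L.
  have [_] := Cflat i; rewrite card_eq_le => /andP[_ /card_le_setT] //.
have natL : inject nat L.
  exact: inject_trans ((infinite_nat_inject _).1 infl) Ll.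
have RL : inject R L.
  apply: (inject_trans RK); apply: inject_trans Ll; move/card_le_setT: kl; apply: inject_trans.
  have [//|kK] := inject_total K kappa.
  by case: ksucc => /negP nk _; case: nk; apply/card_le_setT.
have smallS : atmost L (range e `|` [set x]).
  apply: (@atmost_image _ _ (L + nat)%type (inr 0%N)
    (fun s => match s with inl l => e l | inr _ => x end)).
    exact: (inject_sum natL (inject_refl _) natL).
  by move=> _ [[l _ <-]| ->]; [exists (inl l)|exists (inr 0%N)].
have [P0 [eP0 sP0 P0L P0pure]] := small_pure natL RL smallS.
pose N := subm (submod sP0).
have inclpure : pure_embedding (subm_incl (submod sP0)).
  by apply/subm_pure_embeddingP; rewrite submodE.
have eN l : e l \in submod sP0 by apply/in_submodP/eP0; left; exists l.
have [g gE] : exists g : {linear L -> N}, g = (fun l => Sub (e l) (eN l)) :> (L -> N).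
  by apply: linear_ext => r u v; apply: val_inj; rewrite /= linearP.
have incg : e = subm_incl (submod sP0) \o g :> (L -> P) by rewrite gE.
have Nflat : flat N.
  apply/subm_flatP; rewrite submodE; apply: flatin_purein P0pure _.
  by apply/flatP.
have Nsmall : [set: N] #<= [set: L].
  by apply: subm_atmost => //; rewrite submodE.
have [f fpure fP] := univ N g Nflat Nsmall (pure_embedding_comp incg epure).
have xN : x \in submod sP0 by apply/in_submodP/eP0; right.
pose xn : N := Sub x xN; pose y : M := val (f xn).
exists y => -[k phi v] Pv.
pose fx : X := existT _ k phi.
have Ppar : Psi (PPInstance phi (par fx)) by apply: (parP fx v).
have ypar : satS setT phi (vcons y (par fx)).
  have : pp_holds (PPInstance phi (e \o par' fx)) x by apply: xP; exists fx.
  rewrite /pp_holds /= incg -[x]/(subm_incl (submod sP0) xn) -compA vcons_comp.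
  move=> /(pure_embedding_sat inclpure) h.
  have [vf vfE] : exists q : {linear N -> M}, q = subm_incl (C j) \o f :> (N -> M).
    by apply: linear_ext => r u w; rewrite /= !linearP.
  have -> : vcons y (par fx) = vf \o vcons xn (g \o par' fx).
    rewrite -vcons_comp vfE; congr vcons; rewrite -par'P; apply/funext => l /=.
    exact: esym (fP _).
  exact: satS_linear h.
(* [m] realizes both instances of [phi]: the difference of the two parameter tuples
   does not change the coset. *)
have [|m mP] := fin 2%N (fun l => if l == ord0 then PPInstance phi v else PPInstance phi (par fx)).
  by move=> l; case: eqP.
have := mP ord0; have := mP ord_max; rewrite /pp_holds /= => m1 m0.
have -> : vcons y v = vcons y (par fx) - (vcons m (par fx) - vcons m v).
  apply/funext => l; rewrite !fctD !fctN fctD fctN /vcons; case: unlift => [q|].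
    by rewrite opprB addrCA subrr addr0.
  by rewrite subrr subr0.
by apply: satSB => //; apply: satSB.
Qed.

End EnvelopesFlat.

(** * An injective cogenerator *)

Section Injective.
Variable R : pzRingType.

Definition linearS (A N : lmodType R) (S : set A) (h : A -> N) : Prop :=
  forall r x y, S x -> S y -> h (r *: x + y) = r *: h x + h y.

(** The character module of the ring, an injective cogenerator. *)
Definition injcog : lmodType R := ldual ((R^c)^o : lmodType R^c).

Definition injcog_val (phi : injcog) : R -> QZ := val (phi : ldual ((R^c)^o : lmodType R^c)).

Lemma injcog_val_inj : injective injcog_val.
Proof. by move=> x y xy; apply: val_inj. Qed.

Lemma injcog_hom (A : lmodType R) (chi : A -> QZ) : {morph chi : x y / x - y} ->
  exists theta : {linear A -> injcog}, forall a s, injcog_val (theta a) s = chi (s *: a).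
Proof.
move=> chiB; have thB a : {morph (fun s : (R^c)^o => chi ((s : R) *: a)) : x y / x - y}.
  by move=> x y; rewrite -chiB -scalerBl.
have [theta thE] : exists f : {linear A -> injcog}, f = (fun a => mkchar (thB a)) :> (A -> injcog).
  apply: linear_ext => r a b; apply: val_inj; apply/funext => s.
  rewrite [RHS](_ : _ = chi (((s : R) * r) *: a) + chi ((s : R) *: b)) //.
  rewrite -[LHS]/(chi ((s : R) *: (r *: a + b))) scalerDr scalerA.
  have chiD x y : chi (x + y) = chi x + chi y.
    have chi0 : chi 0 = 0 by have := chiB 0 0; rewrite !subrr.
    by rewrite -[y in LHS]opprK -[- y]sub0r !chiB chi0 sub0r opprK.
  exact: chiD.
by exists theta => a; rewrite thE.
Qed.

Lemma linearS0 (A N : lmodType R) (S : set A) (h : A -> N) : submodS S -> linearS S h -> h 0 = 0.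
Proof.
move=> [S0 _] hl; have := hl 1 0 0 S0 S0; rewrite scale1r addr0 scale1r => e.
by apply: (addrI (h 0)); rewrite addr0.
Qed.

Lemma linearSB (A N : lmodType R) (S : set A) (h : A -> N) x y : submodS S -> linearS S h ->
  S x -> S y -> h (x - y) = h x - h y.
Proof.
by move=> sS hl Sx Sy; rewrite addrC -scaleN1r hl // scaleN1r addrC.
Qed.

Lemma linearSZ (A N : lmodType R) (S : set A) (h : A -> N) r x : submodS S -> linearS S h ->
  S x -> h (r *: x) = r *: h x.
Proof.
move=> sS hl Sx; rewrite -[r *: x]addr0 hl //; last by case: sS.
by rewrite (linearS0 sS hl) addr0.
Qed.

(** A homomorphism into the cogenerator is determined by its values at [1], which
    form a character, and characters extend. *)
Lemma injcog_injective (A : lmodType R) (S : set A) (h : A -> injcog) :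
  submodS S -> linearS S h -> exists theta : {linear A -> injcog}, forall a, S a -> theta a = h a.
Proof.
move=> sS hl.
have [||chi [chiB chiP]] := @divisible_ext A QZ [set p | S p.1 /\ p.2 = injcog_val (h p.1) 1] QZ_divisible.
- split; first by split; [case: sS|rewrite /= (linearS0 sS hl)].
  move=> [a d] [b e] [/= Sa ->] [/= Sb ->]; split; first exact: submodS_B.
  by rewrite /= (linearSB sS hl).
- by move=> d [_ /= ->]; rewrite (linearS0 sS hl).
have [theta thE] := injcog_hom chiB; exists theta => a Sa.
apply: injcog_val_inj; apply/funext => s; rewrite thE.
rewrite (chiP (s *: a) (injcog_val (h (s *: a)) 1)) //=; last by split=> //; apply: submodS_Z.
rewrite (linearSZ s sS hl) // -[LHS]/(injcog_val (h a) (1 * s)).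
by rewrite mul1r.
Qed.

Lemma injcog_separates (A : lmodType R) (S : set A) (a : A) : submodS S -> ~ S a ->
  exists theta : {linear A -> injcog}, (forall x, S x -> theta x = 0) /\ theta a <> 0.
Proof.
move=> sS Sa; have [||chi [chiB chiS /eqP chia]] := @character_separates A S a => //.
  by split; [case: sS|move=> x y; apply: submodS_B].
have [theta thE] := injcog_hom chiB; exists theta; split=> [x Sx|tha].
  apply: injcog_val_inj; apply/funext => s; rewrite thE.
  by apply: chiS; apply: submodS_Z.
by apply: chia; rewrite -[a]scale1r -thE tha.
Qed.

(** Powers of the cogenerator are injective, coordinate by coordinate; the
    coordinates at which [h] vanishes are extended by zero. *)
Lemma power_injective (Z : Type) (A : lmodType R) (S : set A) (V : set Z) (h : A -> Z -> injcog) :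
  submodS S -> linearS S h -> (forall a z, S a -> ~ V z -> h a z = 0) ->
  exists theta : {linear A -> (Z -> injcog)}, (forall a, S a -> theta a = h a) /\
    forall a z, ~ V z -> theta a z = 0.
Proof.
move=> sS hl hV.
have /choice[t tP] : forall z, exists t : {linear A -> injcog},
    (forall a, S a -> t a = h a z) /\ (~ V z -> forall a, t a = 0).
  move=> z; have [Vz|nVz] := pselect (V z).
    have [|t tP] := @injcog_injective A S (fun a => h a z) sS.
      by move=> r x y Sx Sy; rewrite hl.
    by exists t.
  have [t tE] : exists f : {linear A -> injcog}, f = (fun=> 0) :> (A -> injcog).
    by apply: linear_ext => r x y; rewrite scaler0 addr0.
  by exists t; rewrite tE; split=> // a Sa; rewrite hV.
have [theta thE] : exists f : {linear A -> (Z -> injcog)}, f = (fun a z => t z a) :> (A -> Z -> injcog).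
  by apply: linear_ext => r x y; apply/funext => z; rewrite linearP.
exists theta; rewrite thE; split=> [a Sa|a z nVz]; first by apply/funext => z; apply: (tP z).1.
exact: (tP z).2.
Qed.

(** The [a]-th coordinate is chosen to vanish on [S] and not at [a], unless [a] is
    in [S]. *)
Lemma power_separates (A : lmodType R) (S : set A) : submodS S ->
  exists theta : {linear A -> (A -> injcog)}, forall a, theta a = 0 <-> S a.
Proof.
move=> sS.
have /choice[t tP] : forall a, exists t : {linear A -> injcog},
    (forall x, S x -> t x = 0) /\ (t a = 0 -> S a).
  move=> a; have [Sa|nSa] := pselect (S a).
    have [t tE] : exists f : {linear A -> injcog}, f = (fun=> 0) :> (A -> injcog).
      by apply: linear_ext => r x y; rewrite scaler0 addr0.
    by exists t; rewrite tE.
  by have [t [t0 ta]] := injcog_separates sS nSa; exists t; split=> // /ta.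
have [theta thE] : exists f : {linear A -> (A -> injcog)}, f = (fun a b => t b a) :> (A -> A -> injcog).
  by apply: linear_ext => r x y; apply/funext => z; rewrite linearP.
exists theta => a; rewrite thE; split=> [ta|Sa]; last by apply/funext => b; apply: (tP b).1.
by apply: (tP a).2; rewrite -[RHS](congr1 (fun f : A -> injcog => f a) ta).
Qed.

End Injective.

(** * Free modules *)

Section FreeModule.
Variables (R : pzRingType) (K : choiceType).

Definition fin_supp (a : K -> R^o) : Prop := exists s : seq K, forall k, k \notin s -> a k = 0.

Lemma fin_supp_submodS : submodS fin_supp.
Proof.
split=> [|r a b [s sa] [t tb]]; first by exists [::].
exists (s ++ t) => k; rewrite mem_cat negb_or => /andP[ks kt].
by rewrite fctD scalrfctE sa // tb // scaler0 addr0.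
Qed.

Definition freemod : lmodType R := subm (submod fin_supp_submodS).

Definition fcoef (a : freemod) (k : K) : R := val a k.

Lemma fcoefP r a b k : fcoef (r *: a + b) k = r * fcoef a k + fcoef b k.
Proof. by []. Qed.

Lemma freemod_ext (a b : freemod) : fcoef a =1 fcoef b -> a = b.
Proof. by move=> ab; apply: val_inj; apply/funext. Qed.

Lemma fcoef_supp (a : freemod) : exists s : seq K, forall k, k \notin s -> fcoef a k = 0.
Proof. by have /in_submodP[s sP] := valP a; exists s. Qed.

Lemma freemod_of (a : K -> R^o) : fin_supp a -> exists a' : freemod, fcoef a' = a.
Proof. by move=> fa; exists (Sub a ((in_submodP fin_supp_submodS a).2 fa)). Qed.

Lemma sum_supp (N : lmodType R) (t : K -> N) (a : K -> R) (s s' : seq K) :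
  (forall k, k \notin s -> a k = 0) -> {subset s <= s'} ->
  \sum_(k <- undup s') a k *: t k = \sum_(k <- undup s) a k *: t k.
Proof.
move=> sa ss'; rewrite (bigID (mem s)) /= [X in _ + X]big1 ?addr0; last first.
  by move=> k ks; rewrite sa ?scale0r.
rewrite -big_filter; apply: perm_big; apply: uniq_perm; rewrite ?filter_uniq ?undup_uniq //.
move=> k; rewrite mem_filter !mem_undup /=.
by case ks: (k \in s); rewrite //= ss'.
Qed.

Lemma freemod_lift (N : lmodType R) (t : K -> N) : exists pi : {linear freemod -> N},
  forall a s, (forall k, k \notin s -> fcoef a k = 0) ->
    pi a = \sum_(k <- undup s) fcoef a k *: t k.
Proof.
have /choice[sp spP] := fcoef_supp.
pose f a := \sum_(k <- undup (sp a)) fcoef a k *: t k.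
have fE a s : (forall k, k \notin s -> fcoef a k = 0) ->
    f a = \sum_(k <- undup s) fcoef a k *: t k.
  move=> sa; rewrite /f -(@sum_supp _ t _ _ (sp a ++ s) (spP a)).
    by apply: sum_supp => // k ks; rewrite mem_cat ks orbT.
  by move=> k ks; rewrite mem_cat ks.
have [pi piE] : exists pi : {linear freemod -> N}, pi = f :> (freemod -> N).
  apply: linear_ext => r a b; pose s := sp a ++ sp b.
  have sab k : k \notin s -> fcoef a k = 0 /\ fcoef b k = 0.
    by rewrite mem_cat negb_or => /andP[ks kt]; rewrite !spP.
  rewrite (fE a s) => [|k /sab[]//]; rewrite (fE b s) => [|k /sab[]//].
  rewrite (fE _ s) => [|k /sab[ak bk]]; last by rewrite fcoefP ak bk mulr0 addr0.
  by rewrite scaler_sumr -big_split; apply: eq_bigr => k _; rewrite fcoefP scalerDl scalerA.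
by exists pi; rewrite piE.
Qed.

Definition fbasis_fun (k : K) : K -> R^o := fun k' => (k' == k)%:R : R.

Lemma fbasis_supp k : fin_supp (fbasis_fun k).
Proof. by exists [:: k] => k'; rewrite inE /fbasis_fun => /negPf ->. Qed.

Lemma freemod_basis k : exists b : freemod, forall k', fcoef b k' = (k' == k)%:R.
Proof. by have [b bE] := freemod_of (fbasis_supp k); exists b => k'; rewrite bE. Qed.

Lemma freemod_lift_range (N : lmodType R) (t : K -> N) (T : set N) : submodS T -> range t = T ->
  exists pi : {linear freemod -> N}, range pi = T.
Proof.
move=> sT tT; have [pi piP] := freemod_lift t; exists pi; apply/seteqP; split=> [_ [a _ <-]|x].
  have [s sa] := fcoef_supp a; rewrite (piP a s sa); apply: submodS_sum => // k _.
  by apply: submodS_Z => //; rewrite -tT; exists k.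
rewrite -{1}tT => -[k _ <-]; have [b bE] := freemod_basis k; exists b => //.
rewrite (piP b [:: k]) => [|k']; last by rewrite inE bE => /negPf ->.
by rewrite big_seq1 bE eqxx scale1r.
Qed.

Lemma freemod_flat : flat freemod.
Proof.
apply/flatP => m n X v _ Xv.
have [s sP] : exists s : seq K, forall j k, k \notin s -> fcoef (v j) k = 0.
  have /choice[sp spP] : forall j, exists s : seq K, forall k, k \notin s -> fcoef (v j) k = 0.
    by move=> j; apply: fcoef_supp.
  exists (flatten (map sp (enum 'I_n))) => j k /flatten_mapP ks; apply: spP.
  by apply/negP => kj; apply: ks; exists j; rewrite ?mem_enum.
pose U := undup s; have Uu : uniq U by apply: undup_uniq.
have /choice[y yP] := freemod_basis.
have fsum I (r : seq I) (F : I -> R) (G : I -> freemod) k :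
    fcoef (\sum_(i <- r) F i *: G i) k = \sum_(i <- r) F i * fcoef (G i) k.
  elim: r => [|i r IHr]; first by rewrite !big_nil.
  by rewrite !big_cons fcoefP IHr.
exists (size U), (\matrix_(j, l) fcoef (v j) (tnth (in_tuple U) l)), (y \o tnth (in_tuple U)).
split; first by move=> l.
  apply/funext => j; apply: freemod_ext => k; rewrite /mact fsum.
  under eq_bigr => l _ do rewrite mxE /= yP.
  have [kU|kU] := boolP (k \in U).
    have [l kl] := seq_tnthP kU; rewrite (bigD1 l) //= -kl eqxx mulr1 big1 ?addr0 // => l' l'l.
    rewrite [_ == _]negbTE ?mulr0 //; apply: contra l'l => /eqP e; apply/eqP.
    by apply: (elimT (tuple_uniqP (in_tuple U)) Uu); rewrite -e.
  rewrite sP; last by rewrite -mem_undup.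
  rewrite big1 // => l _; rewrite [_ == _]negbTE ?mulr0 //.
  by apply: contra kU => /eqP ->; apply: mem_tnth.
apply/matrixP => i l; rewrite !mxE; under eq_bigr do rewrite mxE.
have := congr1 (fun u : 'I_m -> freemod => fcoef (u i) (tnth (in_tuple U) l)) Xv.
by rewrite /mact fsum.
Qed.

Lemma freemod_inject L : inject nat L -> inject K L -> inject R L -> inject freemod L.
Proof.
move=> natL KL RL; apply: (@inject_trans _ (seq (K * R))).
  pose d (s : seq (K * R)) : K -> R^o := fun k => \sum_(p <- s | p.1 == k) p.2.
  have dfs s : fin_supp (d s).
    exists (map fst s) => k ks; rewrite /d big_seq_cond big1 // => p /andP[ps /eqP pk].
    by move: ks; rewrite -pk map_f.
  have /choice[d' d'P] : forall s, exists a : freemod, fcoef a = d s by move=> s; apply: freemod_of.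
  apply: (@inject_of_surj _ _ d') => a; have [s sa] := fcoef_supp a.
  exists [seq (k, fcoef a k) | k <- undup s]; apply: freemod_ext => k; rewrite d'P /d big_map /=.
  have [ks|ks] := boolP (k \in undup s).
    by rewrite -big_filter filter_pred1_uniq ?undup_uniq // big_seq1.
  rewrite (sa k); last by rewrite -mem_undup.
  rewrite big_seq_cond big1 // => k' /andP[k's /eqP k'k].
  by move: ks; rewrite -k'k k's.
have [c ci] := inject_trans (inject_prod KL RL) (inject_square natL).
by apply: (inject_trans _ (inject_seq natL)); exists (map c); exact: (inj_map ci).
Qed.

End FreeModule.

(** * Universal extensions *)

Lemma flatover_local (R : pzRingType) (M : lmodType R) (S S' : set M) : S `<=` S' ->
  (forall n (v : 'I_n -> M), allin S' v -> exists T, [/\ flatover S T, T `<=` S' & allin T v]) ->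
  flatover S S'.
Proof.
move=> SS' loc; split=> // m n X v Sv SXv; have [T [[_ f] TS' Tv]] := loc n v Sv.
have [u [k [D [y [Su Ty vE XD]]]]] := f _ _ X v Tv SXv.
by exists u, k, D, y; split=> //; apply: allin_sub Ty.
Qed.

Lemma flatin_local (R : pzRingType) (M : lmodType R) (S : set M) :
  (forall n (v : 'I_n -> M), allin S v -> exists T, [/\ flatin T, T `<=` S & allin T v]) ->
  flatin S.
Proof.
move=> loc m n X v Sv Xv; have [T [f TS Tv]] := loc n v Sv.
have [k [D [y [Ty vE XD]]]] := f _ _ X v Tv Xv.
by exists k, D, y; split=> //; apply: allin_sub Ty.
Qed.

Lemma submodS_local (R : pzRingType) (M : lmodType R) (S : set M) : S 0 ->
  (forall x y, S x -> S y -> exists T, [/\ submodS T, T `<=` S, T x & T y]) -> submodS S.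
Proof.
by move=> S0 loc; split=> // r x y Sx Sy; have [T [[_ Tl] TS Tx Ty]] := loc x y Sx Sy; apply/TS/Tl.
Qed.

Section Adjoin.
Variables (R : pzRingType) (M A : lmodType R).
Implicit Types (S : set M) (theta : {linear A -> M}).

Definition adjoin S theta : set M := [set x | exists c a, S c /\ x = c + theta a].

Lemma adjoin_sub S theta : S `<=` adjoin S theta.
Proof. by move=> x Sx; exists x, 0; rewrite linear0 addr0. Qed.

Lemma adjoin_range S theta a : S 0 -> adjoin S theta (theta a).
Proof. by move=> S0; exists 0, a; rewrite add0r. Qed.

Lemma adjoin_mono S S' theta : S `<=` S' -> adjoin S theta `<=` adjoin S' theta.
Proof. by move=> SS' _ [c [a [Sc ->]]]; exists c, a; split=> //; apply: SS'. Qed.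

Lemma adjoin_submodS S theta : submodS S -> submodS (adjoin S theta).
Proof.
move=> sS; split; first by exists 0, 0; rewrite linear0 addr0; split=> //; case: sS.
move=> r _ _ [c [a [Sc ->]]] [d [b [Sd ->]]]; exists (r *: c + d), (r *: a + b).
by split; [apply: sS.2|rewrite scalerDr linearP addrACA].
Qed.

Lemma adjoin_lift S theta n (v : 'I_n -> M) : allin (adjoin S theta) v ->
  exists c a, allin S c /\ v = c + (theta \o a).
Proof.
move=> /choice[c /choice[a ca]]; exists c, a; split=> [i|]; first by case: (ca i).
by apply/funext => i; case: (ca i).
Qed.

(** The quotient of [S + theta(A)] by [S] is the quotient of [A] by the preimage
    of [S]. *)
Lemma adjoin_flatover S theta (L : set A) : submodS S ->
  (forall a, S (theta a) <-> L a) -> flatover L setT -> flatover S (adjoin S theta).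
Proof.
move=> sS thL [_ fL]; split; first exact: adjoin_sub.
move=> m n X v Sv SXv; have [c [a [Sc vE]]] := adjoin_lift Sv.
have [//||u [k [D [b [Lu _ aE XD]]]]] := fL _ _ X a.
  move=> i; apply/thL; have := SXv i; rewrite vE mactD mact_linear fctD => h.
  have := submodS_B sS h (mact_in X sS Sc i); by rewrite addrAC subrr add0r.
exists (c + (theta \o u)), k, D, (theta \o b); split=> //.
- by apply: allinD => // i; apply/thL; apply: Lu.
- by move=> i; apply: adjoin_range; case: sS.
rewrite vE -addrA; congr (_ + _); rewrite mact_linear; apply/funext => i.
by rewrite aE /= linearD.
Qed.

(** Every extension of [S] with flat quotient [A / L] embeds in [S'] over [S],
    purely: such an extension is the pushout along a map [h] from [L] to [S]. *)
Definition absorbs S S' : Prop :=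
  forall (L : set A) (h : A -> M), submodS L -> flatover L setT -> linearS L h ->
    (forall a, L a -> S (h a)) ->
    exists theta : {linear A -> M},
      [/\ forall a, L a -> theta a = h a, forall a, S (theta a) -> L a,
          forall a, S' (theta a) & purein (adjoin S theta) S'].

End Adjoin.

Section ExtensionStep.
Variables (R : pzRingType) (Lam : Type) (A : lmodType R) (Z : Type).
Hypotheses (natLam : inject nat Lam) (ALam : inject A Lam) (funLam : inject (A -> Lam) Lam)
  (setLam : inject (A -> Prop) Lam) (flatA : flat A) (a0 : A) (a0_neq0 : a0 <> 0).

Local Notation W := (Z -> injcog R).

Definition good (V : set Z) (D : set W) : Prop :=
  [/\ submodS D, flatin D, atmost Lam D & forall x z, D x -> ~ V z -> x z = 0].

Definition ext_index : Type := ((A -> Prop) * (A -> Lam)) * Lam.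

Lemma ext_index_inject : inject ext_index Lam.
Proof.
have LL := inject_square natLam.
apply: (inject_trans _ LL); apply: inject_prod (inject_refl _).
by apply: (inject_trans _ LL); apply: inject_prod.
Qed.

(** The pushouts of [C] along all maps from relation modules [L <= A], indexed by
    [L] and by codes of these maps, are formed simultaneously in [W]; each uses its
    own coordinates to keep the quotient [A / L] independent from the others.
    The last component of the index repeats each extension often enough to make
    [C'] of cardinality exactly [Lam]. *)
Lemma extension_step (V : set Z) (iota : ext_index * A -> Z) (C : set W) :
  injective iota -> (forall p, ~ V (iota p)) -> good V C ->
  exists C', [/\ good (V `|` range iota) C', C `<=` C', flatover C C', absorbs A C C' &
    inject Lam {x | C' x}].
Proof.
move=> iinj iV [sC fC [e eC] CV].
pose valid (p : ext_index) := [/\ submodS p.1.1, flatover p.1.1 setT,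
  linearS p.1.1 (e \o p.1.2) & forall a, p.1.1 a -> C (e (p.1.2 a))].
(* For a valid [p] this extends to [A] the map coded by [p], with kernel modulo the
   coordinates outside [p] equal to [p.1.1]; the other [p] get the zero map. *)
have /choice[theta thP] : forall p : ext_index, exists theta : {linear A -> W},
    [/\ valid p -> (forall a, p.1.1 a -> theta a = e (p.1.2 a)),
        forall a z, theta a z <> 0 -> V z \/ exists a', z = iota (p, a') &
        exists L : set A, [/\ submodS L, flatover L setT, forall a, L a -> C (theta a),
          forall a, (forall a', theta a (iota (p, a')) = 0) -> L a & valid p -> L = p.1.1]].
  move=> p; have [[sL fL hl hC]|nv] := pselect (valid p); last first.
    have [t tE] : exists f : {linear A -> W}, f = (fun=> 0) :> (A -> W).
      by apply: linear_ext => r x y; rewrite scaler0 addr0.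
    exists t; rewrite tE; split=> //; exists setT; split=> //.
    - exact: flatover_refl.
    - by move=> a _; case: sC.
  have [|t [tL tV]] := power_injective sL hl (V := V).
    by move=> a z La; apply: CV; apply: hC.
  have [k kP] := power_separates sL.
  pose kap a (z : Z) : injcog R := match pselect (exists a', z = iota (p, a')) with
    | left h => k a (projT1 (cid h)) | right _ => 0 end.
  have kapE a a' : kap a (iota (p, a')) = k a a'.
    rewrite /kap; case: pselect => [h|[]]; last by exists a'.
    by case: cid => a'' /= /iinj[->].
  have kap0 a z : (forall a', z <> iota (p, a')) -> kap a z = 0.
    by move=> h; rewrite /kap; case: pselect => // za; exfalso; case: za => a' /h.
  have [th thE] : exists f : {linear A -> W}, f = (fun a => t a + kap a) :> (A -> W).
    apply: linear_ext => r x y; rewrite linearP scalerDr addrACA; congr (_ + _).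
    apply/funext => z; have [[a' ->]|nz] := pselect (exists a', z = iota (p, a')).
      by rewrite fctD scalrfctE !kapE linearP.
    have h a' : z <> iota (p, a') by move=> za; apply: nz; exists a'.
    by rewrite fctD scalrfctE !kap0 // scaler0 addr0.
  have thL a : p.1.1 a -> th a = e (p.1.2 a).
    move=> La; rewrite thE tL // -[RHS]addr0; congr (_ + _); apply/funext => z.
    have [[a' ->]|nz] := pselect (exists a', z = iota (p, a')).
      by rewrite kapE (kP a).2.
    by rewrite kap0 // => a' za; apply: nz; exists a'.
  exists th; split=> [_ //|a z|].
    rewrite thE fctD => nz; apply: contrapT => /not_orP[nV nz'].
    by apply: nz; rewrite tV // kap0 ?addr0 // => a' za; apply: nz'; exists a'.
  exists p.1.1; split=> // a; first by move=> La; rewrite thL //; apply: hC.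
  move=> h; apply/kP; apply/funext => a'; rewrite -kapE -[RHS](h a') thE fctD.
  by rewrite tV // add0r.
have /choice[LL LLP] : forall p, exists L : set A,
    [/\ submodS L, flatover L setT, forall a, L a -> C (theta p a),
        forall a, (forall a', theta p a (iota (p, a')) = 0) -> L a & valid p -> L = p.1.1].
  by move=> p; have [_ _] := thP p.
(* The stage where the modules [A] of index in [s] have been adjoined. *)
pose CS (X : set W) (s : seq ext_index) := foldr (fun p Y => adjoin Y (theta p)) X s.
have CS_sub X s : X `<=` CS X s.
  by elim: s => //= p s IHs x /IHs; apply: adjoin_sub.
have CS_mono X Y s : X `<=` Y -> CS X s `<=` CS Y s.
  by move=> XY; elim: s => //= p s; apply: adjoin_mono.
have CS_cat s t : CS C (s ++ t) = CS (CS C t) s by rewrite /CS foldr_cat.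
have CS_submod s : submodS (CS C s).
  by elim: s => //= p s IHs; apply: adjoin_submodS.
have CS_supp s x z : CS C s x -> x z <> 0 -> V z \/ exists p a, List.In p s /\ z = iota (p, a).
  elim: s x => [|p s IHs] x /=.
    by move=> Cx xz; left; apply: contrapT => /(CV _ _ Cx).
  move=> [c [a [Cc ->]]]; rewrite fctD => xz.
  have [cz|cz] := pselect (c z = 0).
    have [_ thV _] := thP p.
    have [tz|?|[a' ->]] := thV a z; [|by left|by right; exists p, a'; split=> //; left].
    by apply: xz; rewrite cz tz addr0.
  by have [?|[q [b [qs ->]]]] := IHs c Cc cz; [left|right; exists q, b; split=> //; right].
have th0 p a : C (theta p a) -> LL p a.
  have [_ _ _ h _] := LLP p; move=> Ca; apply: h => a'.
  by apply: CV Ca _; apply: iV.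
have CS_th p s a : ~ List.In p s -> CS C s (theta p a) <-> LL p a.
  move=> ps; have [_ _ hC h _] := LLP p; split=> [Ca|/hC]; last exact: CS_sub.
  apply: h => a'; apply: contrapT => /(CS_supp _ _ _ Ca)[/iV //|[q [b [qs /iinj pq]]]].
  by apply: ps; case: pq => -> _.
have CS_step p s : flatover (CS C s) (CS C (p :: s)).
  have [ps|ps] := pselect (List.In p s).
    rewrite /= (_ : adjoin _ _ = CS C s); first exact: flatover_refl.
    apply/seteqP; split; last exact: adjoin_sub.
    move=> _ [c [a [Cc ->]]]; apply: submodS_D => //.
    elim: (s) ps => //= q s' IHs [->|/IHs h]; last exact: adjoin_sub.
    by apply: adjoin_range; case: (CS_submod s').
  have [_ fL _ _ _] := LLP p.
  by apply: (@adjoin_flatover _ _ _ _ _ (LL p)) => // a; apply: CS_th.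
have CS_flat s t : flatover (CS C t) (CS C (s ++ t)).
  elim: s => [|p s IHs]; first exact: flatover_refl.
  apply: flatover_trans IHs (CS_step _ _) => //; rewrite CS_cat; exact: CS_sub.
pose C' : set W := [set x | exists s, CS C s x].
have C'_tuple n (v : 'I_n -> W) : allin C' v -> exists s, allin (CS C s) v.
  move=> /choice[s sP].
  suff [t tP] : exists t, forall i, i \in enum 'I_n -> CS C t (v i).
    by exists t => i; apply: tP; rewrite mem_enum.
  elim: (enum 'I_n) => [|i r [t tP]]; first by exists [::].
  exists (s i ++ t) => j; rewrite inE => /orP[/eqP ->|/tP jt]; rewrite CS_cat.
    by apply: CS_mono (sP i); apply: CS_sub.
  exact: CS_sub.
have CSC' s : CS C s `<=` C' by move=> x; exists s.
have C'_flat t : flatover (CS C t) C'.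
  apply: flatover_local; first exact: CSC'.
  move=> n v /C'_tuple[s sv]; exists (CS C (s ++ t)); split=> //.
  by apply: allin_sub sv; rewrite CS_cat; apply: CS_mono; apply: CS_sub.
have CC' : C `<=` C' := CSC' [::].
have sC' : submodS C'.
  apply: submodS_local => [|x y [s sx] [t ty]]; first by apply: CC'; case: sC.
  exists (CS C (s ++ t)); split=> //; rewrite CS_cat; last exact: CS_sub.
  by apply: CS_mono sx; apply: CS_sub.
exists C'; split=> //.
- split=> //.
  + exact: flatin_flatover sC sC' fC (C'_flat [::]).
  + pose d (c : Lam * seq (ext_index * A)) : W := e c.1 + \sum_(pa <- c.2) theta pa.1 pa.2.
    have [n0 _] := natLam.
    apply: (@atmost_image _ _ _ (n0 0%N, [::]) d).
      apply: (inject_trans _ (inject_square natLam)); apply: inject_prod (inject_refl _) _.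
      apply: (inject_trans _ (inject_seq natLam)).
      have [c ci] : inject (ext_index * A) Lam.
        apply: (inject_trans _ (inject_square natLam)).
        by apply: inject_prod => //; apply: ext_index_inject.
      by exists (map c); exact: (inj_map ci).
    move=> x [s]; elim: s x => [|p s IHs] x /=.
      by move=> /eC[l _ <-]; exists (l, [::]) => //; rewrite /d big_nil addr0.
    move=> [c [a [/IHs[[l r] _ <-] ->]]]; exists (l, (p, a) :: r) => //.
    by rewrite /d big_cons addrA addrAC -addrA.
  + move=> x z [s sx] nVz; apply: contrapT => /(CS_supp _ _ _ sx)[Vz|[p [a [_ za]]]].
      by apply: nVz; left.
    by apply: nVz; right; exists (p, a).
- exact: C'_flat [::].
- move=> L h sL fL hl hC.
  have /choice[u uP] : forall a, exists l, L a -> e l = h a.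
    move=> a; have [La|nLa] := pselect (L a); last by have [n0 _] := natLam; exists (n0 0%N).
    by have [l _ el] := eC _ (hC a La); exists l.
  have [n0 _] := natLam; pose p : ext_index := ((L, u), n0 0%N).
  have vp : valid p.
    split=> //= [r x y Lx Ly|a La]; last by rewrite uP //; apply: hC.
    by rewrite /comp !uP ?hl //; apply: sL.2.
  have [t1 _ _] := thP p; have [_ _ _ _ LLp] := LLP p.
  exists (theta p); split=> [a La|a /th0|a|].
  + by rewrite t1 //= uP.
  + by rewrite LLp.
  + exists [:: p]; apply: adjoin_range; case: sC => //.
  + apply: flatover_purein => //; first exact: (CS_submod [:: p]).
    exact: (C'_flat [:: p]).
(* The free extensions, with [L = 0], are indexed by [Lam]. *)
- have [l0 _ el0] : range e 0 by apply: eC; case: sC.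
  pose p c : ext_index := ((fun a => a = 0, fun=> l0), c).
  have vp c : valid (p c).
    have s0 : submodS (fun a : A => a = 0) by split=> // r x y -> ->; rewrite scaler0 addr0.
    split=> //=.
    + apply: flatin_purein_flatover => //; last by apply/flatP.
      split=> // m n X u u0 [w _ Xw]; exists 0; first exact: allin0.
      by rewrite mact0; apply/funext => i; rewrite u0.
    + by move=> r x y _ _; rewrite /= el0 scaler0 addr0.
    + by move=> a _; rewrite el0; case: sC.
  have inC' c : C' (theta (p c) a0) by exists [:: p c]; apply: adjoin_range; case: sC.
  exists (fun c => exist _ _ (inC' c)) => c c' [cc']; apply: contrapT => ncc'.
  have [_ _ _ h LLp] := LLP (p c); apply: a0_neq0.
  rewrite LLp // in h; apply: h => a'; rewrite cc'; apply: contrapT => nz.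
  have [_ /(_ _ _ nz)[/iV //|[a'' /iinj pp]] _] := thP (p c').
  by apply: ncc'; case: pp.
Qed.

End ExtensionStep.

Section FlatChain.
Variables (R : pzRingType) (Lam : Type) (Z : Type).
Hypothesis natLam : inject nat Lam.
Variables (I : Type) (lt : I -> I -> Prop).
Hypotheses (wf : well_founded lt) (lt_trans : forall i j k, lt i j -> lt j k -> lt i k)
  (lt_total : forall i j, [\/ lt i j, i = j | lt j i]) (ILam : inject I Lam).

Local Notation W := (Z -> injcog R).

(** Chains of small flat submodules of [W], with the layer [V1 i] of coordinates
    reserved for the step [i]. *)
Lemma flat_chain (V0 : set Z) (V1 : I -> set Z) (B : set W) (Q : I -> set W -> set W -> Prop) :
  let D (J : set I) (h : I -> set W) := B `|` \bigcup_(j in J) h j in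
  let below i := [set j | lt j i] in
  let V (J : set I) := V0 `|` \bigcup_(j in J) V1 j in
  good Lam V0 B ->
  (forall i C, good Lam (V (below i)) C ->
    exists E, [/\ good Lam (V (below i) `|` V1 i) E, flatover C E & Q i C E]) ->
  exists h : I -> set W,
    [/\ forall i, good Lam (V (below i)) (D (below i) h) /\
          forall j, lt j i -> flatover (h j) (D (below i) h),
        forall i, [/\ submodS (h i), flatover (D (below i) h) (h i) & Q i (D (below i) h) (h i)],
        good Lam (V setT) (D setT h), flatover B (D setT h) &
        forall j, flatover (h j) (D setT h)].
Proof.
move=> D below V gB step.
pose le (S S' : set W) := submodS S' /\ flatover S S'.
pose Plt (J : set I) (S : set W) := good Lam (V J) S.
pose Ple i (S : set W) := good Lam (V (below i) `|` V1 i) S.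
have [|J h Jdown hP hch|i C gC|h [h1 h2 [h3 h4 h5]]] :=
  @transfinite_chain I W lt B le Plt Ple Q wf lt_trans.
- move=> X Y S [sY fXY] [sS fYS]; split=> //.
  by apply: flatover_trans fYS => //; case: fXY.
- rewrite -/(D J h).
  pose F : set (set W) := [set T | T = B \/ exists2 j, J j & T = h j].
  have FD T : F T -> T `<=` D J h by move=> [->|[j Jj ->]] x Tx; [left|right; exists j].
  have Fch : total_on F subset.
    have Bh j : J j -> B `<=` h j by move=> Jj; have [_ [_ []]] := hP j Jj.
    have hh j k : J j -> J k -> lt j k -> h j `<=` h k.
      by move=> Jj Jk jk; have [_ []] := hch j k Jj Jk jk.
    move=> S S' [->|[j Jj ->]] [->|[k Jk ->]]; [by left|by left; exact: Bh|by right; exact: Bh|].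
    by have [jk|->|kj] := lt_total j k; [left; exact: hh|left|right; exact: hh].
  have tuple n (v : 'I_n -> W) : allin (D J h) v -> exists2 T, F T & allin T v.
    move=> Dv; apply: finite_in_chain => // [|i]; first by exists B; left.
    by have [Bv|[j Jj hv]] := Dv i; [exists B => //; left|exists (h j) => //; right; exists j].
  have stage T : F T -> [/\ submodS T, flatin T & flatover B T].
    move=> [->|[j Jj ->]]; first by case: gB => sB fB _ _; split=> //; exact: flatover_refl.
    by have [[sh fh _ _] [_ fBh]] := hP j Jj.
  have sD : submodS (D J h).
    apply: submodS_local => [|x y Dx Dy]; first by left; case: gB => -[].
    have [|T FT Tv] := tuple 2%N (fun i => if i == ord0 then x else y); first by move=> i; case: eqP.
    exists T; split; [by case: (stage T FT)|exact: FD|exact: Tv ord0|exact: Tv ord_max].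
  have gD : good Lam (V J) (D J h).
    split=> //.
    + apply: flatin_local => n v /tuple[T FT Tv].
      by exists T; split=> //; [case: (stage T FT)|exact: FD].
    + have /choice[e eP] : forall j, exists e : Lam -> W, J j -> h j `<=` range e.
        move=> j; have [Jj|nJ] := pselect (J j); last by exists (fun=> 0).
        by have [[_ _ [e he] _] _] := hP j Jj; exists e.
      have [_ _ [eB BeB] _] := gB; have [n0 _] := natLam.
      apply: (@atmost_image _ _ (Lam + I * Lam)%type (inl (n0 0%N))
        (fun c => match c with inl l => eB l | inr (j, l) => e j l end)).
        apply: inject_sum natLam (inject_refl _) _.
        by apply: inject_trans (inject_square natLam); apply: inject_prod ILam (inject_refl _).
      move=> x [/BeB[l _ <-]|[j Jj /(eP j Jj)[l _ <-]]]; first by exists (inl l).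
      by exists (inr (j, l)).
    + move=> x z [Bx|[j Jj hx]] nV.
        by case: gB => _ _ _; apply=> //; move=> Vz; apply: nV; left.
      have [[_ _ _ supp] _] := hP j Jj; apply: supp hx _ => -[[Vz|[k kj Vz]]|Vz]; apply: nV.
      * by left.
      * by right; exists k => //; apply: Jdown kj.
      * by right; exists j.
  have sub_flat T : F T -> flatover T (D J h).
    move=> FT; apply: flatover_local => [|n v Dv]; first exact: FD.
    have [T' FT' Tv] := tuple n v Dv.
    have [|T'T] : flatover T T' \/ T' `<=` T.
      case: FT => [->|[j Jj ->]]; first by have [_ _] := stage T' FT'; left.
      case: FT' => [->|[k Jk ->]]; first by right; have [_ [_ [BS _]]] := hP j Jj.
      have [jk|->|kj] := lt_total j k; first by left; have [] := hch j k Jj Jk jk.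
        by right.
      by right; have [_ []] := hch k j Jk Jj kj.
    + by exists T'; split=> //; exact: FD.
    + by exists T; split; [exact: flatover_refl|exact: FD|exact: allin_sub T'T Tv].
  split=> //.
    by split=> //; apply: sub_flat; left.
  by move=> j Jj; split=> //; apply: sub_flat; right; exists j.
- have [E [gE fCE QE]] := step i C gC; exists E; split=> //; split=> //.
  by case: gE.
exists h; split=> //.
- move=> i; have [gD _ hD] := h1 i; split=> // j ji.
  by have [] := hD j ji.
- by move=> i; have [[sh fh] _ Qh] := h2 i.
- by case: h4.
- by move=> j; have [] := h5 j.
Qed.

End FlatChain.

Section Graphs.
Variables (R : pzRingType) (N W : lmodType R).

Definition graph_dom (G : set (N * W)) : set N := [set s | exists y, G (s, y)].

(** Graphs of pure embeddings into [U], with values in [C], defined on pure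
    submodules of [N]. *)
Definition pure_graph (U C : set W) (G : set (N * W)) : Prop :=
  [/\ submodS G, forall y, G (0, y) -> y = 0, forall p, G p -> C p.2,
      purein (graph_dom G) setT &
      forall m n (X : 'M[R]_(m, n)) v w, allin G v -> allin U w -> mact X w = snd \o v ->
        exists w', mact X w' = fst \o v].

Lemma graph_dom_submodS G : submodS G -> submodS (graph_dom G).
Proof.
move=> [G0 Gl]; split=> [|r x y [x' Gx] [y' Gy]]; first by exists 0.
by exists (r *: x' + y'); exact: Gl Gx Gy.
Qed.

Lemma pure_graph_bigcup (I : Type) (lt : I -> I -> Prop) (J : set I) (U C : set W) (B : set (N * W))
    (h : I -> set (N * W)) : (forall i j, [\/ lt i j, i = j | lt j i]) ->
  pure_graph U C B -> (forall j, J j -> pure_graph U C (h j)) -> (forall j, J j -> B `<=` h j) ->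
  (forall j k, J j -> J k -> lt j k -> h j `<=` h k) ->
  pure_graph U C (B `|` \bigcup_(j in J) h j).
Proof.
move=> lt_total pB ph Bh hh; set G := B `|` _.
pose F : set (set (N * W)) := [set T | T = B \/ exists2 j, J j & T = h j].
have Fpure T : F T -> pure_graph U C T by move=> [->//|[j Jj ->]]; apply: ph.
have FG T : F T -> T `<=` G by move=> [->|[j Jj ->]] x Tx; [left|right; exists j].
have Fch : total_on F subset.
  move=> S S' [->|[j Jj ->]] [->|[k Jk ->]]; [by left|by left; exact: Bh|by right; exact: Bh|].
  by have [jk|->|kj] := lt_total j k; [left; exact: hh|left|right; exact: hh].
have tuple n (v : 'I_n -> N * W) : allin G v ->
    exists T, [/\ pure_graph U C T, T `<=` G & allin T v].
  move=> Gv; have [||T FT Tv] := @finite_in_chain _ F n v _ Fch.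
  - by exists B; left.
  - by move=> i; have [Bv|[j Jj hv]] := Gv i; [exists B => //; left|exists (h j) => //; right; exists j].
  - by exists T; split=> //; [exact: Fpure|exact: FG].
have one p : G p -> exists T, [/\ pure_graph U C T, T `<=` G & T p].
  move=> Gp; have [|T [pT TG Tp]] := tuple 1%N (fun=> p); first by [].
  by exists T; split=> //; exact: Tp ord0.
split.
- apply: submodS_local => [|x y Gx Gy]; first by left; case: pB => -[].
  have [|T [[sT _ _ _ _] TG Tv]] := tuple 2%N (fun i => if i == ord0 then x else y).
    by move=> i; case: eqP.
  by exists T; split=> //; [exact: Tv ord0|exact: Tv ord_max].
- by move=> y /one[T [[_ T0 _ _ _] _ /T0]].
- by move=> p /one[T [[_ _ TC _ _] _ /TC]].
- split=> // m n X u Gu [w _ Xw].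
  have /choice[y uy] : forall i, exists y, G (u i, y) by move=> i; apply: Gu.
  have [|T [[_ _ _ [_ pT] _] TG Tv]] := tuple m (fun i => (u i, y i)) => //.
  have [||w' Tw' Xw'] := pT _ _ X u; first by move=> i; exists (y i); apply: Tv.
    by exists w.
  by exists w' => // j; have [y' Ty'] := Tw' j; exists y'; apply: TG.
- move=> m n X v w Gv Uw Xw; have [T [[_ _ _ _ rT] TG Tv]] := tuple _ v Gv.
  exact: rT Tv Uw Xw.
Qed.

End Graphs.

Section AbsorbStep.
Variables (R : pzRingType) (K : Type) (A N W : lmodType R).
Hypotheses (natK : inject nat K) (RK : inject R K)
  (liftA : forall T : set N, submodS T -> atmost K T -> exists pi : {linear A -> N}, range pi = T).

(** A pure embedding defined on [S] extends to [S + T] for a small [T] containing a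
    given element: [T] is a quotient of [A], and [S + T] the pushout of [S] along
    the preimage [L] of [S] in [A]. *)
Lemma absorb_step (U C C' : set W) (G : set (N * W)) (x : N) : flat N ->
  submodS C -> submodS C' -> C `<=` C' -> C' `<=` U -> purein C' U -> absorbs A C C' ->
  pure_graph U C G -> exists G', [/\ G `<=` G', pure_graph U C' G' & graph_dom G' x].
Proof.
move=> /flatP fN sC sC' CC' C'U pC' abs [sG G0 GC pG rG].
pose S := graph_dom G; have sS : submodS S := graph_dom_submodS sG.
have Gfun s y y' : G (s, y) -> G (s, y') -> y = y'.
  move=> Gy Gy'; apply/subr0_eq/G0; rewrite -(subrr s); exact: submodS_B sG Gy Gy'.
have /choice[f fP] : forall s, exists y, S s -> G (s, y).
  by move=> s; have [[y Gy]|nS] := pselect (S s); [exists y|exists 0].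
have xK : atmost K [set x] by exists (fun=> x) => _ ->; case: natK => n0 _; exists (n0 0%N).
have [T [xT sT TK Tp]] := small_pure_modulo natK RK sS xK.
have [pi piT] := liftA sT TK.
have piTa a : T (pi a) by rewrite -piT; exists a.
pose L := [set a | S (pi a)].
have sL : submodS L.
  by split=> [|r a b La Lb]; rewrite /L /= ?linear0 ?linearP; [case: sS|apply: sS.2].
pose ST : set N := adjoin S pi.
(* A system with right-hand side [s + t] is first solved modulo [S] in [T], and the
   error is then corrected in [S]. *)
have pST : purein ST setT.
  split=> // m n X u /adjoin_lift[s [a [Ss ->]]] [w _ Xw].
  have [||w' Tw' Xw'] := Tp _ _ X (pi \o a); first by move=> i; apply: piTa.
    by exists w => i; rewrite Xw addrK; apply: Ss.
  have [||v Sv Xv] := pG.2 _ _ X (s + (pi \o a) - mact X w').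
  - move=> i; have := submodS_B sS (Ss i) (Xw' i).
    by rewrite !fctD !fctN opprB addrA.
  - by exists (w - w') => //; rewrite mactB Xw.
  have /choice[b bw'] : forall j, exists b, pi b = w' j.
    by move=> j; have := Tw' j; rewrite -piT => -[b _ <-]; exists b.
  exists (v + w') => [j|]; first by exists (v j), (b j); split; [exact: Sv|rewrite bw'].
  by rewrite mactD Xv subrK.
have fS : flatover S setT by apply: flatin_purein_flatover.
have fL : flatover L setT.
  split=> // m n X a _ LXa.
  have [//||u [k [D [y [Su _ aE XD]]]]] := fS.2 _ _ X (pi \o a).
    by rewrite mact_linear.
  have [||y' STy' aE'] := pST.2 _ _ D ((pi \o a) - u).
  - by move=> i; rewrite fctD fctN; exists (- u i), (a i); split; [apply: submodS_N|rewrite addrC].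
  - by exists y => //; rewrite aE addrAC subrr add0r.
  have [s [b [Ss y'E]]] := adjoin_lift STy'.
  exists (a - mact D b), k, D, b; split=> //; last by rewrite subrK.
  move=> i; rewrite /L /= fctD fctN linearB -[pi (mact D b i)]/((pi \o mact D b) i) -mact_linear.
  have -> : pi (a i) - mact D (pi \o b) i = u i + mact D s i.
    have := congr1 (fun g => g i) aE'; rewrite y'E mactD !fctD fctN /= => e.
    have -> : pi (a i) = mact D s i + mact D (pi \o b) i + u i by rewrite e subrK.
    by rewrite [_ + u i]addrC addrA addrK.
  by apply: submodS_D => //; apply: mact_in.
have hl : linearS L (f \o pi).
  move=> r a b La Lb /=; rewrite linearP; apply: (Gfun (r *: pi a + pi b)).
    by apply: fP; apply: sS.2.
  by apply: (sG.2 r (pi a, f (pi a)) (pi b, f (pi b))); apply: fP.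
have hC a : L a -> C ((f \o pi) a) by move=> La; apply: (GC (pi a, f (pi a))); apply: fP.
have [theta [thL thC thC' pth]] := abs L (f \o pi) sL fL hl hC.
have Gth a : L a -> G (pi a, theta a) by move=> La; rewrite thL //; apply: fP.
pose G' : set (N * W) := [set p | exists q a, G q /\ p = (q.1 + pi a, q.2 + theta a)].
have GG' : G `<=` G'.
  by move=> [s y] Gsy; exists (s, y), 0; rewrite !linear0 !addr0.
have domG' : graph_dom G' = ST.
  apply/seteqP; split=> [s [y [[s' y'] [a [Gq [-> _]]]]]|_ [s [a [[y Gy] ->]]]].
    by exists s', a; split=> //; exists y'.
  by exists (y + theta a), (s, y), a.
exists G'; split=> //; last first.
  by rewrite domG'; have := xT x erefl; rewrite -piT => -[a _ <-]; apply: adjoin_range; case: sS.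
split.
- split; first by apply: GG'; case: sG.
  move=> r _ _ [q [a [Gq ->]]] [q' [a' [Gq' ->]]].
  exists (r *: q + q'), (r *: a + a'); split; first exact: sG.2.
  rewrite !linearP [LHS](_ : _ = (r *: (q.1 + pi a) + (q'.1 + pi a'), r *: (q.2 + theta a) + (q'.2 + theta a'))) //.
  by rewrite !scalerDr; congr (_, _); rewrite addrACA.
- move=> y [[s y'] [a [/= Gs [e ->]]]].
  have pa : pi a = - s by apply/eqP; rewrite -addr_eq0 addrC -e.
  have La : L a by rewrite /L /= pa; apply: submodS_N => //; exists y'.
  by apply: G0; rewrite e; exact: submodS_D sG Gs (Gth a La).
- by move=> _ [q [a [Gq ->]]]; apply: submodS_D => //; apply/CC'/GC.
- by rewrite domG'.
- move=> m n X v w Gv Uw Xw.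
  have /choice[q /choice[a qa]] := Gv.
  have v1 : fst \o v = (fst \o q) + (pi \o a).
    by apply/funext => i; have [_ e] := qa i; rewrite /= e.
  have v2 : snd \o v = (snd \o q) + (theta \o a).
    by apply/funext => i; have [_ e] := qa i; rewrite /= e.
  have C'v : allin C' (snd \o v).
    rewrite v2; apply: allinD => // i; first by apply/CC'/GC; case: (qa i).
    exact: thC'.
  have [|w' C'w' Xw'] := pC'.2 _ _ X _ C'v; first by exists w.
  have [||w'' /adjoin_lift[c [b [Cc w''E]]] Xw''] := pth.2 _ _ X (snd \o v).
  - move=> i; exists (q i).2, (a i); split; last by rewrite v2.
    by apply: GC; case: (qa i).
  - by exists w'.
  (* The part of the system that involves [A] is moved into [L], where [theta] is
     given by the graph [G]; a system over [C] remains. *)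
  pose d := a - mact X b.
  have XcE : mact X c = (snd \o q) + (theta \o d).
    have -> : theta \o d = (theta \o a) - mact X (theta \o b).
      by rewrite mact_linear; apply/funext => i; rewrite /d /= fctD fctN linearB.
    by rewrite addrA -v2 -Xw'' w''E mactD addrK.
  have Ld i : L (d i).
    apply: thC; have -> : theta (d i) = mact X c i - (q i).2.
      by rewrite XcE fctD /= addrC addKr.
    by apply: submodS_B => //; [apply: mact_in|apply: GC; case: (qa i)].
  have [|||w0 Xw0] := rG _ _ X (fun i => q i + (pi (d i), theta (d i))) c.
  - by move=> i; apply: submodS_D => //; [case: (qa i)|apply: Gth].
  - by move=> i; apply: C'U; apply: CC'.
  - by rewrite XcE.
  exists (w0 + (pi \o b)); rewrite mactD Xw0 v1 mact_linear; apply/funext => i.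
  by rewrite !fctD /= /d fctD fctN linearB -addrA subrK.
Qed.

End AbsorbStep.

Section UniversalStep.
Variables (R : pzRingType) (K Lam : Type) (A : lmodType R) (Z : Type).
Hypotheses (natK : inject nat K) (RK : inject R K)
  (liftA : forall (N : lmodType R) (T : set N), submodS T -> atmost K T ->
     exists pi : {linear A -> N}, range pi = T).
Hypotheses (natLam : inject nat Lam) (ALam : inject A Lam) (funLam : inject (A -> Lam) Lam)
  (setLam : inject (A -> Prop) Lam) (flatA : flat A) (a0 : A) (a0_neq0 : a0 <> 0).

Local Notation W := (Z -> injcog R).
Local Notation ext_index := (ext_index Lam A).

Lemma mact_linearS (M N : lmodType R) (S : set M) (h : M -> N) m n (X : 'M[R]_(m, n)) v :
  submodS S -> linearS S h -> allin S v -> mact X (h \o v) = h \o mact X v.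
Proof.
move=> sS hl Sv; apply/funext => i; rewrite /mact /=.
suff [] : S (\sum_j X i j *: v j) /\ \sum_j X i j *: h (v j) = h (\sum_j X i j *: v j) by [].
apply: (big_ind2 (fun x y => S x /\ y = h x)) => [|x y x' y' [Sx ->] [Sx' ->]|j _].
- by split; [case: sS|rewrite (linearS0 sS hl)].
- split; first exact: submodS_D.
  by rewrite -[x]scale1r hl // !scale1r.
- by split; [apply: submodS_Z|rewrite (linearSZ _ sS hl)].
Qed.

(** Universality of [U] over [C], in terms of a map [g] that is a pure embedding of
    [C] into [N]. *)
Definition universal_set (C U : set W) : Prop :=
  forall (N : lmodType R) (g : W -> N), flat N -> atmost Lam [set: N] -> linearS C g ->
    (forall m n (X : 'M[R]_(m, n)) v w, allin C v -> mact X w = g \o v ->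
      exists2 w', allin C w' & mact X w' = v) ->
  exists F : {linear N -> W}, [/\ forall x, U (F x), forall c, C c -> F (g c) = c &
    forall m n (X : 'M[R]_(m, n)) v w, allin U w -> mact X w = F \o v ->
      exists w', mact X w' = v].

(** A chain of [Lam] extension steps: an extension of [C] of cardinality [Lam] is
    embedded by treating its elements in a sequence of type [Lam]. *)
Lemma universal_step (V : set Z) (iota : Lam * (ext_index * A) -> Z) (C : set W) :
  injective iota -> (forall p, ~ V (iota p)) -> good Lam V C ->
  exists U, [/\ good Lam (V `|` range iota) U, flatover C U, universal_set C U &
    inject Lam {x | U x}].
Proof.
move=> iinj iV gC.
pose T : choiceType := HB.pack_for choiceType Lam (gen_eqMixin Lam) (gen_choiceMixin Lam).
have [Rel Rwo] := well_ordering_principle T.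
pose I := wotype Rwo; pose lt (i j : I) := (i < j)%O.
have wf : well_founded lt by apply: order_wf; exact: Rwo.
have ltt i j k : lt i j -> lt j k -> lt i k by apply: lt_trans.
have ltotal i j : [\/ lt i j, i = j | lt j i].
  by rewrite /lt; case: (ltgtP i j) => h; [constructor 1|constructor 3|constructor 2].
have [|h [h1 h2 h3 h4 h5]] := @flat_chain R Lam Z natLam I lt wf ltt ltotal (inject_refl _)
  V (fun i => range (fun p => iota (i : Lam, p))) C
  (fun _ D E => absorbs A D E /\ inject Lam {x | E x}) gC.
  move=> i D gD.
  have [|p|E [gE DE fDE aDE LE]] := @extension_step R Lam A Z natLam ALam funLam setLam flatA
     a0 a0_neq0 _ (fun p => iota (i : Lam, p)) D _ _ gD.
  - by move=> p q /iinj[].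
  - move=> [Vp|[j ji [q _ /iinj[ij _]]]]; first exact: iV Vp.
    by move: ji; rewrite /= ij /lt ltxx.
  - by exists E.
set D := fun J => C `|` \bigcup_(j in J) h j in h1 h2 h3 h4 h5.
pose U := D setT; exists U; split=> //.
- case: h3 => sU fU LU suppU; split=> // x z Ux nV; apply: suppU Ux _ => -[Vz|[j _ [p _ pz]]].
    by apply: nV; left.
  by apply: nV; right; exists (j : Lam, p).
- move=> N g fN [en enP] gl gp.
  pose B : set (N * W) := [set p | C p.2 /\ p.1 = g p.2].
  have sC : submodS C by case: gC.
  have sU : submodS U by case: h3.
  have pB J : pure_graph U (D J) B.
    split.
    + split; first by split; [case: sC|rewrite /= (linearS0 sC gl)].
      move=> r [x y] [x' y'] [/= Cy ->] [/= Cy' ->]; split=> /=; first exact: sC.2.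
      by rewrite gl.
    + move=> y [/= Cy gy]; have [|w' _] := gp 1%N 0%N 0 (fun=> y) (fun=> 0) (fun=> Cy).
        by rewrite mact0l; apply/funext => i /=; rewrite -gy.
      by rewrite mact0l => /(congr1 (fun f => f ord0)) <-.
    + by move=> p [Cp _]; left.
    + split=> // m n X u Bu [w _ Xw].
      have /choice[y yP] : forall i, exists y, B (u i, y) by move=> i; apply: Bu.
      have [||w' Cw' Xw'] := gp _ _ X y w; first by move=> i; case: (yP i).
        by rewrite Xw; apply/funext => i; case: (yP i).
      exists (g \o w') => [j|]; first by exists (w' j); split=> //; exact: Cw'.
      rewrite (mact_linearS _ sC gl) // Xw'; apply/funext => i.
      by have [_ /= ->] := yP i.
    + move=> m n X v w Bv Uw Xw.
      have pCU : purein C U by apply: flatover_purein.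
      have [||w' Cw' Xw'] := pCU.2 _ _ X (snd \o v); first by move=> i; case: (Bv i).
        by exists w.
      exists (g \o w'); rewrite (mact_linearS _ sC gl) // Xw'.
      by apply/funext => i; have [_ e] := Bv i; rewrite /= e.
  have hU i : h i `<=` U by case: (h5 i).
  have pure_sub E E' G : E `<=` E' -> pure_graph U E G -> pure_graph U E' G.
    by move=> EE' [? ? GE ? ?]; split=> // p /GE/EE'.
  have [|||F [_ F2 [F3 BF FF]]] := @transfinite_chain I (N * W) lt B subset
    (fun J G => pure_graph U (D J) G) (fun i G => pure_graph U (h i) G)
    (fun i _ G => graph_dom G (en i)) wf ltt.
  - by move=> X Y S; apply: subset_trans.
  - move=> J F Jdown FP Fch; split.
    + apply: (pure_graph_bigcup (lt := lt)) => // [j Jj|j Jj]; last by case: (FP j Jj).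
      by apply: pure_sub (FP j Jj).1 => x hx; right; exists j.
    + by move=> x Bx; left.
    + by move=> j Jj x Fx; right; exists j.
  - move=> i G pG; have [gD _] := h1 i; have [shi fD [aD _]] := h2 i.
    have sD : submodS (D [set j | lt j i]) by case: gD.
    have [|G' [GG' pG' Gx]] := absorb_step natK RK (liftA (N := N)) (en i) fN sD shi fD.1 (hU i) _ aD pG.
      by apply: flatover_purein.
    by exists G'.
  - move: F3; set G := (G in pure_graph U _ G) => -[sG G0 GU pG rG].
    have Gfun s y y' : G (s, y) -> G (s, y') -> y = y'.
      move=> Gy Gy'; apply/subr0_eq/G0; rewrite -(subrr s); exact: submodS_B sG Gy Gy'.
    have /choice[f fP] : forall x, exists y, G (x, y).
      move=> x; have [l _ <-] := enP x Logic.I.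
      by have [_ _ [y Fy]] := F2 l; exists y; apply: (FF l).
    have [f' f'E] : exists f' : {linear N -> W}, f' = f :> (N -> W).
      apply: linear_ext => r x y; apply: (Gfun (r *: x + y)) => //.
      exact: (sG.2 r (x, f x) (y, f y) (fP x) (fP y)).
    exists f'; rewrite f'E; split=> [x|c Cc|m n X v w Uw Xw].
    + exact: (GU (x, f x)).
    + by apply: (Gfun (g c)) => //; apply: BF.
    + exact: (rG _ _ X (fun i => (v i, f (v i))) w).
- have [n0 _] := natLam; pose i0 : I := n0 0%N.
  have [_ _ [_ [c ci]]] := h2 i0; have [hU _] := h5 i0.
  exists (fun l => exist _ (sval (c l)) (hU _ (svalP (c l)))) => l l' [cl].
  exact/ci/sval_inj.
Qed.

End UniversalStep.

(** * Existence of limit models *)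

Section Transport.
Variables (R : pzRingType) (N W : lmodType R) (f : {linear N -> W}).
Hypothesis finj : injective f.

Definition inv_image (S : set W) : set N := [set x | S (f x)].

Lemma inv_image_submodS S : submodS S -> submodS (inv_image S).
Proof.
move=> sS; split=> [|r x y Sx Sy]; first by rewrite /inv_image /= linear0; case: sS.
by rewrite /inv_image /= linearP; apply: sS.2.
Qed.

Lemma lift_tuple S n (v : 'I_n -> W) : S `<=` range f -> allin S v ->
  exists2 u, allin (inv_image S) u & f \o u = v.
Proof.
move=> Sf Sv; have /choice[u uP] : forall i, exists x, f x = v i.
  by move=> i; have [x _ fx] := Sf _ (Sv i); exists x.
exists u => [i|]; first by rewrite /inv_image /= uP.
by apply/funext => i; exact: uP.
Qed.

Lemma comp_linear_inj n (u v : 'I_n -> N) : f \o u = f \o v -> u = v.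
Proof. by move=> uv; apply/funext => i; apply: finj; apply: (congr1 (fun g => g i) uv). Qed.

Lemma inv_image_flatin S : S `<=` range f -> flatin S -> flatin (inv_image S).
Proof.
move=> Sf fS m n X v Sv Xv.
have [//||k [D [y [Sy vE XD]]]] := fS _ _ X (f \o v).
  by rewrite mact_linear Xv; apply/funext => i; rewrite -[RHS](linear0 f).
have [y' Sy' y'y] := lift_tuple Sf Sy.
exists k, D, y'; split=> //; apply: comp_linear_inj.
by rewrite -mact_linear y'y.
Qed.

Lemma image_flatin : flatin [set: N] -> flatin (range f).
Proof.
move=> fN m n X v Sv Xv.
have [u _ uv] := lift_tuple (@subset_refl _ _) Sv.
have [//||k [D [y [_ uE XD]]]] := fN _ _ X u.
  apply: comp_linear_inj; rewrite -mact_linear uv Xv.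
  by apply/funext => i; rewrite -[LHS](linear0 f).
exists k, D, (f \o y); split=> [i||//]; first by exists (y i).
by rewrite mact_linear -uE.
Qed.

Lemma inv_image_purein S S' : S' `<=` range f -> purein S S' ->
  purein (inv_image S) (inv_image S').
Proof.
move=> S'f [SS' pS]; split=> [x|m n X u Su [w Sw Xw]]; first exact: SS'.
have [//||w' Sw' Xw'] := pS _ _ X (f \o u).
  by exists (f \o w) => //; rewrite mact_linear Xw.
have [w0 Sw0 w0w] := lift_tuple (fun x Sx => S'f x (SS' x Sx)) Sw'.
by exists w0 => //; apply: comp_linear_inj; rewrite -mact_linear w0w.
Qed.

End Transport.

Lemma inject_pred U V : inhabited U -> inject U V -> inject (U -> bool) (V -> bool).
Proof.
move=> [u0] [f fi]; have [g gK] := inject_leftinv u0 fi.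
exists (fun p v => p (g v)) => p q pq; apply/funext => u.
by rewrite -(gK u); exact: (congr1 (fun r => r (f u)) pq).
Qed.

Lemma inject_singleton U : inject U (U -> bool).
Proof.
exists (fun u v => `[< u = v >]) => u v /(congr1 (fun p => p v)).
by rewrite [RHS]asboolT // => /asboolW.
Qed.

Lemma card_eq_inject U V : inject U V -> inject V U -> [set: U] #= [set: V].
Proof. by move=> UV VU; rewrite card_eq_le; apply/andP; split; apply/card_le_setT. Qed.

Section LimitModelExists.
Variables (R : pzRingType) (K : choiceType) (Lam : Type) (d : Order.disp_t) (alpha : orderType d)
  (M : lmodType R).
Hypotheses (R_neq0 : (1 : R) <> 0) (natK : inject nat K) (RK : inject R K) (KLam : inject K Lam)
  (funLam : inject (K -> Lam) Lam) (setLam : inject (K -> Prop) Lam)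
  (MLam : inject M Lam) (alphaLam : inject alpha Lam)
  (alim : limit_ordinal alpha) (flatM : flat M).

Local Notation A := (freemod R K).
Local Notation index := (ext_index Lam A).
Local Notation Z := ((option alpha * (Lam * (index * A))) + M)%type.
Local Notation W := (Z -> injcog R).

(** The first stage is a universal extension of [M], made before the chain starts
    so that all stages have cardinality [Lam]; it uses the coordinates at [None].
    A union of stages below [i] is the stage [i], so the chain is continuous, and
    the stage that follows [i] is the [i]-th universal extension. *)
Lemma limit_model_extension : exists (N : lmodType R) (f : {linear M -> N}),
  [/\ limit_model Lam alpha N, flat N & pure_embedding f].
Proof.
have natLam : inject nat Lam := inject_trans natK KLam.
have AK : inject A K by apply: freemod_inject natK (inject_refl _) RK.
have ALam := inject_trans AK KLam.
have [c0 _] := natK.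
have precomp (Y : Type) : inject (A -> Y) (K -> Y).
  have [f fi] := AK; have [g gK] := inject_leftinv (0 : A) fi.
  exists (fun h k => h (g k)) => h h' hh'; apply/funext => a.
  by rewrite -(gK a); exact: (congr1 (fun u => u (f a)) hh').
have funALam := inject_trans (precomp Lam) funLam.
have setALam := inject_trans (precomp Prop) setLam.
have [a0 a0E] := freemod_basis R (c0 0%N).
have a0_neq0 : a0 <> 0.
  move=> a00; apply: R_neq0; have := a0E (c0 0%N); rewrite eqxx a00 => e.
  exact: esym e.
have liftA (N : lmodType R) (T : set N) : submodS T -> atmost K T ->
    exists pi : {linear A -> N}, range pi = T.
  move=> sT [e eT]; pose t k := if pselect (T (e k)) is left _ then e k else 0.
  apply: (freemod_lift_range sT (t := t)); apply/seteqP; split=> [_ [k _ <-]|x Tx].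
    by rewrite /t; case: pselect => // _; case: sT.
  by have [k _ ek] := eT x Tx; exists k => //; rewrite /t ek; case: pselect.
have step (V : set Z) o (C : set W) : (forall p, ~ V (inl (o, p))) -> good Lam V C ->
    exists U, [/\ good Lam (V `|` range (fun p => inl (o, p))) U, flatover C U,
      universal_set Lam C U & inject Lam {x | U x}].
  move=> oV gC.
  pose iota (p : Lam * (index * A)) : Z := inl (o, p).
  have iinj : injective iota by move=> p q [].
  exact: (@universal_step R K Lam A Z natK RK liftA natLam ALam funALam setALam
    (@freemod_flat R K) a0 a0_neq0 V iota C iinj oV gC).
have s0 : submodS [set 0 : M] by split=> // r x y -> ->; rewrite scaler0 addr0.
have [th thP] := power_separates s0.
have [j jE] : exists j : {linear M -> W},
    j = (fun m z => match z with inl _ => 0 | inr m' => th m m' end) :> (M -> W).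
  apply: linear_ext => r x y; apply/funext => -[p|m]; rewrite fctD scalrfctE.
    by rewrite scaler0 addr0.
  by rewrite linearP.
have jinj : injective j.
  move=> x y; rewrite jE => xy; apply/subr0_eq/(thP (x - y)).1.
  apply/funext => m; rewrite linearB fctD fctN.
  by have := congr1 (fun w : W => w (inr m)) xy => /= ->; rewrite subrr.
have gM : good Lam (range inr) (range j).
  split.
  - exact: range_submodS.
  - by apply: image_flatin => //; apply/flatP.
  - exact: (atmost_image (0 : M) MLam (@subset_refl _ (range j))).
  - move=> _ [p|m] [x _ <-] nV; first by rewrite jE.
    by case: nV; exists m.
have [|B [gB fMB _ LB]] := step (range inr) None _ _ gM; first by move=> p [].
have [wo [i0] nomax] := alim.
pose V0 : set Z := range inr `|` range (fun p => inl (None, p)).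
have ltotal (i k : alpha) : [\/ (i < k)%O, i = k | (k < i)%O].
  by case: (ltgtP i k) => ik; [constructor 1|constructor 3|constructor 2].
have [|h [h1 h2 h3 h4 h5]] := @flat_chain R Lam Z natLam alpha (fun i j => (i < j)%O)
    (order_wf wo) (fun i j k ij jk => lt_trans ij jk) ltotal alphaLam V0
    (fun i => range (fun p => inl (Some i, p))) B
    (fun _ C E => universal_set Lam C E /\ inject Lam {x | E x}) gB.
  move=> i C gC; have [|E [gE fE uE LE]] := step _ (Some i) _ _ gC; last by exists E.
  by move=> p [[[]//|[]//]|[k ki [q _ [ki' _]]]]; move: ki; rewrite /= ki' ltxx.
set D := fun J => B `|` \bigcup_(k in J) h k in h1 h2 h3 h4 h5.
pose below i := [set k : alpha | (k < i)%O].
have sD i : submodS (D (below i)) by have [[]] := h1 i.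
have sU : submodS (D setT) by case: h3.
pose N : lmodType R := subm (submod sU).
pose inc : {linear N -> W} := subm_incl (submod sU).
have incinj : injective inc by apply: subm_incl_inj.
have rangeU : D setT `<=` range inc.
  by move=> x Ux; exists (Sub x ((in_submodP sU x).2 Ux)) => //; apply: SubK.
have DU i : D (below i) `<=` D setT by move=> x [Bx|[k _ hx]]; [left|right; exists k].
have rangeD i : D (below i) `<=` range inc by move=> x /DU/rangeU.
pose C i : submodClosed N := submod (inv_image_submodS inc (sD i)).
have CE i : [set` C i] = inv_image inc (D (below i)) by apply: submodE.
have inC i x : x \in C i <-> D (below i) (inc x) by apply: in_submodP.
have Dmono i k : (i <= k)%O -> purein (D (below i)) (D (below k)).
  rewrite le_eqVlt => /orP[/eqP -> //|ik]; first exact: purein_refl.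
  have [shi fi _] := h2 i; have [_ fik] := h1 k.
  apply: (purein_trans (S' := h i)); apply: flatover_purein => //.
  exact: fik.
have cardC i : [set: subm (C i)] #= [set: Lam].
  apply: card_eq_inject.
    have [[_ _ [e eD] _] _] := h1 i.
    have /choice[f fP] : forall x : subm (C i), exists l, e l = inc (val x).
      by move=> x; have [l _ el] := eD _ ((inC i _).1 (valP x)); exists l.
    by exists f => x y fxy; apply: val_inj; apply: incinj; rewrite -!fP fxy.
  have [b bi] := LB.
  have bD l : D (below i) (sval (b l)) by left; exact: svalP.
  have /choice[g gP] : forall l, exists x : subm (C i), inc (val x) = sval (b l).
    move=> l; have [x _ xb] := rangeD i _ (bD l).
    have xC : x \in C i by apply/inC; rewrite xb.
    by exists (Sub x xC).
  by exists g => l l' gl; apply/bi/sval_inj; rewrite -!gP gl.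
have flatC i : flat (subm (C i)).
  apply/subm_flatP; rewrite CE; apply: inv_image_flatin => //.
  by have [[]] := h1 i.
have [f fE] : exists f : {linear M -> N}, inc \o f = j :> (M -> W).
  have jU m : j m \in submod sU by apply/in_submodP; apply: h4.1; apply: fMB.1; exists m.
  have [f fE] : exists f : {linear M -> N}, f = (fun m => Sub (j m) (jU m)) :> (M -> N).
    by apply: linear_ext => r x y; apply: val_inj; rewrite /= linearP.
  by exists f; rewrite fE; apply/funext => m; apply: SubK.
exists N, f; split; last first.
- apply/pure_embeddingP => m n X v w Xw.
  have pj : purein (range j) (D setT).
    apply: (purein_trans (S' := B)); apply: flatover_purein => //; first exact: range_submodS.
    - by case: gB.
    - by case: gB.
  have Xw' : mact X (inc \o w) = j \o v by rewrite mact_linear Xw -fE.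
  have [||u ju Xu] := pj.2 _ _ X (j \o v).
  + by move=> k; exists (v k).
  + by exists (inc \o w) => // k; apply/(in_submodP sU)/valP.
  have [u' _ u'u] := lift_tuple (@subset_refl _ _) ju.
  by exists u'; apply: (comp_linear_inj jinj); rewrite -mact_linear u'u.
- by apply/subm_flatP; rewrite submodE; case: h3.
split=> //; first by apply/infinite_nat_inject.
  exact/card_le_setT.
exists C; split.
- by move=> i; split.
- move=> i k ik; apply/pp_leP; first exact: submodS_closed.
  by rewrite !CE; apply: inv_image_purein => //; exact: Dmono.
- move=> i [[k0 k0i] lim] x /inC[Bx|[k ki hx]]; first by exists k0 => //; apply/inC; left.
  by have [l [kl li]] := lim k ki; exists l => //; apply/inC; right; exists k.
- move=> i k [ik ikmin].
  have DkE : D (below k) = h i.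
    apply/seteqP; split=> x; last by move=> hx; right; exists i.
    have [_ [Dh _] _] := h2 i; case=> [Bx|[l lk hx]]; first by apply: Dh; left.
    have [il|li|il] := ltgtP i l.
    + by have := ikmin l il; rewrite leNgt lk.
    + by apply: Dh; right; exists l.
    + by rewrite il.
  split.
  + apply/pp_leP; first exact: submodS_closed.
    by rewrite !CE; apply: inv_image_purein => //; apply: Dmono; exact: ltW.
  + by apply: card_eq_trans (cardC k) _; rewrite card_eq_sym.
  + move=> Ns g flatNs NsC gpure.
    have [_ _ [univ _]] := h2 i.
    have lift_C w : D (below i) w -> exists x : subm (C i), inc (val x) = w.
      move=> Dw; have [x _ xw] := rangeD i _ Dw.
      have xC : x \in C i by apply/inC; rewrite xw.
      by exists (Sub x xC).
    have /choice[lf lfP] : forall w, exists x : subm (C i), D (below i) w -> inc (val x) = w.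
      move=> w; have [Dw|nD] := pselect (D (below i) w); last by exists 0.
      by have [x xw] := lift_C w Dw; exists x.
    have [incC incCE] : exists e : {linear subm (C i) -> W}, e = inc \o val :> (subm (C i) -> W).
      by apply: linear_ext => r x y; rewrite -[LHS]/(inc (val (r *: x + y))) !linearP.
    have incCv z : incC z = inc (val z) by rewrite incCE.
    have lfK x : lf (inc (val x)) = x.
      by apply: val_inj; apply: incinj; apply: lfP; apply/inC; exact: valP.
    have NsLam : atmost Lam [set: Ns].
      have /card_le_setT NsL : [set: Ns] #<= [set: Lam].
        by apply: (card_le_trans NsC); have := cardC i; rewrite card_eq_le => /andP[].
      by apply: (atmost_image (0 : Ns) NsL (f := id)) => x _; exists x.
    have [||F [FU FK Fp]] := univ Ns (g \o lf) flatNs NsLam.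
    * move=> r x y Dx Dy /=; rewrite -linearP; congr (g _).
      apply: val_inj; apply: incinj; rewrite lfP; last exact: (sD i).2.
      by rewrite -incCv linearP !incCv !lfP.
    * move=> m n X v w Dv Xw.
      have [w' Xw'] := (pure_embeddingP g).1 gpure _ _ X (lf \o v) w Xw.
      exists (incC \o w') => [l|]; first by rewrite /= incCv; apply/inC; exact: valP.
      rewrite mact_linear Xw'; apply/funext => l.
      by rewrite /= incCv; apply: lfP; apply: Dv.
    have FC x : exists y : subm (C k), inc (val y) = F x.
      have FDk : D (below k) (F x) by rewrite DkE.
      have [y _ yF] := rangeD k _ FDk.
      have yC : y \in C k by apply/inC; rewrite yF.
      by exists (Sub y yC).
    have /choice[f' f'P] := FC.
    have [incK incKE] : exists e : {linear subm (C k) -> W}, e = inc \o val :> (subm (C k) -> W).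
      by apply: linear_ext => r x y; rewrite -[LHS]/(inc (val (r *: x + y))) !linearP.
    have incKv z : incK z = inc (val z) by rewrite incKE.
    have [F' F'E] : exists F' : {linear Ns -> subm (C k)}, F' = f' :> (Ns -> subm (C k)).
      apply: linear_ext => r x y; apply: val_inj; apply: incinj.
      by rewrite -incKv linearP !incKv !f'P linearP.
    exists F'.
      apply/pure_embeddingP => m n X v w Xw.
      apply: (Fp _ _ X v (incK \o w)) => [l|].
        by rewrite -DkE /= incKv; apply/inC; exact: valP.
      by rewrite mact_linear Xw; apply/funext => l; rewrite /= incKv F'E f'P.
    move=> x; apply: incinj; rewrite F'E f'P -[g x]/(g x) -{1}(lfK x).
    by apply: (FK (inc (val x))); apply/inC; exact: valP.
- move=> x; have [Bx|[k _ hx]] : D setT (inc x) by apply/(in_submodP sU)/valP.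
    by exists i0; apply/inC; left.
  by have [l kl] := nomax k; exists l; apply/inC; right; exists k.
Qed.

End LimitModelExists.

(** * The equivalence *)

Lemma flat_pure_embedding (R : pzRingType) (M N : lmodType R) (f : {linear M -> N}) :
  pure_embedding f -> flat N -> flat M.
Proof.
move=> /pure_embeddingP fp /flatP fN; apply/flatP => m n X v _ Xv.
have [//||k [C [y [_ vE XC]]]] := fN _ _ X (f \o v).
  by rewrite mact_linear Xv; apply/funext => i; rewrite -[RHS](linear0 f).
by have [y' y'E] := fp _ _ C v y (esym vE); exists k, C, y'; split.
Qed.

Lemma trivial_ring_flat (R : pzRingType) (M : lmodType R) : (1 : R) = 0 -> flat M.
Proof.
move=> R0; apply/flatP => m n X v _ _; exists 0%N, 0, (fun=> 0); split=> //.
  by rewrite mact0l; apply/funext => i; rewrite -[v i]scale1r R0 scale0r.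
by rewrite mulmx0.
Qed.

Theorem theorem4p10 (R : pzRingType) :
  (forall (kappa_plus lambda cf : cardinal) (d : Order.disp_t)
      (alpha : orderType d) (M : lmodType R),
    is_succ_cardinal (R + nat)%type kappa_plus ->
    [set: kappa_plus] #<= [set: lambda] ->
    is_cofinality alpha cf -> [set: kappa_plus] #<= [set: cf] ->
    limit_model lambda alpha M -> pure_injective M)
  <->
  (forall (M P : lmodType R) (i : {linear M -> P}),
    flat M -> pure_injective_envelope i -> flat P).
Proof.
split=> [limit_pi M P i flatM env|env_flat kappa lambda cf d alpha M]; last first.
  exact: limit_model_pure_injective.
have [R0|R_neq0] := pselect ((1 : R) = 0); first exact: trivial_ring_flat.
pose K : choiceType := (R + nat)%type.
have natK : inject nat K by exists inr => x y [].
have RK : inject R K by exists inl => x y [].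
have [d [alpha [wo nK small]]] := succ_ordinal natK.
(* A power set of [X] contains [M] and [alpha], and satisfies
   [Lam ^ K = 2 ^ (K * X) = Lam]. *)
pose X := (K + (M + alpha))%type.
have KX : inject K X by exists inl => x y [].
have natX := inject_trans natK KX.
pose Lam : Type := X -> bool.
have XLam : inject X Lam := inject_singleton X.
have KXX : inject (K * X) X.
  exact: inject_trans (inject_prod KX (inject_refl _)) (inject_square natX).
have [n0 _] := natK.
have funLam : inject (K -> Lam) Lam.
  apply: (@inject_trans _ (K * X -> bool)).
    exists (fun f p => f p.1 p.2) => f g fg; apply/funext => k; apply/funext => x.
    exact: (congr1 (fun h => h (k, x)) fg).
  by apply: (inject_pred _ KXX); exists; exact: (n0 0%N, inl (n0 0%N)).
have setLam : inject (K -> Prop) Lam.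
  apply: (@inject_trans _ (K -> bool)).
    exists (fun A k => `[< A k >]) => A B AB; apply/funext => k; apply/propext.
    by apply: asbool_eq_equiv; have := congr1 (fun h => h k) AB.
  by apply: (inject_pred _ KX); exists; exact: n0 0%N.
have MLam : inject M Lam by apply: inject_trans XLam; exists (inr \o inl) => x y [].
have alphaLam : inject alpha Lam by apply: inject_trans XLam; exists (inr \o inr) => x y [].
have alim : limit_ordinal alpha.
  split=> // [|i0].
    apply: contrapT => na; apply: nK.
    have h (x : alpha) : False by apply: na.
    by exists (fun x => match h x with end) => x; case: (h x).
  apply: contrapT => nmax; apply: nK; apply: inject_trans (small i0).
  have le_i0 j : (j <= i0)%O.
    by rewrite leNgt; apply/negP => ij; apply: nmax; exists j.
  by exists (fun j => exist _ j (le_i0 j)) => j k [].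
have [N [f [Nlim Nflat fpure]]] :=
  limit_model_extension R_neq0 natK RK (inject_trans KX XLam) funLam setLam MLam alphaLam alim flatM.
have PIN : pure_injective N.
  apply: limit_pi Nlim.
  - split; first by apply/negP => /card_le_setT/nK.
    move=> mu /negP nmu; apply/card_le_setT/(succ_ordinal_least wo small) => muK.
    by apply: nmu; apply/card_le_setT.
  - by apply/card_le_setT.
  - split; first by exists setT => //; move=> i1; exists i1.
    move=> A cofA; have [g gi] := succ_ordinal_cofinal natK wo nK small cofA.
    have : [set: alpha] #<= [set: A].
      apply/card_le_setT; exists (fun x => exist _ (sval (g x)) (mem_set (svalP (g x)))).
      by move=> x y [] /sval_inj/gi.
    by move=> /card_le_trans; apply; have := card_setT A; rewrite card_eq_le => /andP[].
  - exact: card_lexx.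
have [_ _ envmin] := env; have [h hpure _] := envmin N f fpure PIN.
exact: flat_pure_embedding hpure Nflat.
Qed.
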